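(* Let $E/\mathbb{Q}$ be given by $y^2+a_1xy+a_3y=x^3+a_2x^2+a_4x+a_6$ with $a_i\in\mathbb{Z}$, and let $\mathbf{P}=(P_1,\ldots,P_n)$ be linearly independent points of $E(\mathbb{Q})$ such that each $P_i$ reduces to a non-singular point modulo every prime $\ell$. Define $W:\mathbb{Z}^n\to\mathbb{Q}$ by $W(\mathbf{0})=0$ and $W(\mathbf{v})=(-1)^{\mathrm{Parity}[\Psi_{\mathbf{v}}(\mathbf{P};E)]}D_{\mathbf{v}\cdot\mathbf{P}}$ for $\mathbf{v}\ne\mathbf{0}$. Then $W$ is an elliptic net.
   Context: For $\mathbf{v}\in\mathbb{Z}^n\setminus\{\mathbf 0\}$ write $\mathbf{v}\cdot\mathbf{P}=v_1P_1+\cdots+v_nP_n=(A/D^2,B/D^3)$ with $A,B,D\in\mathbb{Z}$, $D>0$, in lowest terms, and set $D_{\mathbf{v}\cdot\mathbf{P}}=D$ (the elliptic denominator net). Net polynomials: with $\Lambda$ the period lattice of $E$ over $\mathbb{C}$, $\sigma(z;\Lambda)=z\prod_{0\ne\omega\in\Lambda}(1-z/\omega)e^{z/\omega+\frac12(z/\omega)^2}$, and $z_i\in\mathbb{C}$ corresponding to $P_i$ under $\mathbb{C}/\Lambda\cong E(\mathbb{C})$, $\Psi_{\mathbf{v}}(\mathbf{P};E)=(-1)^{\sum_i v_i^2-\sum_{i<j}v_iv_j-1}\sigma(\sum_i v_iz_i;\Lambda)\big/\big(\prod_i\sigma(z_i;\Lambda)^{2v_i^2-\sum_j v_iv_j}\prod_{i<j}\sigma(z_i+z_j;\Lambda)^{v_iv_j}\big)$,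 a nonzero real number for $\mathbf{v}\ne\mathbf0$. For nonzero real $x$, $\mathrm{Parity}[x]\in\mathbb{Z}/2\mathbb{Z}$ is defined by $x/|x|=(-1)^{\mathrm{Parity}[x]}$. An elliptic net is a map $W:\mathbb{Z}^n\to R$ with $W(\mathbf0)=0$ and $W(\mathbf{p}+\mathbf{q}+\mathbf{s})W(\mathbf{p}-\mathbf{q})W(\mathbf{r}+\mathbf{s})W(\mathbf{r})+W(\mathbf{q}+\mathbf{r}+\mathbf{s})W(\mathbf{q}-\mathbf{r})W(\mathbf{p}+\mathbf{s})W(\mathbf{p})+W(\mathbf{r}+\mathbf{p}+\mathbf{s})W(\mathbf{r}-\mathbf{p})W(\mathbf{q}+\mathbf{s})W(\mathbf{q})=0$ for all $\mathbf{p},\mathbf{q},\mathbf{r},\mathbf{s}\in\mathbb{Z}^n$. *)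

(* Defs.v *)
From HB Require Import structures.
From mathcomp Require Import all_boot all_order all_algebra.
From mathcomp Require Import all_classical all_reals all_analysis.
From mathcomp Require Import Rstruct Rstruct_topology.
From mathcomp.real_closed Require Import complex.
Set Implicit Arguments. Unset Strict Implicit. Unset Printing Implicit Defensive.
Import Order.TTheory GRing.Theory Num.Theory.
Import numFieldTopology.Exports numFieldNormedType.Exports.
Local Open Scope classical_set_scope.
Local Open Scope ring_scope.

Definition CC := (complex Rdefinitions.R).
HB.instance Definition _ := GRing.Field.on CC.
HB.instance Definition _ := Num.ClosedField.on CC.
HB.instance Definition _ := PseudoPointedMetric.copy CC CC^o.

Definition cexp (z : CC) : CC :=
  Complex (expR (complex.Re z) * cos (complex.Im z))
          (expR (complex.Re z) * sin (complex.Im z)).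

Record wcoef := WCoef { a1 : int; a2 : int; a3 : int; a4 : int; a6 : int }.

Section Invariants.
Variable E : wcoef.
Definition b2 : int := a1 E ^+ 2 + 4 * a2 E.
Definition b4 : int := 2 * a4 E + a1 E * a3 E.
Definition b6 : int := a3 E ^+ 2 + 4 * a6 E.
Definition b8 : int := a1 E ^+ 2 * a6 E + 4 * a2 E * a6 E - a1 E * a3 E * a4 E
                       + a2 E * a3 E ^+ 2 - a4 E ^+ 2.
Definition c4 : int := b2 ^+ 2 - 24 * b4.
Definition c6 : int := - b2 ^+ 3 + 36 * b2 * b4 - 216 * b6.
Definition disc : int := - b2 ^+ 2 * b8 - 8 * b4 ^+ 3 - 27 * b6 ^+ 2 + 9 * b2 * b4 * b6.
End Invariants.

Inductive ecpt := EInf | EPt of rat & rat.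

Section GroupLaw.
Variable E : wcoef.
Local Notation A1 := ((a1 E)%:~R : rat).
Local Notation A2 := ((a2 E)%:~R : rat).
Local Notation A3 := ((a3 E)%:~R : rat).
Local Notation A4 := ((a4 E)%:~R : rat).
Local Notation A6 := ((a6 E)%:~R : rat).

Definition on_curve (P : ecpt) : Prop :=
  match P with
  | EInf => True
  | EPt x y => y ^+ 2 + A1 * x * y + A3 * y = x ^+ 3 + A2 * x ^+ 2 + A4 * x + A6
  end.

Definition ec_neg (P : ecpt) : ecpt :=
  match P with EInf => EInf | EPt x y => EPt x (- y - A1 * x - A3) end.

(* chord-and-tangent addition (Silverman, Alg. III.2.3) *)
Definition ec_add (P Q : ecpt) : ecpt :=
  match P, Q with
  | EInf, _ => Q
  | _, EInf => P
  | EPt x1 y1, EPt x2 y2 =>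
    if (x1 == x2) && (y1 + y2 + A1 * x2 + A3 == 0) then EInf else
    let lam := if x1 == x2
               then (3 * x1 ^+ 2 + 2 * A2 * x1 + A4 - A1 * y1) / (2 * y1 + A1 * x1 + A3)
               else (y2 - y1) / (x2 - x1) in
    let nu := if x1 == x2
              then (- x1 ^+ 3 + A4 * x1 + 2 * A6 - A3 * y1) / (2 * y1 + A1 * x1 + A3)
              else (y1 * x2 - y2 * x1) / (x2 - x1) in
    let x3 := lam ^+ 2 + A1 * lam - A2 - x1 - x2 in
    EPt x3 (- (lam + A1) * x3 - nu - A3)
  end.

Definition ec_mulz (k : int) (P : ecpt) : ecpt :=
  match k with
  | Posz m => iter m (ec_add P) EInf
  | Negz m => ec_neg (iter m.+1 (ec_add P) EInf)
  end.

Definition ec_lincomb (n : nat) (v : 'rV[int]_n) (P : 'I_n -> ecpt) : ecpt :=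
  \big[ec_add/EInf]_(i < n) ec_mulz (v ord0 i) (P i).

Definition lin_indep (n : nat) (P : 'I_n -> ecpt) : Prop :=
  forall v : 'rV[int]_n, ec_lincomb v P = EInf -> v = 0.

(* P reduces to a non-singular point of E mod the prime l: either P reduces
   to the point at infinity (l divides the denominator of x), or the partial
   derivatives of F = y^2+a1xy+a3y-x^3-a2x^2-a4x-a6 at the (l-integral)
   point (x, y) do not both vanish mod l. *)
Definition nonsing_mod (l : nat) (P : ecpt) : Prop :=
  match P with
  | EInf => True
  | EPt x y =>
    (l %| `|denq x|)%N \/
    ~~ (((l%:Z) %| numq (A1 * y - 3 * x ^+ 2 - 2 * A2 * x - A4))%Z &&
        ((l%:Z) %| numq (2 * y + A1 * x + A3))%Z)
  end.

End GroupLaw.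

(* elliptic denominator: for P = (A/D^2, B/D^3) in lowest terms, D > 0,
   i.e. the D with D^2 = denominator of x(P). (Value at O is irrelevant.) *)
Definition ell_denom (P : ecpt) : nat :=
  match P with
  | EInf => 0
  | EPt x _ => let m := `|denq x|%N in (\max_(d < m.+1 | d * d == m) d)%N
  end.

(* Lattice functions for Lambda = Z w1 + Z w2.  Lattice sums/products  *)
(* (absolutely convergent) are the limits of the partial sums/products *)
(* over the squares {m w1 + k w2 : |m|,|k| <= N}.                      *)
Section Lattice.
Variables w1 w2 : CC.

Definition latt (m k : int) : CC := m%:~R * w1 + k%:~R * w2.

Definition sq_sum (N : nat) (F : int -> int -> CC) : CC :=
  \sum_(i < N.*2.+1) \sum_(j < N.*2.+1) F (i%:Z - N%:Z) (j%:Z - N%:Z).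
Definition sq_prod (N : nat) (F : int -> int -> CC) : CC :=
  \prod_(i < N.*2.+1) \prod_(j < N.*2.+1) F (i%:Z - N%:Z) (j%:Z - N%:Z).

Definition nz (m k : int) : bool := (m != 0) || (k != 0).

Definition g2L : CC :=
  60 * lim ((fun N => sq_sum N (fun m k => if nz m k then latt m k ^- 4 else 0)) @ \oo).
Definition g3L : CC :=
  140 * lim ((fun N => sq_sum N (fun m k => if nz m k then latt m k ^- 6 else 0)) @ \oo).

Definition wp (z : CC) : CC :=
  z ^- 2 + lim ((fun N => sq_sum N (fun m k =>
        if nz m k then (z - latt m k) ^- 2 - latt m k ^- 2 else 0)) @ \oo).
Definition wp' (z : CC) : CC :=
  - 2 * lim ((fun N => sq_sum N (fun m k => (z - latt m k) ^- 3)) @ \oo).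

Definition wsigma (z : CC) : CC :=
  lim ((fun N => z * sq_prod N (fun m k =>
        if nz m k then (1 - z / latt m k) *
                       cexp (z / latt m k + (z / latt m k) ^+ 2 / 2)
        else 1)) @ \oo).

Definition in_latt (z : CC) : Prop := exists m k, z = latt m k.
End Lattice.

(* (w1, w2) is a basis of the period lattice Lambda of E: an R-basis of C
   whose lattice has invariants g2 = c4/12, g3 = c6/216, i.e. for which
   C/Lambda ~ E(C) via z |-> (wp z - b2/12, (wp' z - a1 x - a3)/2). *)
Definition period_basis (E : wcoef) (w1 w2 : CC) : Prop :=
  (forall r s : Rdefinitions.R, (r%:C)%C * w1 + (s%:C)%C * w2 = 0 -> r = 0 /\ s = 0)
  /\ g2L w1 w2 = ratr ((c4 E)%:~R / 12)
  /\ g3L w1 w2 = ratr ((c6 E)%:~R / 216).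

Definition corresponds (E : wcoef) (w1 w2 : CC) (z : CC) (P : ecpt) : Prop :=
  match P with
  | EInf => in_latt w1 w2 z
  | EPt x y =>
    ~ in_latt w1 w2 z /\
    ratr x = wp w1 w2 z - ((b2 E)%:~R / 12) /\
    ratr y = (wp' w1 w2 z - (a1 E)%:~R * ratr x - (a3 E)%:~R) / 2
  end.

Definition net_psi (n : nat) (w1 w2 : CC) (z : 'I_n -> CC) (v : 'rV[int]_n) : CC :=
  let vi := fun i : 'I_n => v ord0 i in
  (-1) ^ (\sum_(i < n) vi i ^+ 2 - \sum_(i < n) \sum_(j < n | (i < j)%N) vi i * vi j - 1)
  * wsigma w1 w2 (\sum_(i < n) (vi i)%:~R * z i)
  / ((\prod_(i < n) wsigma w1 w2 (z i) ^ (2 * vi i ^+ 2 - \sum_(j < n) vi i * vi j))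
     * \prod_(i < n) \prod_(j < n | (i < j)%N) wsigma w1 w2 (z i + z j) ^ (vi i * vi j)).

(* Parity of a nonzero real number x (here: Psi, a complex number that is
   real and nonzero): x/|x| = (-1)^Parity[x]. *)
Definition parity (x : CC) : bool := complex.Re x < 0.

Definition netW (E : wcoef) (n : nat) (P : 'I_n -> ecpt) (w1 w2 : CC)
    (z : 'I_n -> CC) (v : 'rV[int]_n) : rat :=
  if v == 0 then 0
  else (-1) ^+ parity (net_psi w1 w2 z v) * (ell_denom (ec_lincomb E v P))%:R.

Definition elliptic_net (R : comRingType) (n : nat) (W : 'rV[int]_n -> R) : Prop :=
  W 0 = 0 /\
  forall p q r s : 'rV[int]_n,
    W (p + q + s) * W (p - q) * W (r + s) * W r
    + W (q + r + s) * W (q - r) * W (p + s) * W p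
    + W (r + p + s) * W (r - p) * W (q + s) * W q = 0.

(* Main.v *)
(* Psi_v is sigma(z_v) times a quadratic map in v (the multiplicative analogue of a quadratic form), and the
   three-term identity of sigma, which follows from
     sigma(a+b) sigma(a-b) = - sigma(a)^2 sigma(b)^2 (wp a - wp b),
   makes Psi an elliptic net.  Multiplying every value of a net by a quadratic map gives a net again, so it
   suffices that |Psi_v| / D_v is a quadratic map, and that Psi_v is real.
   The sigma formula gives |Psi_{v+w} Psi_{v-w}| = |Psi_v Psi_w|^2 |x_v - x_w|.  If the duplication formula at P
   is in lowest terms, the numerators and the denominators of x(P+Q) + x(P-Q) and x(P+Q) x(P-Q) show that the
   same law D_{P+Q} D_{P-Q} = (D_P D_Q)^2 |x_P - x_Q| holds without cancellation for every Q.  Conversely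
   D_{2P} = D_P^4 |2 y_P + a1 x_P + a3| says exactly that the duplication formula at P is in lowest terms.  The
   parallelogram laws at v and at w imply this doubling law at v + w, so the lowest-terms condition passes from
   the P_i to all v.P.
   Reality is propagated from Psi_{e_i} = Psi_{e_i+e_j} = 1 by the same law: three instances express
   Psi_{v+b+c}^2 as the square of a real number, a difference of two slopes entering as the root. *)
Require Import Defs.
From HB Require Import structures.
From mathcomp Require Import all_boot all_order all_algebra.
From mathcomp Require Import all_classical all_reals all_analysis.
From mathcomp Require Import Rstruct Rstruct_topology.
From mathcomp.real_closed Require Import complex.
From mathcomp Require Import cyclic separable cyclotomic.
From mathcomp Require Import ring lra zify.
Import Order.TTheory GRing.Theory Num.Theory.
Local Open Scope ring_scope.
Import numFieldTopology.Exports numFieldNormedType.Exports.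

Local Notation R := Rdefinitions.R.
Local Notation "x %:K" := (real_complex R x : CC) (at level 2, format "x %:K").

(** * Norm and convergence *)

(** Two obstacles shape the proof. On the analytic side sigma is only a limit of finite products
    over square boxes, so its product formula has to come from estimates: for fixed b the function
    sigma(z+b) sigma(z-b) / (sigma(z)^2 sigma(b)^2) + wp(z) - wp(b) is doubly periodic, has
    removable singularities at the lattice points and vanishes at z = b, so Liouville's theorem
    makes it zero. The addition theorem and the differential equation of wp are then limits of this
    one identity, with difference quotients in place of derivatives. On the arithmetic side the
    associativity of [ec_add] is never proved: a point is determined by its complex argument, so the
    additivity of v -> v.P is inherited from C. Reality of Psi is likewise obtained algebraically,
    from the group law over Q, and not from a conjugation symmetry of the lattice. Logarithms of
    |Psi_v| / D_v turn all deductions among parallelogram laws into linear arithmetic. *)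

Definition nm (z : CC) : R := ComplexField.Normc.normc z.

(** The norm of [CC] takes its values in [CC] itself; this is the bridge to a real-valued modulus,
    on which linear arithmetic over the reals is available. *)
Lemma nmE (z : CC) : `|z| = (nm z)%:K.
Proof. by rewrite normc_def /nm; case: z. Qed.

Lemma lecK (x y : R) : (x%:K <= y%:K) = (x <= y).
Proof. by rewrite lecR. Qed.

Lemma nm_ge0 z : 0 <= nm z.
Proof. by rewrite -lecK -nmE normr_ge0. Qed.

Lemma nm0 : nm 0 = 0. Proof. exact: ComplexField.Normc.normc0. Qed.
Lemma nm1 : nm 1 = 1. Proof. exact: ComplexField.Normc.normc1. Qed.
Lemma nm_eq0 z : (nm z == 0) = (z == 0).
Proof.
apply/eqP/eqP => [|->]; last exact: nm0.
exact: ComplexField.Normc.eq0_normc.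
Qed.
Lemma nm_gt0 z : (0 < nm z) = (z != 0).
Proof. by rewrite lt0r nm_ge0 andbT nm_eq0. Qed.
Lemma nmM x y : nm (x * y) = nm x * nm y.
Proof. exact: ComplexField.Normc.normcM. Qed.
Lemma nmV x : nm x^-1 = (nm x)^-1.
Proof. exact: ComplexField.Normc.normcV. Qed.
Lemma nmN x : nm (- x) = nm x.
Proof. exact: normcN. Qed.
Lemma nmX x n : nm (x ^+ n) = nm x ^+ n.
Proof. by elim: n => [|n ih]; rewrite ?expr0 ?nm1 // !exprS nmM ih. Qed.
Lemma nmD x y : nm (x + y) <= nm x + nm y.
Proof. exact: le_normcD. Qed.
Lemma nmB x y : nm (x - y) <= nm x + nm y.
Proof. by rewrite -(nmN y); exact: nmD. Qed.
Lemma nmBC x y : nm (x - y) = nm (y - x).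
Proof. by rewrite -nmN opprB. Qed.
Lemma nm_tri y x z : nm (x - z) <= nm (x - y) + nm (y - z).
Proof. by rewrite -(subrKA y x (- z)); exact: nmD. Qed.
Lemma nm_ge_sub x y : nm x - nm y <= nm (x - y).
Proof. by rewrite lerBlDr -{1}(subrK y x) nmD. Qed.
Lemma nm_ge_add x y : nm x - nm y <= nm (x + y).
Proof. by have := nm_ge_sub x (- y); rewrite opprK nmN. Qed.
Lemma nm_real (x : R) : nm x%:K = `|x|.
Proof. by rewrite /nm /= expr0n /= addr0 sqrtr_sqr. Qed.
Lemma nm_nat n : nm n%:R = n%:R.
Proof.
have -> : (n%:R : CC) = (n%:R : R)%:K by rewrite rmorph_nat.
by rewrite nm_real ger0_norm.
Qed.
Lemma nm_sum (I : Type) (r : seq I) (P : pred I) (F : I -> CC) :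
  nm (\sum_(i <- r | P i) F i) <= \sum_(i <- r | P i) nm (F i).
Proof.
elim/big_ind2 : _ => //; first by rewrite nm0.
by move=> x1 x2 y1 y2 h1 h2; apply: le_trans (nmD _ _) _; apply: lerD.
Qed.
Lemma nm_prod (I : Type) (r : seq I) (P : pred I) (F : I -> CC) :
  nm (\prod_(i <- r | P i) F i) = \prod_(i <- r | P i) nm (F i).
Proof. by elim/big_rec2: _ => [|i x y _ <-]; rewrite ?nm1 ?nmM. Qed.

Lemma nm_Re z : `|complex.Re z| <= nm z.
Proof.
case: z => a b; rewrite /nm /= -sqrtr_sqr ler_sqrt ?lerDl ?sqr_ge0 //.
by rewrite addr_ge0 ?sqr_ge0.
Qed.
Lemma nm_Im z : `|complex.Im z| <= nm z.
Proof.
case: z => a b; rewrite /nm /= -sqrtr_sqr ler_sqrt ?lerDr ?sqr_ge0 //.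
by rewrite addr_ge0 ?sqr_ge0.
Qed.
Lemma nm_le_ReIm z : nm z <= `|complex.Re z| + `|complex.Im z|.
Proof.
case: z => a b /=; rewrite /nm /=.
rewrite -[leRHS]ger0_norm ?addr_ge0 // -sqrtr_sqr ler_sqrt ?sqr_ge0 //.
rewrite sqrrD !real_normK ?num_real // -addrA lerD2l lerDr.
by rewrite mulrn_wge0 // mulr_ge0.
Qed.

(** Convergence is kept in explicit form, since rates and uniformity matter later; [tends_lim] is
    the bridge to [lim]. *)
Definition tends (u : nat -> CC) (l : CC) : Prop :=
  forall e : R, 0 < e -> exists N, forall n, (N <= n)%N -> nm (u n - l) <= e.

Lemma tends_lim u l : tends u l -> lim (u @ \oo)%classic = l.
Proof.
move=> h; apply: (@cvg_lim CC); first exact: (@norm_hausdorff _ CC^o).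
(* The tolerance is a positive element of [CC], which forces its imaginary part to be zero. *)
apply/(@cvgrPdist_le _ CC^o) => -[a b]; rewrite ltcE /= => /andP[/eqP b0 a0].
have [N hN] := h _ a0.
exists N => // n /= Nn; rewrite distrC.
rewrite -[X in X <= _]/(`|(u n - l : CC)|) nmE.
have -> : Complex a b = a%:K by rewrite b0.
by rewrite lecK; exact: hN.
Qed.

Lemma nm_small z : (forall e : R, 0 < e -> nm z <= e) -> z = 0.
Proof.
move=> h; apply/eqP; rewrite -nm_eq0; apply/negPn/negP => nz.
have z0 : 0 < nm z by rewrite lt0r nz nm_ge0.
have := h (nm z / 2) ltac:(lra); lra.
Qed.

Lemma tends_uniq u l l' : tends u l -> tends u l' -> l = l'.
Proof.
move=> h h'; apply/eqP; rewrite -subr_eq0; apply/eqP/nm_small => e e0.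
have [N hN] := h (e / 2) ltac:(lra); have [M hM] := h' (e / 2) ltac:(lra).
have := hN (maxn N M) (leq_maxl _ _); have := hM (maxn N M) (leq_maxr _ _).
have := nm_tri (u (maxn N M)) l l'; rewrite (nmBC l (u _)); lra.
Qed.

Lemma tends_ext u v l : (forall n, u n = v n) -> tends u l -> tends v l.
Proof. by move=> e h d /h[N hN]; exists N => n /hN; rewrite e. Qed.

Lemma tends_cst c : tends (fun=> c) c.
Proof. by move=> e e0; exists 0%N => n _; rewrite subrr nm0 ltW. Qed.

Lemma tendsD u v l m : tends u l -> tends v m -> tends (fun n => u n + v n) (l + m).
Proof.
move=> h h' e e0.
have [N hN] := h (e / 2) ltac:(lra); have [M hM] := h' (e / 2) ltac:(lra).
exists (maxn N M) => n; rewrite geq_max => /andP[/hN a /hM b].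
have -> : u n + v n - (l + m) = (u n - l) + (v n - m) by ring.
by have := nmD (u n - l) (v n - m); lra.
Qed.

Lemma tends_bounded u l : tends u l -> exists K : R, 0 < K /\ exists N, forall n, (N <= n)%N -> nm (u n) <= K.
Proof.
move=> /(_ 1 ltac:(lra)) [N hN]; exists (nm l + 1); split; first by have := nm_ge0 l; lra.
exists N => n /hN; have := nmD (u n - l) l; rewrite subrK; lra.
Qed.

Lemma tendsM u v l m : tends u l -> tends v m -> tends (fun n => u n * v n) (l * m).
Proof.
move=> h h' e e0.
have [K [K0 [N0 hK]]] := tends_bounded _ _ h.
have mp := nm_ge0 m.
have L0 : 0 < nm m + 1 by lra.
have [N hN] := h (e / 2 / (nm m + 1)) ltac:(by rewrite !divr_gt0).
have [M hM] := h' (e / 2 / K) ltac:(by rewrite !divr_gt0).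
exists (maxn N0 (maxn N M)) => n; rewrite !geq_max => /and3P[/hK k /hN a /hM b].
have -> : u n * v n - (l * m) = (u n - l) * m + u n * (v n - m) by ring.
apply: le_trans (nmD _ _) _; rewrite !nmM.
have -> : e = e / 2 + e / 2 by field.
apply: lerD.
  move: a; rewrite ler_pdivlMr // mulrDr mulr1; have := nm_ge0 (u n - l); lra.
move: b; rewrite ler_pdivlMr // mulrC => b; apply: le_trans b.
by rewrite ler_wpM2r ?nm_ge0.
Qed.

Lemma tendsZ c u l : tends u l -> tends (fun n => c * u n) (c * l).
Proof. exact: (tendsM _ _ _ _ (tends_cst c)). Qed.

Lemma tendsN u l : tends u l -> tends (fun n => - u n) (- l).
Proof.
move=> h; rewrite -mulN1r; apply: tends_ext (tendsZ (-1) _ _ h) => n.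
by rewrite mulN1r.
Qed.

Lemma tendsB u v l m : tends u l -> tends v m -> tends (fun n => u n - v n) (l - m).
Proof. by move=> h /tendsN; apply: tendsD. Qed.

Lemma tendsX u l k : tends u l -> tends (fun n => u n ^+ k) (l ^+ k).
Proof.
move=> h; elim: k => [|k ih]; first by rewrite expr0; exact: tends_cst.
by rewrite exprS; apply: tends_ext (tendsM _ _ _ _ h ih) => n; rewrite exprS.
Qed.

Lemma tendsV u l : l != 0 -> tends u l -> tends (fun n => (u n)^-1) l^-1.
Proof.
move=> l0 h e e0; have L0 : 0 < nm l by rewrite nm_gt0.
have [N hN] := h (nm l / 2) ltac:(lra).
have [M hM] := h (e * (nm l * (nm l / 2))) ltac:(by rewrite !mulr_gt0 // invr_gt0).
exists (maxn N M) => n; rewrite geq_max => /andP[/hN a /hM b].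
have un : nm l / 2 <= nm (u n).
  by have := nm_ge_sub l (l - u n); rewrite (nmBC l (u n)) opprB addrCA subrr addr0; lra.
have u0 : u n != 0 by rewrite -nm_gt0; lra.
have -> : (u n)^-1 - l^-1 = (l - u n) / (u n * l) by field; apply/andP.
rewrite nmM nmBC nmV nmM ler_pdivrMr ?mulr_gt0 ?nm_gt0 //.
apply: le_trans b _; rewrite ler_wpM2l //; first by lra.
by rewrite mulrC ler_wpM2r // ltW.
Qed.

Lemma tends_le u l (K : R) N : tends u l -> (forall n, (N <= n)%N -> nm (u n) <= K) -> nm l <= K.
Proof.
move=> h hK; apply/ler_addgt0Pr => e e0.
have [M hM] := h e e0.
have := hM (maxn N M) (leq_maxr _ _); have := hK (maxn N M) (leq_maxl _ _).
have := nmD (u (maxn N M)) (- (u (maxn N M) - l)); rewrite nmN opprB addrCA subrr addr0; lra.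
Qed.

Definition cauchyC (u : nat -> CC) : Prop :=
  forall e : R, 0 < e -> exists N, forall m n, (N <= m)%N -> (N <= n)%N -> nm (u m - u n) <= e.

Lemma cauchyR (u : nat -> R) :
  (forall e : R, 0 < e -> exists N, forall m n, (N <= m)%N -> (N <= n)%N -> `|u m - u n| <= e) ->
  exists l, forall e : R, 0 < e -> exists N, forall n, (N <= n)%N -> `|u n - l| <= e.
Proof.
move=> h.
have hc : cvg (u @ \oo)%classic.
  apply: (@cauchy_cvg R^o); apply/cauchy_exP => e e0.
  have [N hN] := h (e / 2) ltac:(lra).
  exists (u N); exists N => // n /= Nn.
  have := hN N n (leqnn _) Nn; rewrite /ball /= /ball_ => a; lra.
exists (lim (u @ \oo)%classic) => e e0.
move/(@cvgrPdist_le _ R^o) : hc => /(_ e e0) [N _ hN].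
by exists N => n Nn; rewrite distrC; apply: hN.
Qed.

Lemma cauchy_tends u : cauchyC u -> exists l, tends u l.
Proof.
move=> h.
have [a ha] : exists l, forall e : R, 0 < e -> exists N, forall n, (N <= n)%N -> `|complex.Re (u n) - l| <= e.
  apply: cauchyR => e e0; have [N hN] := h e e0; exists N => m n hm hn.
  by have := nm_Re (u m - u n); have := hN m n hm hn; rewrite raddfB; lra.
have [b hb] : exists l, forall e : R, 0 < e -> exists N, forall n, (N <= n)%N -> `|complex.Im (u n) - l| <= e.
  apply: cauchyR => e e0; have [N hN] := h e e0; exists N => m n hm hn.
  by have := nm_Im (u m - u n); have := hN m n hm hn; rewrite raddfB; lra.
exists (Complex a b) => e e0.
have [N hN] := ha (e / 2) ltac:(lra); have [M hM] := hb (e / 2) ltac:(lra).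
exists (maxn N M) => n; rewrite geq_max => /andP[/hN A /hM B].
by have := nm_le_ReIm (u n - Complex a b); rewrite !raddfB /=; lra.
Qed.

(** * Estimates for the real and the complex exponential *)

Lemma sin_mvt (y : R) : 0 < y -> exists2 c : R, 0 < c < y & sin y = cos c * y.
Proof.
move=> y0; have [c] := @MVT R sin cos 0 y y0 (fun x _ => is_derive_sin x) (continuous_subspaceT (@continuous_sin R)).
by rewrite in_itv /= => cy; rewrite sin0 !subr0 => ->; exists c.
Qed.

Lemma norm_sin_le (y : R) : `|sin y| <= `|y|.
Proof.
wlog y0 : y / 0 <= y => [h|].
  case: (lerP 0 y) => [/h//|y0].
  by rewrite -normrN -sinN -(normrN y); apply: h; rewrite oppr_ge0 ltW.
move: y0; rewrite le0r => /orP[/eqP->|y0]; first by rewrite sin0.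
have [c _ ->] := sin_mvt _ y0.
by rewrite normrM ler_piMl // cos_max.
Qed.

Lemma sqr_le_norm (a b : R) : `|a| <= `|b| -> a ^+ 2 <= b ^+ 2.
Proof.
move=> h; rewrite -(real_normK (num_real a)) -(real_normK (num_real b)).
by rewrite lerXn2r ?nnegrE.
Qed.

Lemma cos_lb (y : R) : `|cos y - 1| <= y ^+ 2.
Proof.
have h : cos y - 1 = - (sin (y / 2) ^+ 2 *+ 2).
  have {1}-> : y = (y / 2) *+ 2 by rewrite mulr2n; field.
  by rewrite cos_mulr2n cos2sin2; ring.
have hs := norm_sin_le (y / 2).
rewrite h normrN ger0_norm; last by rewrite mulrn_wge0 ?sqr_ge0.
have : sin (y / 2) ^+ 2 <= (y / 2) ^+ 2 by exact: sqr_le_norm.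
have : (y / 2) ^+ 2 = y ^+ 2 / 4 by field.
have := sqr_ge0 y.
rewrite -mulr_natl; lra.
Qed.

Lemma sin_lb (y : R) : `|y| <= 1 -> `|sin y - y| <= y ^+ 2.
Proof.
wlog y0 : y / 0 <= y => [h|].
  case: (lerP 0 y) => [/h//|y0 y1].
  have -> : sin y - y = - (sin (- y) - - y) by rewrite sinN; ring.
  by rewrite normrN -(sqrrN y); apply: h; rewrite ?normrN // oppr_ge0 ltW.
rewrite (ger0_norm y0) => y1.
move: y0; rewrite le0r => /orP[/eqP->|y0]; first by rewrite sin0 subr0 normr0 expr0n.
have [c /andP[c0 cy] ->] := sin_mvt _ y0.
have -> : cos c * y - y = (cos c - 1) * y by ring.
rewrite normrM (gtr0_norm y0) expr2 ler_wpM2r ?(ltW y0) //.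
apply: le_trans (cos_lb c) _; rewrite expr2.
by apply: le_trans (_ : c * y <= _); [rewrite ler_wpM2l // ltW | rewrite ler_piMl ?(ltW y0) //; lra].
Qed.

(** Both bounds come from [1 + x <= expR x], used at [x] and at [- x]; the second use gives
    [expR x * (1 - x) <= 1]. *)
Lemma expR_ub (x : R) : `|x| <= 1 / 2 -> `|expR x - 1 - x| <= 2 * x ^+ 2.
Proof.
rewrite ler_norml => /andP[x1 x2].
have h1 := expR_ge1Dx x; have h2 := expR_ge1Dx (- x).
have e0 := expR_gt0 x.
have : expR x * (1 - x) <= 1.
  by rewrite -[leRHS](@exp.expR0 R) -(subrr x) exp.expRD ler_wpM2l // ltW.
have := sqr_ge0 x => s0 h3; rewrite ger0_norm; last by lra.
nra.
Qed.

Lemma cexp0 : cexp 0 = 1.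
Proof. by rewrite /cexp /= exp.expR0 trigo.cos0 trigo.sin0 mulr1 mulr0. Qed.

Lemma cexpD x y : cexp (x + y) = cexp x * cexp y.
Proof.
case: x => a b; case: y => c d; rewrite /cexp /= exp.expRD trigo.cosD trigo.sinD.
apply/eqP; rewrite eq_complex /=; apply/andP; split; apply/eqP; ring.
Qed.

Lemma nm_cexp z : nm (cexp z) = expR (complex.Re z).
Proof.
rewrite /cexp /nm /= !exprMn -mulrDr trigo.cos2Dsin2 mulr1 sqrtr_sqr ger0_norm // expR_ge0.
Qed.

Lemma nm_cexp_le z : nm (cexp z) <= expR (nm z).
Proof. by rewrite nm_cexp ler_expR; apply: le_trans (nm_Re z); exact: ler_norm. Qed.

Lemma cexp_neq0 z : cexp z != 0.
Proof. by rewrite -nm_gt0 nm_cexp expR_gt0. Qed.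

Lemma cexpX z n : cexp z ^+ n = cexp (n%:R * z).
Proof.
elim: n => [|n ih]; first by rewrite mul0r cexp0.
by rewrite exprS ih -cexpD -[n.+1]add1n natrD mulrDl mul1r.
Qed.

(** The real part contributes at most 4 and the imaginary part at most 5 times [nm v ^+ 2]; the
    constant 12 is generous. *)
Lemma cexp_lin v : nm v <= 1 / 2 -> nm (cexp v - 1 - v) <= 12 * nm v ^+ 2.
Proof.
move=> hv.
have hx := nm_Re v; have hy := nm_Im v; have v0 := nm_ge0 v.
apply: le_trans (nm_le_ReIm _) _.
move: (nm v) hv hx hy v0 => m hv hx hy v0; case: v hx hy => x y /= hx hy.
have hx2 : `|x| <= 1 / 2 by lra.
have hy2 : `|y| <= 1 by lra.
have ex := expR_ub _ hx2.
have cy := cos_lb y; have sy := sin_lb _ hy2.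
have e2 : `|expR x| <= 2.
  have : x ^+ 2 <= (1 / 2) ^+ 2 by apply: sqr_le_norm; rewrite (_ : `|1 / 2| = 1 / 2) // ger0_norm; lra.
  have -> : expR x = (expR x - 1 - x) + (1 + x) by ring.
  move=> a; apply: le_trans (ler_normD _ _) _.
  have := ler_normD 1 x; rewrite normr1; lra.
have x2 : x ^+ 2 <= m ^+ 2 by apply: sqr_le_norm; rewrite (ger0_norm v0).
have y2 : y ^+ 2 <= m ^+ 2 by apply: sqr_le_norm; rewrite (ger0_norm v0).
have -> : expR x * cos y - 1 - x = (expR x - 1 - x) + expR x * (cos y - 1) by ring.
have -> : expR x * sin y - 0 - y = expR x * (sin y - y) + (expR x - 1 - x) * y + x * y by ring.
have A : `|(expR x - 1 - x) + expR x * (cos y - 1)| <= 2 * m ^+ 2 + 2 * m ^+ 2.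
  apply: le_trans (ler_normD _ _) _; apply: lerD; first by lra.
  by rewrite normrM; apply: ler_pM => //; lra.
have B : `|expR x * (sin y - y) + (expR x - 1 - x) * y + x * y| <= 2 * m ^+ 2 + 2 * m ^+ 2 * 1 + m * m.
  apply: le_trans (ler_normD _ _) _; apply: lerD; [apply: le_trans (ler_normD _ _) _; apply: lerD|].
  - by rewrite normrM; apply: ler_pM => //; lra.
  - by rewrite normrM; apply: ler_pM => //; lra.
  by rewrite normrM; apply: ler_pM => //; lra.
have := sqr_ge0 m; move: A B; rewrite expr2; lra.
Qed.

(** * Holomorphic functions and Liouville's theorem *)

(* Holomorphy at [a] is encoded as: [f (a + h)] is a uniform limit of polynomials in [h] on a disc.
   This class is closed under all the operations needed, without complex derivatives or contour integrals. *)
Definition happ (r : R) (f : CC -> CC) (a : CC) : Prop :=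
  forall e : R, 0 < e -> exists p : {poly CC},
    forall h, nm h <= r -> nm (f (a + h) - p.[h]) <= e.

Definition hol (f : CC -> CC) (a : CC) : Prop := exists2 r : R, 0 < r & happ r f a.

Lemma happ_mono r r' f a : r' <= r -> happ r f a -> happ r' f a.
Proof. by move=> rr h e /h[p hp]; exists p => x hx; apply: hp; lra. Qed.

Lemma happ_ext r f g a : (forall h, nm h <= r -> f (a + h) = g (a + h)) -> happ r f a -> happ r g a.
Proof. by move=> fg h e /h[p hp]; exists p => x hx; rewrite -fg // hp. Qed.

(** Weierstrass' theorem on uniform limits is immediate for this notion of holomorphy; it is what
    makes infinite sums and products holomorphic. *)
Lemma happ_lim r f a :
  (forall e : R, 0 < e -> exists2 g, happ r g a & forall h, nm h <= r -> nm (f (a + h) - g (a + h)) <= e) ->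
  happ r f a.
Proof.
move=> H e e0; have [g hg fg] := H (e / 2) ltac:(lra).
have [p hp] := hg (e / 2) ltac:(lra); exists p => h hr.
have := nm_tri (g (a + h)) (f (a + h)) p.[h]; have := fg h hr; have := hp h hr; lra.
Qed.

Lemma poly_bound (p : {poly CC}) (r : R) : 0 <= r ->
  exists2 K : R, 0 < K & forall h, nm h <= r -> nm p.[h] <= K.
Proof.
move=> r0; exists (1 + \sum_(i < size p) nm p`_i * r ^+ i).
  by rewrite ltr_pwDl // sumr_ge0 // => i _; rewrite mulr_ge0 ?nm_ge0 ?exprn_ge0.
move=> h hr; rewrite horner_coef; apply: le_trans (nm_sum _ _ _ _) _.
apply: (@le_trans _ _ (\sum_(i < size p) nm p`_i * r ^+ i)); last by lra.
apply: ler_sum => i _; rewrite nmM nmX ler_wpM2l ?nm_ge0 // lerXn2r ?nnegrE ?nm_ge0 //.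
Qed.

Lemma happ_bound r f a : 0 <= r -> happ r f a ->
  exists2 K : R, 0 < K & forall h, nm h <= r -> nm (f (a + h)) <= K.
Proof.
move=> r0 /(_ 1 ltac:(lra)) [p hp]; have [K K0 hK] := poly_bound p _ r0.
exists (1 + K) => [|h hr]; first lra.
have := nmD (f (a + h) - p.[h]) p.[h]; rewrite subrK.
have := hp h hr; have := hK h hr; lra.
Qed.

Lemma happ_poly r f a (p : {poly CC}) : (forall h, f (a + h) = p.[h]) -> happ r f a.
Proof. by move=> fp e e0; exists p => h _; rewrite fp subrr nm0 ltW. Qed.

Lemma happC r c a : happ r (fun=> c) a.
Proof. by apply: (@happ_poly _ _ _ c%:P) => h; rewrite hornerC. Qed.

Lemma happ_id r a : happ r id a.
Proof. by apply: (@happ_poly _ _ _ (a%:P + 'X)) => h; rewrite !hornerE. Qed.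

Lemma happD r f g a : happ r f a -> happ r g a -> happ r (fun z => f z + g z) a.
Proof.
move=> hf hg e e0; have [p hp] := hf (e / 2) ltac:(lra).
have [q hq] := hg (e / 2) ltac:(lra).
exists (p + q) => h hr; rewrite hornerD.
have -> : f (a + h) + g (a + h) - (p.[h] + q.[h]) = (f (a + h) - p.[h]) + (g (a + h) - q.[h]) by ring.
by apply: le_trans (nmD _ _) _; have := hp h hr; have := hq h hr; lra.
Qed.

Lemma happM r f g a : 0 <= r -> happ r f a -> happ r g a -> happ r (fun z => f z * g z) a.
Proof.
move=> r0 hf hg e e0.
(* The order of choices matters: [f] is bounded first, then [q] is chosen for [g], and only then
   [p], whose error gets multiplied by the bound [L] of [q]. *)
have [K K0 hK] := happ_bound _ _ _ r0 hf.
have [q hq] := hg (e / 2 / K) ltac:(by rewrite !divr_gt0).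
have [L L0 hL] := poly_bound q _ r0.
have [p hp] := hf (e / 2 / L) ltac:(by rewrite !divr_gt0).
exists (p * q) => h hr; rewrite hornerM.
have -> : f (a + h) * g (a + h) - (p.[h] * q.[h]) =
   f (a + h) * (g (a + h) - q.[h]) + (f (a + h) - p.[h]) * q.[h] by ring.
apply: le_trans (nmD _ _) _; rewrite !nmM.
have -> : e = K * (e / 2 / K) + (e / 2 / L) * L by field; rewrite !gt_eqF.
by apply: lerD; apply: ler_pM; rewrite ?nm_ge0 ?hK ?hq ?hp ?hL.
Qed.

Lemma happZ r c f a : 0 <= r -> happ r f a -> happ r (fun z => c * f z) a.
Proof. by move=> r0; apply: happM => //; exact: happC. Qed.

Lemma happN r f a : 0 <= r -> happ r f a -> happ r (fun z => - f z) a.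
Proof.
by move=> r0 /(happZ _ (-1) _ _ r0); apply: happ_ext => h _; rewrite mulN1r.
Qed.

Lemma happB r f g a : 0 <= r -> happ r f a -> happ r g a -> happ r (fun z => f z - g z) a.
Proof. by move=> r0 hf hg; apply: happD => //; apply: happN. Qed.

Lemma happX r f a n : 0 <= r -> happ r f a -> happ r (fun z => f z ^+ n) a.
Proof.
move=> r0 hf; elim: n => [|n ih]; first by apply: happ_ext (happC r 1 a) => h _; rewrite expr0.
by apply: happ_ext (happM _ _ _ _ r0 hf ih) => h _; rewrite exprS.
Qed.

Lemma happ_sum r (I : Type) (s : seq I) (F : I -> CC -> CC) a :
  (forall i, happ r (F i) a) -> happ r (fun z => \sum_(i <- s) F i z) a.
Proof.
move=> hF; elim: s => [|i s ih].
  by apply: happ_ext (happC r 0 a) => h _; rewrite big_nil.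
by apply: happ_ext (happD _ _ _ _ (hF i) ih) => h _; rewrite big_cons.
Qed.

Lemma happ_prod r (I : Type) (s : seq I) (F : I -> CC -> CC) a : 0 <= r ->
  (forall i, happ r (F i) a) -> happ r (fun z => \prod_(i <- s) F i z) a.
Proof.
move=> r0 hF; elim: s => [|i s ih].
  by apply: happ_ext (happC r 1 a) => h _; rewrite big_nil.
by apply: happ_ext (happM _ _ _ _ r0 (hF i) ih) => h _; rewrite big_cons.
Qed.

(* The approximants come from (1 + w/m)^m. *)
Lemma cexp_approx (K : R) : 0 < K -> forall e : R, 0 < e ->
  exists m : nat, forall w, nm w <= K -> nm (cexp w - (1 + w / m.+1%:R) ^+ m.+1) <= e.
Proof.
move=> K0 e e0.
pose B := expR K * 12 * K ^+ 2.
have B0 : 0 <= B by rewrite !mulr_ge0 ?expR_ge0 ?exprn_ge0 ?ltW.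
(* The summand [2 * K] forces [nm v <= 1 / 2], as [cexp_lin] requires, and [B / e] makes the final
   error [B / M] at most [e]. *)
pose m := (Num.truncn (2 * K + B / e)); exists m => w hw.
have hm : 2 * K + B / e < m.+1%:R by exact: truncnS_gt.
have Be : 0 <= B / e by rewrite divr_ge0 // ltW.
have m0 : (0 : R) < m.+1%:R by rewrite ltr0n.
set M : R := m.+1%:R in hm m0.
have M0 : (m.+1%:R : CC) != 0 by rewrite pnatr_eq0.
pose v := w / m.+1%:R.
have nv : nm v <= K / M by rewrite /v nmM nmV nm_nat ler_wpM2r // invr_ge0 ltW.
have KM : K / M <= 1 / 2.
  rewrite ler_pdivrMr //; move: (B / e) Be hm => X; move: M {nv m0} => N hX hm. lra.
have -> : cexp w = cexp v ^+ m.+1 by rewrite cexpX /v mulrC divfK.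
(* In the difference of two M-th powers, the difference of the bases is of order [M ^- 2], and the
   cofactor is a sum of M terms, each at most [expR K]. *)
rewrite subrXX nmM.
have h1 : nm (cexp v - (1 + v)) <= 12 * (K / M) ^+ 2.
  rewrite opprD addrA; apply: le_trans (cexp_lin v _) _; first exact: le_trans nv KM.
  by rewrite ler_wpM2l // lerXn2r ?nnegrE ?nm_ge0 ?divr_ge0 ?(ltW K0) ?(ltW m0).
have ev : nm (1 + v) <= expR (nm v).
  by apply: le_trans (expR_ge1Dx _); rewrite -nm1; exact: nmD.
have h2 : nm (\sum_(i < m.+1) cexp v ^+ (m.+1.-1 - i) * (1 + v) ^+ i) <= M * expR K.
  apply: le_trans (nm_sum _ _ _ _) _.
  rewrite /M -[in leRHS](card_ord m.+1) mulr_natl -sumr_const; apply: ler_sum => i _.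
  rewrite nmM !nmX; apply: (@le_trans _ _ (expR (nm v) ^+ (m.+1.-1 - i) * expR (nm v) ^+ i)).
    apply: ler_pM; rewrite ?exprn_ge0 ?nm_ge0 //;
    by apply: lerXn2r; rewrite ?nnegrE ?nm_ge0 ?expR_ge0 ?nm_cexp_le.
  rewrite -exprD subnK; last by rewrite -ltnS.
  rewrite -expRM_natl ler_expR; apply: (@le_trans _ _ (m%:R * (K / M))).
    by rewrite -mulr_natl ler_wpM2l.
  rewrite mulrA ler_pdivrMr // mulrC ler_wpM2l ?(ltW K0) //.
  by rewrite ler_nat.
apply: le_trans (ler_pM (nm_ge0 _) (nm_ge0 _) h1 h2) _.
have -> : 12 * (K / M) ^+ 2 * (M * expR K) = B / M by rewrite /B; field; rewrite gt_eqF.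
rewrite ler_pdivrMr // mulrC -ler_pdivrMr //; apply: ltW; apply: le_lt_trans hm; by rewrite lerDr mulr_ge0 // ltW.
Qed.

Lemma happ_cexp r f a : 0 <= r -> happ r f a -> happ r (fun z => cexp (f z)) a.
Proof.
move=> r0 hf; have [K K0 hK] := happ_bound _ _ _ r0 hf.
apply: happ_lim => e e0; have [m hm] := cexp_approx _ K0 _ e0.
exists (fun z => (1 + f z / m.+1%:R) ^+ m.+1) => [|h hr]; last exact/hm/hK.
apply: happX => //; apply: happD; first exact: happC.
by apply: happM => //; exact: happC.
Qed.

(** * Cauchy's estimates by averaging over roots of unity, and division of holomorphic functions *)

Lemma prim_root_exists n : (0 < n)%N -> exists z : CC, n.-primitive_root z.
Proof.
move=> n0; pose p : {poly CC} := 'X^n - 1; have [r Dp] := closed_field_poly_normal p.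
have mp : p \is monic by rewrite monicXnsubC.
move: Dp; rewrite (monicP mp) scale1r => Dp.
have sr : size r = n by apply: succn_inj; rewrite -(size_prod_XsubC r id) -Dp size_XnsubC.
have ur : uniq r.
  rewrite -separable_prod_XsubC -Dp separable_Xn_sub_1 // pnatr_eq0 -lt0n //.
have /hasP[z _ hz] : has n.-primitive_root r.
  apply: has_prim_root => //; last by rewrite sr.
  by apply/allP => x xr; rewrite /root_of_unity -/p Dp root_prod_XsubC.
by exists z.
Qed.

Lemma nm_unity z n : (0 < n)%N -> z ^+ n = 1 -> nm z = 1.
Proof.
move=> n0 zn; apply/eqP; rewrite -(@pexpr_eq1 _ _ n) ?nm_ge0 //.
by rewrite -nmX zn nm1.
Qed.

Lemma geom_unity (w : CC) n : w ^+ n = 1 -> \sum_(k < n) w ^+ k = if w == 1 then n%:R else 0.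
Proof.
move=> wn; case: eqVneq => [->|w1].
  by under eq_bigr do rewrite expr1n; rewrite sumr_const card_ord.
have := subrX1 w n; rewrite wn subrr => /esym/eqP; rewrite mulf_eq0 subr_eq0 (negPf w1) /=.
by move/eqP.
Qed.

(** A discrete Cauchy integral: the average over n equidistant points of a circle keeps exactly the
    coefficients of index congruent to -m modulo n. *)
Lemma unity_filter (p : {poly CC}) (z rho : CC) n m : n.-primitive_root z ->
  \sum_(k < n) p.[rho * z ^+ k] * z ^+ (k * m) =
  n%:R * \sum_(i < size p | (n %| i + m)%N) p`_i * rho ^+ i.
Proof.
move=> hz; have zn := prim_expr_order hz.
under eq_bigr => k _ do rewrite horner_coef mulr_suml.
rewrite exchange_big /= mulr_sumr big_mkcond [RHS]big_mkcond /=; apply: eq_bigr => i _.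
have -> : \sum_(k < n) p`_i * (rho * z ^+ k) ^+ i * z ^+ (k * m) =
   p`_i * rho ^+ i * \sum_(k < n) (z ^+ (i + m)) ^+ k.
  rewrite mulr_sumr; apply: eq_bigr => k _.
  by rewrite exprMn -!mulrA -!exprM -exprD -mulnDr mulnC.
rewrite geom_unity; last by rewrite exprAC zn expr1n.
rewrite -(prim_order_dvd hz); case: ifP => _; last by rewrite mulr0.
by rewrite mulrC.
Qed.

(** Cauchy's estimate: with n = [size p] points on the circle the filter isolates the single
    coefficient of index j, and each of the n values is at most [B]. *)
Lemma coef_bound (p : {poly CC}) (r B : R) j : 0 < r ->
  (forall h, nm h <= r -> nm p.[h] <= B) -> nm p`_j * r ^+ j <= B.
Proof.
move=> r0 hB; have B0 : 0 <= B by apply: le_trans (hB 0 _); rewrite ?nm_ge0 ?nm0 ?ltW.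
case: (ltnP j (size p)) => [jp|/leq_sizeP/(_ j (leqnn _)) ->]; last by rewrite nm0 mul0r.
have [z hz] := prim_root_exists (size p) (leq_ltn_trans (leq0n _) jp).
set n := size p in hz jp.
have n0 : (0 < n)%N by apply: leq_ltn_trans jp.
have eS : \sum_(i < n | (n %| i + (n - j))%N) p`_i * r%:K ^+ i = p`_j * r%:K ^+ j.
  rewrite (bigD1 (Ordinal jp)) /=; last by rewrite subnKC // ltnW.
  rewrite big1 ?addr0 // => i /andP[di]; rewrite -val_eqE /= => ij; exfalso.
  have e : (i + (n - j) = n)%N.
    have hi := ltn_ord i; have jn := jp.
    by move/dvdnP: di => [[|[|c]] e]; lia.
  by move/negP: ij; apply; apply/eqP; lia.
have := unity_filter p z r%:K n (n - j) hz; rewrite -/n eS.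
move=> e; have : nm (n%:R * (p`_j * r%:K ^+ j)) <= n%:R * B.
  rewrite -e; apply: le_trans (nm_sum _ _ _ _) _.
  rewrite -[n in leRHS]card_ord mulr_natl -sumr_const; apply: ler_sum => k _.
  rewrite nmM nmX (nm_unity z n n0 (prim_expr_order hz)) expr1n mulr1; apply: hB.
  by rewrite nmM nmX nm_real (nm_unity z n n0 (prim_expr_order hz)) expr1n mulr1 gtr0_norm.
rewrite !nmM nm_nat nmX nm_real gtr0_norm // ler_pM2l // ltr0n //.
Qed.

Lemma happ_cont r f a : 0 < r -> happ r f a ->
  forall e : R, 0 < e -> exists2 d : R, 0 < d <= r & forall h, nm h <= d -> nm (f (a + h) - f a) <= e.
Proof.
move=> r0 hf e e0; have [p hp] := hf (e / 4) ltac:(lra).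
have /factor_theorem [q hq] : root (p - p.[0]%:P) 0 by rewrite /root !hornerE subrr.
have [K K0 hK] := poly_bound q _ (ltW r0).
have eK : 0 < e / 2 / K by rewrite !divr_gt0.
exists (Order.min r (e / 2 / K)); first by rewrite lt_min r0 eK /= ge_min lexx.
move=> h; rewrite le_min => /andP[hr he].
have h1 := hp h hr; have := hp 0 ltac:(by rewrite nm0 ltW); rewrite addr0 => h2.
have h3 : nm (p.[h] - p.[0]) <= e / 2.
  have -> : p.[h] - p.[0] = q.[h] * h.
    by have := congr1 (horner^~ h) hq; rewrite hornerM !hornerD !hornerN !hornerC hornerX subr0.
  rewrite nmM; apply: le_trans (_ : K * (e / 2 / K) <= _).
    by apply: ler_pM; rewrite ?nm_ge0 ?hK.
  by rewrite mulrC divfK ?gt_eqF.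
have := nm_tri p.[h] (f (a + h)) (f a); have := nm_tri p.[0] p.[h] (f a).
rewrite (nmBC p.[0] (f a)); lra.
Qed.

(** With c the value at [a], the inverse is the geometric series in [u] = (c - f)/c, which converges
    uniformly because [nm u <= 1 / 2] on the disc. *)
Lemma happ_inv r f a : 0 <= r -> happ r f a -> f a != 0 ->
  (forall h, nm h <= r -> nm (f (a + h) - f a) <= nm (f a) / 2) ->
  happ r (fun z => (f z)^-1) a.
Proof.
move=> r0 hf fa hh; set c := f a in fa hh.
have c0 : 0 < nm c by rewrite nm_gt0.
pose u z := (c - f z) * c^-1.
have hu : happ r u a by apply: happM => //; [apply: happB => //; exact: happC|exact: happC].
have nu h : nm h <= r -> nm (u (a + h)) <= 1 / 2.
  by move=> /hh; rewrite /u nmM nmV nmBC ler_pdivrMr // mulrC mul1r.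
apply: happ_lim => e e0.
have [n hn] : exists n : nat, 2 / nm c / e <= 2 ^+ n.
  exists (Num.truncn (2 / nm c / e)).+1.
  apply: ltW; apply: lt_trans (truncnS_gt _) _.
  by rewrite -natrX ltr_nat ltn_expl.
exists (fun z => c^-1 * \sum_(i < n) u z ^+ i).
  by apply: happZ => //; apply: happ_sum => i; apply: happX.
move=> h hr; have nuh := nu h hr; set U := u (a + h) in nuh *.
have U1 : 1 - U != 0.
  by rewrite -nm_gt0; have := nm_ge_sub 1 U; rewrite nm1; lra.
have fE : f (a + h) = c * (1 - U) by rewrite /U /u; field.
have gE : \sum_(i < n) U ^+ i = (1 - U ^+ n) / (1 - U).
  apply/(mulIf U1); rewrite divfK // -[RHS]opprB subrX1; ring.
have -> : (f (a + h))^-1 - c^-1 * \sum_(i < n) U ^+ i = c^-1 * (U ^+ n / (1 - U)).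
  by rewrite gE fE; field; rewrite fa U1.
rewrite !nmM !nmV nmX.
have h1 : nm U ^+ n <= (2 ^+ n)^-1.
  by rewrite -exprVn lerXn2r ?nnegrE ?nm_ge0 ?invr_ge0 //; lra.
have h2 : (nm (1 - U))^-1 <= 2.
  rewrite -[leRHS]invrK lef_pV2 ?posrE ?nm_gt0 ?invr_gt0 //.
  by have := nm_ge_sub 1 U; rewrite nm1; lra.
apply: (@le_trans _ _ ((nm c)^-1 * ((2 ^+ n)^-1 * 2))).
  rewrite ler_wpM2l ?invr_ge0 ?nm_ge0 //; apply: ler_pM => //.
    by rewrite exprn_ge0 ?nm_ge0.
  by rewrite invr_ge0 nm_ge0.
have p0 : 0 < (2 : R) ^+ n by rewrite exprn_gt0.
have -> : (nm c)^-1 * ((2 ^+ n)^-1 * 2) = (2 / nm c) / 2 ^+ n by ring.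
by rewrite ler_pdivrMr // [e * _]mulrC -ler_pdivrMr.
Qed.

Lemma hol_inv f a : hol f a -> f a != 0 -> hol (fun z => (f z)^-1) a.
Proof.
move=> [r r0 hf] fa; have c0 : 0 < nm (f a) by rewrite nm_gt0.
have [d /andP[d0 dr] hd] := happ_cont _ _ _ r0 hf (nm (f a) / 2) ltac:(lra).
exists d => //; apply: happ_inv => //; [exact: ltW|exact: happ_mono hf].
Qed.

Lemma hol_cont f a : hol f a -> forall e : R, 0 < e ->
  exists2 d : R, 0 < d & forall h, nm h <= d -> nm (f (a + h) - f a) <= e.
Proof.
move=> [r r0 hf] e e0; have [d /andP[d0 dr] hd] := happ_cont _ _ _ r0 hf e e0.
by exists d.
Qed.

Lemma hol_ext f g a : (exists2 r : R, 0 < r & forall h, nm h <= r -> f (a + h) = g (a + h)) -> hol f a -> hol g a.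
Proof.
move=> [r r0 fg] [s s0 hf]; exists (Order.min r s); first by rewrite lt_min r0.
apply: (@happ_ext _ f); first by move=> h; rewrite le_min => /andP[/fg].
by apply: happ_mono hf; rewrite ge_min lexx orbT.
Qed.

Lemma hol_common f g a : hol f a -> hol g a -> exists2 r : R, 0 < r & happ r f a /\ happ r g a.
Proof.
move=> [r r0 hf] [s s0 hg]; exists (Order.min r s); first by rewrite lt_min r0.
by split; [apply: happ_mono hf|apply: happ_mono hg]; rewrite ge_min lexx ?orbT.
Qed.

Lemma holD f g a : hol f a -> hol g a -> hol (fun z => f z + g z) a.
Proof. by move=> hf hg; have [r r0 [h1 h2]] := hol_common _ _ _ hf hg; exists r => //; exact: happD. Qed.
Lemma holB f g a : hol f a -> hol g a -> hol (fun z => f z - g z) a.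
Proof. by move=> hf hg; have [r r0 [h1 h2]] := hol_common _ _ _ hf hg; exists r => //; apply: happB => //; exact: ltW. Qed.
Lemma holM f g a : hol f a -> hol g a -> hol (fun z => f z * g z) a.
Proof. by move=> hf hg; have [r r0 [h1 h2]] := hol_common _ _ _ hf hg; exists r => //; apply: happM => //; exact: ltW. Qed.
Lemma holC c a : hol (fun=> c) a.
Proof. by exists 1 => //; exact: happC. Qed.
Lemma hol_id a : hol id a.
Proof. by exists 1 => //; exact: happ_id. Qed.
Lemma holX f a n : hol f a -> hol (fun z => f z ^+ n) a.
Proof. by move=> [r r0 h]; exists r => //; apply: happX => //; exact: ltW. Qed.
Lemma hol_shift f a c : hol f (a + c) -> hol (fun z => f (z + c)) a.
Proof.
move=> [r r0 h]; exists r => // e /h [p hp]; exists p => x xr.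
by rewrite addrAC; exact: hp.
Qed.

(** By [coef_bound] the coefficient of index i of [q] is at most B / r^(i+1); on the half disc the
    resulting geometric series has sum at most 2 B / r. Thus uniformly close approximants stay close
    after division by h. *)
Lemma quot_bound (q : {poly CC}) (r B : R) : 0 < r ->
  (forall h, nm h <= r -> nm (q * 'X).[h] <= B) -> forall h, nm h <= r / 2 -> nm q.[h] <= 2 * B / r.
Proof.
move=> r0 hB h hr.
have cb j : nm q`_j * r ^+ j.+1 <= B.
  by have := coef_bound (q * 'X) r B j.+1 r0 hB; rewrite coefMX.
have B0 : 0 <= B by apply: le_trans (cb 0%N); rewrite mulr_ge0 ?nm_ge0 ?exprn_ge0 ?ltW.
rewrite horner_coef; apply: le_trans (nm_sum _ _ _ _) _.
apply: (@le_trans _ _ (\sum_(i < size q) B / r * (1 / 2) ^+ i)).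
  apply: ler_sum => i _; rewrite nmM nmX.
  apply: (@le_trans _ _ (nm q`_i * (r / 2) ^+ i)).
    by rewrite ler_wpM2l ?nm_ge0 // lerXn2r ?nnegrE ?nm_ge0 // divr_ge0 // ltW.
  rewrite expr_div_n expr_div_n expr1n !mulrA mulr1 ler_wpM2r ?invr_ge0 ?exprn_ge0 //.
  by rewrite ler_pdivlMr // -mulrA -exprSr.
rewrite -mulr_sumr.
have S n : \sum_(i < n) (1 / 2 : R) ^+ i <= 2.
  have -> : \sum_(i < n) (1 / 2 : R) ^+ i = 2 - 2 * (1 / 2) ^+ n.
    have := subrX1 (1 / 2 : R) n; lra.
  have : 0 <= (1 / 2 : R) ^+ n by rewrite exprn_ge0.
  lra.
have -> : 2 * B / r = B / r * 2 by ring.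
by rewrite ler_wpM2l // divr_ge0 // ltW.
Qed.

Lemma nat_eps (K e : R) : 0 < e -> exists N : nat, forall n, (N <= n)%N -> K / n.+1%:R <= e.
Proof.
move=> e0; exists (Num.truncn (K / e)) => n hn.
rewrite ler_pdivrMr ?ltr0n // mulrC -ler_pdivrMr //.
by apply: ltW; apply: lt_le_trans (truncnS_gt _) _; rewrite ler_nat.
Qed.

(** The approximating polynomials, corrected to vanish at 0, are divided by ['X]; by [quot_bound]
    the quotients form a uniform Cauchy sequence on the half disc, and [g] is their limit. *)
Lemma happ_div r f a : 0 < r -> happ r f a -> f a = 0 ->
  exists2 g, happ (r / 2) g a & forall h, nm h <= r / 2 -> f (a + h) = h * g (a + h).
Proof.
move=> r0 hf fa.
have hP0 (e : R) : 0 < e -> exists q : {poly CC}, forall h, nm h <= r -> nm (f (a + h) - (q * 'X).[h]) <= e.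
  move=> e0; have [p hp] := hf (e / 2) ltac:(lra).
  have /factor_theorem [q hq] : root (p - p.[0]%:P) 0 by rewrite /root !hornerE subrr.
  exists q => h hr; have -> : q * 'X = p - p.[0]%:P by rewrite hq subr0.
  have := hp 0 ltac:(by rewrite nm0 ltW); rewrite addr0 fa => h2.
  have -> : f (a + h) - (p - p.[0]%:P).[h] = (f (a + h) - p.[h]) - (0 - p.[0]).
    by rewrite hornerD hornerN hornerC; ring.
  by apply: le_trans (nmB _ _) _; have := hp h hr; lra.
have [ep ep0 epN] : exists2 ep : nat -> R, (forall n, 0 < ep n) &
    forall K e : R, 0 < e -> exists N : nat, forall n, (N <= n)%N -> K * ep n <= e.
  exists (fun n => n.+1%:R^-1) => [n|K e e0]; first by rewrite invr_gt0 ltr0n.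
  exact: nat_eps.
have hP n := hP0 (ep n) (ep0 n).
have [q hq] := choice hP.
have close m n h : nm h <= r / 2 -> nm ((q m).[h] - (q n).[h]) <= 2 / r * (ep m + ep n).
  move=> hr; have -> : (q m).[h] - (q n).[h] = (q m - q n).[h] by rewrite !hornerE.
  have -> : 2 / r * (ep m + ep n) = 2 * (ep m + ep n) / r by ring.
  apply: quot_bound hr => // x xr.
  have := hq m x xr; have := hq n x xr.
  have -> : ((q m - q n) * 'X).[x] = (f (a + x) - (q n * 'X).[x]) - (f (a + x) - (q m * 'X).[x]).
    by rewrite !hornerE; ring.
  by have := nmB (f (a + x) - (q n * 'X).[x]) (f (a + x) - (q m * 'X).[x]); lra.
(* Outside the half disc the premise is false and any value serves. *)
have hl z : exists l, nm (z - a) <= r / 2 -> tends (fun n => (q n).[z - a]) l.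
  have [zr|zr] := boolP (nm (z - a) <= r / 2); last by exists 0.
  have [|l hl] := cauchy_tends (fun n => (q n).[z - a]).
    move=> e e0; have [N hN] := epN (2 / r) (e / 2) ltac:(lra).
    exists N => m n /hN m1 /hN n1; have := close m n _ zr; rewrite mulrDr; lra.
  by exists l.
have [g hg] := choice hl.
exists g.
  move=> e e0; have [N hN] := epN (2 / r) (e / 2) ltac:(lra).
  exists (q N) => h hr.
  have az : a + h - a = h by ring.
  have := hg (a + h); rewrite az => /(_ hr) tg.
  have := tendsB _ _ _ _ tg (tends_cst (q N).[h]) => tt.
  apply: (tends_le _ _ _ N tt) => n /hN hn.
  by have := close n N h hr; rewrite mulrDr; have := hN N (leqnn _); lra.
move=> h hr; have hr' : nm h <= r by lra.
have az : a + h - a = h by ring.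
have := hg (a + h); rewrite az => /(_ hr) tg.
apply: tends_uniq (tendsZ h _ _ tg) => e e0.
have [N hN] := epN 1 e e0.
exists N => n /hN; rewrite mul1r => hn.
by rewrite nmBC; apply: le_trans hn; have := hq n h hr'; rewrite hornerM hornerX mulrC.
Qed.

Lemma hol_div f a : hol f a -> f a = 0 ->
  exists2 g, hol g a & exists2 r : R, 0 < r & forall h, nm h <= r -> f (a + h) = h * g (a + h).
Proof.
move=> [r r0 hf] fa; have [g hg fg] := happ_div _ _ _ r0 hf fa.
by exists g; exists (r / 2) => //; rewrite divr_gt0.
Qed.

(** * The maximum principle and Liouville's theorem *)

Lemma dvdn_lt_double n m : (n %| m)%N -> (0 < m)%N -> (m < n.*2)%N -> m = n.
Proof.
move=> /dvdnP[[|[|c]] ->] //; first by rewrite mul1n.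
by rewrite -mul2n ltn_mul2r => _ /andP[].
Qed.

(** Sharpens Cauchy's estimate so that a constant term close to the maximum forces all other
    coefficients to be small. The values on the circle are averaged with nonnegative weights 1 +
    Re(t), where t runs through rotated powers of a root of unity; the average is the constant term
    plus half of the rotated j-th term. *)
Lemma coef_bound0 (p : {poly CC}) (r B : R) j : 0 < r -> (0 < j)%N ->
  (forall h, nm h <= r -> nm p.[h] <= B) -> nm p`_0 + nm p`_j * r ^+ j / 2 <= B.
Proof.
move=> r0 j0 hB.
have [->|cj0] := eqVneq p`_j 0.
  rewrite nm0 !mul0r addr0 -horner_coef0; apply: hB; rewrite nm0; exact: ltW.
have jp : (j < size p)%N by rewrite ltnNge; apply: contra cj0 => /leq_sizeP/(_ j (leqnn _)) ->.
(* So many points that i + j < n for every index i of [p]: the conjugate frequency, computed in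
   [S2], then catches no coefficient. *)
pose n := (size p + j)%N.
have n0 : (0 < n)%N by rewrite addn_gt0 j0 orbT.
have [z hz] := prim_root_exists n n0.
have zn := prim_expr_order hz.
have nz : nm z = 1 by exact: nm_unity zn.
(* The phase [u] turns the j-th term into the direction of the constant term, so that their moduli
   add up; if the constant term is 0, no rotation is required. *)
have [u nu hu] : exists2 u : CC, nm u = 1 & nm (p`_0 + u * p`_j * r%:K ^+ j / 2) = nm p`_0 + nm p`_j * r ^+ j / 2.
  have rj : nm (r%:K ^+ j) = r ^+ j by rewrite nmX nm_real gtr0_norm.
  have n2 : nm 2 = 2 by rewrite nm_nat.
  have cc0 : 0 < nm p`_j by rewrite nm_gt0.
  have [c0|c0] := eqVneq p`_0 0.
    by exists 1; rewrite ?nm1 // c0 add0r nm0 add0r mul1r !nmM nmV rj n2.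
  have cc1 : 0 < nm p`_0 by rewrite nm_gt0.
  have k0 : (nm p`_0)%:K != 0 by rewrite -nm_gt0 nm_real normr_gt0 gt_eqF.
  have k1 : (nm p`_j)%:K != 0 by rewrite -nm_gt0 nm_real normr_gt0 gt_eqF.
  exists (p`_0 / (nm p`_0)%:K * ((nm p`_j)%:K / p`_j)).
    by rewrite !nmM !nmV !nm_real !ger0_norm ?nm_ge0 // mulfV ?gt_eqF // mul1r mulfV ?gt_eqF.
  have -> : p`_0 + p`_0 / (nm p`_0)%:K * ((nm p`_j)%:K / p`_j) * p`_j * r%:K ^+ j / 2 =
     p`_0 * (1 + (nm p`_j * r ^+ j / (nm p`_0) / 2)%:K).
    rewrite !rmorphM /= !fmorphV rmorphXn /=; set rr := _ ^+ j.
    have -> : (2 : R)%:K = 2 by rewrite rmorph_nat.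
    by field; rewrite k0 cj0.
  have p0 : 0 <= nm p`_j * r ^+ j / nm p`_0 / 2 by rewrite !mulr_ge0 ?invr_ge0 ?nm_ge0 ?exprn_ge0 ?ltW.
  rewrite nmM -(rmorph1 (real_complex R)) -rmorphD nm_real ger0_norm ?addr_ge0 //.
  by field; rewrite gt_eqF.
(* Since [nm (t k) = 1], the weights [w k] are nonnegative, and by [sw] their total mass is n, as
   for a plain average. *)
pose t k : CC := u * z ^+ (k * (n - j)).
pose w k : R := 1 + complex.Re (t k).
have nt k : nm (t k) = 1 by rewrite /t nmM nmX nz expr1n mulr1.
have w0 k : 0 <= w k.
  have := nm_Re (t k); rewrite nt ler_norml => /andP[]; rewrite /w; lra.
have tc k : (t k)^* = u^* * z ^+ (k * j).
  rewrite /t rmorphM rmorphXn /=; congr (_ * _).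
  have zc : z * z^* = 1 by rewrite -normCK nmE nz expr1n.
  have z0 : z != 0 by rewrite -nm_gt0 nz.
  have -> : z^* = z^-1 by apply: (mulfI z0); rewrite zc mulfV.
  apply: (mulfI (expf_neq0 (k * (n - j)) z0)); rewrite exprVn mulfV ?expf_neq0 //.
  by rewrite -exprD -mulnDr subnK ?leq_addl // mulnC exprM zn expr1n.
have wE k : (w k)%:K = 1 + (t k + (t k)^*) / 2.
  by rewrite /w rmorphD /= rmorph1; congr (_ + _); rewrite ReJ_add.
pose S m := \sum_(k < n) p.[r%:K * z ^+ k] * z ^+ (k * m).
have S0 : S 0%N = n%:R * p`_0.
  rewrite /S unity_filter // (bigD1 (Ordinal (leq_ltn_trans (leq0n _) jp))) //=.
  rewrite big1 ?addr0 ?expr0 ?mulr1 // => i /andP[di]; rewrite -val_eqE /= => ij; exfalso.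
  by move: di ij; rewrite addn0 /dvdn modn_small ?ltn_addr // => ->.
have S1 : S (n - j)%N = n%:R * (p`_j * r%:K ^+ j).
  rewrite /S unity_filter // (bigD1 (Ordinal jp)) //=; last by rewrite subnKC // leq_addl.
  rewrite big1 ?addr0 // => i /andP[di]; rewrite -val_eqE /= => ij; exfalso.
  have e : (i + (n - j) = n)%N.
    apply: dvdn_lt_double => //; rewrite /n addnK.
      by rewrite addn_gt0 (leq_ltn_trans _ jp) // orbT.
    by rewrite -addnn -addSn leq_add ?leq_addr // ltn_addr.
  by move: ij; rewrite -(eqn_add2r (n - j)) e subnKC ?eqxx // leq_addl.
have S2 : S j = 0.
  rewrite /S unity_filter // big1 ?mulr0 // => i di; exfalso.
  move: di; rewrite /dvdn modn_small ?ltn_add2r //.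
  by rewrite addn_eq0 (gtn_eqF j0) andbF.
have main : \sum_(k < n) p.[r%:K * z ^+ k] * (w k)%:K = n%:R * (p`_0 + u * p`_j * r%:K ^+ j / 2).
  have -> : \sum_(k < n) p.[r%:K * z ^+ k] * (w k)%:K = S 0%N + u / 2 * S (n - j)%N + u^* / 2 * S j.
    rewrite /S !mulr_sumr -!big_split /=; apply: eq_bigr => k _.
    by rewrite wE tc /t muln0 expr0; ring.
  by rewrite S0 S1 S2; ring.
have sw : \sum_(k < n) w k = n%:R.
  have zj : z ^+ j <> 1.
    move/eqP; rewrite -(prim_order_dvd hz) /dvdn modn_small ?(gtn_eqF j0) //.
    by rewrite -[X in (X < _)%N]add0n ltn_add2r (leq_ltn_trans _ jp).
  have g1 : \sum_(k < n) t k = 0.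
    rewrite /t -mulr_sumr; under eq_bigr do rewrite mulnC exprM.
    rewrite geom_unity; last by rewrite exprAC zn expr1n.
    case: eqVneq => [e|]; last by rewrite mulr0.
    exfalso; apply: zj; have : z ^+ (j + (n - j)) = 1 by rewrite subnKC ?leq_addl.
    by rewrite exprD e mulr1.
  rewrite /w big_split /= sumr_const card_ord -[RHS]addr0; congr (_ + _).
  by rewrite -raddf_sum g1.
have : nm (n%:R * (p`_0 + u * p`_j * r%:K ^+ j / 2)) <= n%:R * B.
  rewrite -main -sw mulr_suml; apply: le_trans (nm_sum _ _ _ _) _.
  apply: ler_sum => k _; rewrite nmM nm_real (ger0_norm (w0 _)) mulrC ler_wpM2l //.
  by apply: hB; rewrite nmM nmX nz nm_real expr1n mulr1 gtr0_norm.
by rewrite nmM nm_nat hu ler_pM2l // ltr0n.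
Qed.

(** An approximant within d of f satisfies |p(0)| >= |f(a)| - d and |p| <= |f(a)| + d on the disc,
    so [coef_bound0] bounds its j-th coefficient by 4 d / r^j. On the half disc p then moves by at
    most 4 d and f by at most 6 d, which is e. *)
Lemma local_max r f a : 0 < r -> happ r f a ->
  (forall h, nm h <= r -> nm (f (a + h)) <= nm (f a)) ->
  forall h, nm h <= r / 2 -> f (a + h) = f a.
Proof.
move=> r0 hf hM h hr; apply/eqP; rewrite -subr_eq0; apply/eqP/nm_small => e e0.
have [p hp] := hf (e / 6) ltac:(lra).
set d := e / 6 in hp *.
have de : e = 6 * d by rewrite /d; field.
have c0 : nm (f a) - d <= nm p`_0.
  have := hp 0 ltac:(by rewrite nm0 ltW); rewrite addr0 horner_coef0.
  have := nm_ge_sub (f a) (f a - p`_0); rewrite opprB addrCA subrr addr0; lra.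
have pB x : nm x <= r -> nm p.[x] <= nm (f a) + d.
  move=> xr; have := hp x xr; have := hM x xr.
  have := nmB (f (a + x)) (f (a + x) - p.[x]); rewrite opprB addrCA subrr addr0; lra.
have cj j : (0 < j)%N -> nm p`_j * r ^+ j <= 4 * d.
  by move=> j0; have := coef_bound0 p r _ j r0 j0 pB; lra.
have pp : nm (p.[h] - p`_0) <= 4 * d.
  have /factor_theorem [q hq] : root (p - (p`_0)%:P) 0 by rewrite /root -horner_coef0 !hornerE subrr.
  have qE : p - (p`_0)%:P = q * 'X by rewrite hq subr0.
  have -> : p.[h] - p`_0 = (q * 'X).[h] by rewrite -qE !hornerE.
  rewrite hornerM hornerX horner_coef mulr_suml; apply: le_trans (nm_sum _ _ _ _) _.
  apply: (@le_trans _ _ (\sum_(i < size q) 4 * d * (1 / 2) ^+ i.+1)).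
    apply: ler_sum => i _; rewrite -mulrA -exprSr nmM nmX.
    have -> : q`_i = p`_i.+1.
      by have := congr1 (fun s : {poly CC} => s`_i.+1) qE; rewrite coefMX coefB coefC /= subr0.
    apply: (@le_trans _ _ (nm p`_i.+1 * (r / 2) ^+ i.+1)).
      by rewrite ler_wpM2l ?nm_ge0 // lerXn2r ?nnegrE ?nm_ge0 // divr_ge0 // ltW.
    by rewrite expr_div_n expr_div_n expr1n mulrA mul1r ler_wpM2r ?invr_ge0 ?exprn_ge0 ?cj.
  rewrite -mulr_sumr.
  have S n : \sum_(i < n) (1 / 2 : R) ^+ i.+1 = 1 - (1 / 2) ^+ n.
    elim: n => [|n ih]; first by rewrite big_ord0 expr0 subrr.
    by rewrite big_ord_recr /= ih exprS; field.
  rewrite S; have hn : 0 <= (1 / 2 : R) ^+ (size q) by rewrite exprn_ge0.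
  have d0 : 0 <= d by lra.
  by rewrite ler_piMr ?mulr_ge0 //; lra.
have := hp h ltac:(lra); have := hp 0 ltac:(by rewrite nm0 ltW); rewrite addr0 horner_coef0.
have := nm_tri p.[h] (f (a + h)) (f a); have := nm_tri p`_0 p.[h] (f a).
rewrite (nmBC p`_0 (f a)); lra.
Qed.

(** Real coordinates can be reduced modulo the integers, so all values of f are taken on the image
    of the compact square [0,1]^2. *)
Lemma periodic_max (f : CC -> CC) (w1 w2 : CC) :
  (forall a, hol f a) -> (forall z, exists s t : R, z = s%:K * w1 + t%:K * w2) ->
  (forall z, f (z + w1) = f z) -> (forall z, f (z + w2) = f z) ->
  exists c, forall z, nm (f z) <= nm (f c).
Proof.
move=> hf span p1 p2.
have fz w (pw : forall z, f (z + w) = f z) (m : int) z : f (z + m%:~R * w) = f z.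
  have fn (n : nat) y : f (y + n%:R * w) = f y.
    elim: n => [|n ih]; first by rewrite mul0r addr0.
    by rewrite -addn1 natrD mulrDl mul1r addrA pw.
  case: m => n; first exact: fn.
  rewrite NegzE rmorphN mulNr -[in RHS](subrK (n.+1%:R * w) z) fn //.
pose g (v : 'rV[R]_2) : CC := (v ord0 ord0)%:K * w1 + (v ord0 ord_max)%:K * w2.
pose F (v : 'rV[R]_2) : R := nm (f (g v)).
pose A : set 'rV[R]_2 := [set v : 'rV[R]_2 | forall i, (`[0, 1]%classic : set R) (v ord0 i)]%classic.
have cA : compact A.
  by apply: (@rV_compact R 2 (fun=> `[0, 1]%classic)) => _; exact: segment_compact.
have A0 : (A !=set0)%classic.
  by exists 0 => i /=; rewrite mxE in_itv /= lexx ler01.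
have cF : continuous F.
  move=> v; apply/(@cvgrPdist_le R R^o _ (nbhs v) (nbhs_filter v)) => e e0.
  have [d d0 hd] := hol_cont _ _ (hf (g v)) e e0.
  pose L := nm w1 + nm w2 + 1.
  have L0 : 0 < L by rewrite /L; have := nm_ge0 w1; have := nm_ge0 w2; lra.
  apply/nbhs_ballP; exists (d / L) => /=; first by rewrite divr_gt0.
  move=> v' [_ hv'].
  have b0 := hv' ord0 ord0; have b1 := hv' ord0 ord_max.
  rewrite /ball /= in b0 b1.
  have dg : nm (g v' - g v) <= d.
    have -> : g v' - g v = (v' ord0 ord0 - v ord0 ord0)%:K * w1 + (v' ord0 ord_max - v ord0 ord_max)%:K * w2.
      by rewrite /g !rmorphB /=; ring.
    apply: le_trans (nmD _ _) _; rewrite !nmM !nm_real ![`|v' _ _ - _|]distrC.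
    apply: (@le_trans _ _ (d / L * nm w1 + d / L * nm w2)).
      by apply: lerD; rewrite ler_wpM2r ?nm_ge0 // ltW.
    rewrite -mulrDr mulrAC ler_pdivrMr // ler_wpM2l ?(ltW d0) // /L; lra.
  have := hd _ dg; rewrite [g v + _]addrC subrK => h.
  rewrite /F distrC ler_norml.
  have := nm_ge_sub (f (g v')) (f (g v)); have := nm_ge_sub (f (g v)) (f (g v')).
  by rewrite (nmBC (f (g v))) => ? ?; apply/andP; split; lra.
have [c _ hc] := compact_EVT_max A0 cA (continuous_subspaceT cF).
exists (g c) => z; have [s [t ->]] := span z.
have frac (x : R) : exists (m : int) (y : R), 0 <= y <= 1 /\ x = y + m%:~R.
  exists (Num.floor x), (x - (Num.floor x)%:~R); split; last by rewrite subrK.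
  by have := floor_itv x => /andP[h1 h2]; rewrite intrD1 in h2; lra.
have [m [s' [s01 ->]]] := frac s; have [k [t' [t01 ->]]] := frac t.
have -> : (s' + m%:~R)%:K * w1 + (t' + k%:~R)%:K * w2 = s'%:K * w1 + t'%:K * w2 + m%:~R * w1 + k%:~R * w2.
  by rewrite !rmorphD /= !rmorph_int; ring.
rewrite (fz w2) // (fz w1) //.
pose v : 'rV[R]_2 := \row_i if i == ord0 then s' else t'.
have := hc v; rewrite /F /g /v !mxE /= => h; apply: h.
rewrite inE => i /=; rewrite mxE; case: ifP => _; rewrite in_itv /=; [exact: s01|exact: t01].
Qed.

(** A periodic entire function attains its maximum at some c. By [local_max] the set where it keeps
    the value f(c) is open, by continuity it is closed; connectedness is used along the segment from
    c to y, as a supremum argument on the parameter. *)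
Lemma liouville (f : CC -> CC) (w1 w2 : CC) :
  (forall a, hol f a) -> (forall z, exists s t : R, z = s%:K * w1 + t%:K * w2) ->
  (forall z, f (z + w1) = f z) -> (forall z, f (z + w2) = f z) ->
  forall x y, f x = f y.
Proof.
move=> hf span p1 p2.
have [c hc] := periodic_max f w1 w2 hf span p1 p2.
suff H y : f y = f c by move=> x y; rewrite !H.
pose g (t : R) : CC := f (c + t%:K * (y - c)).
pose A : set R := [set t : R | 0 <= t /\ forall s, 0 <= s <= t -> g s = f c]%classic.
have step t : g t = f c -> exists2 d : R, 0 < d & forall s, `|s - t| <= d -> g s = f c.
  move=> gt; have [r r0 hr] := hf (c + t%:K * (y - c)).
  have L0 : 0 < nm (y - c) + 1 by have := nm_ge0 (y - c); lra.
  exists (r / 2 / (nm (y - c) + 1)); first by rewrite !divr_gt0.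
  move=> s hs; rewrite /g.
  have -> : c + s%:K * (y - c) = c + t%:K * (y - c) + (s - t)%:K * (y - c).
    by rewrite rmorphB /=; ring.
  rewrite (local_max _ _ _ r0 hr) //; first by move=> h _; rewrite -/(g t) gt.
  rewrite nmM nm_real; apply: le_trans (_ : r / 2 / (nm (y - c) + 1) * (nm (y - c) + 1) <= _).
    by apply: ler_pM => //; rewrite ?nm_ge0 //; lra.
  by rewrite divfK // gt_eqF.
have cont t : forall e : R, 0 < e -> exists2 d : R, 0 < d & forall s, `|s - t| <= d -> nm (g s - g t) <= e.
  move=> e e0; have [d d0 hd] := hol_cont _ _ (hf (c + t%:K * (y - c))) e e0.
  have L0 : 0 < nm (y - c) + 1 by have := nm_ge0 (y - c); lra.
  exists (d / (nm (y - c) + 1)); first by rewrite divr_gt0.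
  move=> s hs; rewrite /g.
  have -> : c + s%:K * (y - c) = c + t%:K * (y - c) + (s - t)%:K * (y - c).
    by rewrite rmorphB /=; ring.
  apply: hd; rewrite nmM nm_real; apply: le_trans (_ : d / (nm (y - c) + 1) * (nm (y - c) + 1) <= _).
    by apply: ler_pM => //; rewrite ?nm_ge0 //; lra.
  by rewrite divfK // gt_eqF.
have g0 : g 0 = f c by rewrite /g rmorph0 mul0r addr0.
have A0 : A 0.
  by split => // s /andP[s0 s1]; have -> : s = 0 by apply/eqP; rewrite eq_le s0 s1.
have g1 : g 1 = f y by rewrite /g rmorph1 mul1r addrC subrK.
have [[t [At t1]]|hn] := pselect (exists t, A t /\ 1 <= t).
  by rewrite -g1; apply At.2; rewrite t1 ler01.
exfalso.
have ubA : ubound A 1.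
  by move=> t At; rewrite leNgt; apply/negP => t1; apply: hn; exists t; split => //; exact: ltW.
have supA : has_sup A by split; [exists 0|exists 1].
pose t := sup A.
have t0 : 0 <= t by apply: sup_ubound A0; case: supA.
have below s : 0 <= s -> s < t -> g s = f c.
  move=> s0 st; have [|u Au su] := @sup_adherent R A (t - s) _ supA; first by rewrite subr_gt0.
  by apply Au.2; rewrite s0 /=; rewrite -/t in su; lra.
have gt : g t = f c.
  move: t0; rewrite le0r => /orP[/eqP->//|t0].
  apply/eqP; rewrite -subr_eq0; apply/eqP/nm_small => e e0.
  have [d d0 hd] := cont t e e0.
  pose s := Order.max 0 (t - d).
  have hs : 0 <= s /\ s < t /\ `|s - t| <= d.
    rewrite /s; case: (lerP (t - d) 0) => h; split => //; (try split); try lra.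
      by rewrite sub0r normrN gtr0_norm //; lra.
    by rewrite ltr0_norm; lra.
  by have := hd s hs.2.2; rewrite (below s) ?hs.1 ?hs.2.1 // nmBC.
have [d d0 hd] := step t gt.
have : A (t + d).
  split; first by lra.
  move=> s /andP[s0 sd]; case: (ltrP s t) => st; first exact: below.
  by apply: hd; rewrite ger0_norm; lra.
move=> /(sup_ubound (proj2 supA)); rewrite -/t; lra.
Qed.

(** * Sums and products over square boxes *)

Definition height (p : int * int) : nat := maxn `|p.1|%N `|p.2|%N.

(** One list of pairs in place of two nested index ranges; [locked] protects the enumeration from
    being unfolded. *)
Definition box (N : nat) : seq (int * int) :=
  locked [seq (i%:Z - N%:Z, j%:Z - N%:Z) | i <- iota 0 N.*2.+1, j <- iota 0 N.*2.+1].

Lemma mem_box N p : (p \in box N) = (height p <= N)%N.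
Proof.
case: p => m k; rewrite /height /= geq_max /box -lock; apply/allpairsP/andP.
  by move=> [[i j] [hi hj [-> ->]]]; rewrite !mem_iota /= in hi hj; rewrite /=; lia.
move=> [hm hk]; exists (absz (m + N%:Z), absz (k + N%:Z)); rewrite !mem_iota /=.
by split; [lia|lia|congr (_, _); lia].
Qed.

Lemma box_uniq N : uniq (box N).
Proof.
rewrite /box -lock; apply: allpairs_uniq; rewrite ?iota_uniq // => -[i j] [i' j'] /= _ _ [h1 h2].
by congr (_, _); lia.
Qed.

Lemma size_box N : size (box N) = (N.*2.+1 ^ 2)%N.
Proof. by rewrite /box -lock size_allpairs size_iota. Qed.

Lemma sqbox (T : Type) (idx : T) (op : Monoid.com_law idx) N (F : int -> int -> T) :
  \big[op/idx]_(i < N.*2.+1) \big[op/idx]_(j < N.*2.+1) F (i%:Z - N%:Z) (j%:Z - N%:Z) =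
  \big[op/idx]_(p <- box N) F p.1 p.2.
Proof.
rewrite /box -lock big_allpairs_dep.
transitivity (\big[op/idx]_(0 <= i < N.*2.+1) \big[op/idx]_(0 <= j < N.*2.+1) F (i%:Z - N%:Z) (j%:Z - N%:Z)).
  by rewrite big_mkord; apply: eq_bigr => i _; rewrite big_mkord.
by rewrite /index_iota subn0.
Qed.

Lemma sq_sumE N F : sq_sum N F = \sum_(p <- box N) F p.1 p.2.
Proof. exact: sqbox. Qed.
Lemma sq_prodE N F : sq_prod N F = \prod_(p <- box N) F p.1 p.2.
Proof. exact: sqbox. Qed.

Definition ann N M : seq (int * int) := [seq p <- box M | (N < height p)%N].

Lemma mem_ann N M p : (p \in ann N M) = (N < height p <= M)%N.
Proof. by rewrite mem_filter mem_box. Qed.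

Lemma box_ann N M : (N <= M)%N -> perm_eq (box M) (box N ++ ann N M).
Proof.
move=> NM; apply: uniq_perm; first exact: box_uniq.
  rewrite cat_uniq box_uniq filter_uniq ?box_uniq // andbT; apply/hasPn => p.
  by rewrite mem_ann => /andP[h _]; rewrite /= mem_box -ltnNge.
by move=> p; rewrite mem_cat mem_ann !mem_box; lia.
Qed.

Lemma perm_box_map (f g : int * int -> int * int) N :
  cancel f g -> cancel g f -> (forall p, height (f p) = height p) -> perm_eq (map f (box N)) (box N).
Proof.
move=> fK gK hf; apply: uniq_perm; rewrite ?box_uniq ?map_inj_uniq ?box_uniq //; first exact: can_inj fK.
move=> p; apply/mapP/idP => [[q qb ->]|pb]; first by rewrite mem_box hf -mem_box.
by exists (g p); rewrite ?gK // mem_box -hf gK -mem_box.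
Qed.

Lemma box_opp N : perm_eq (map (fun p : int * int => (- p.1, - p.2)) (box N)) (box N).
Proof.
apply: (@perm_box_map _ (fun p : int * int => (- p.1, - p.2))); try by case=> a b; rewrite /= !opprK.
by case=> a b; rewrite /height /= !abszN.
Qed.

Lemma box_swap N : perm_eq (map (fun p : int * int => (p.2, p.1)) (box N)) (box N).
Proof.
apply: (@perm_box_map _ (fun p : int * int => (p.2, p.1))); try by case.
by case=> a b; rewrite /height /= maxnC.
Qed.

Definition col (c : int) (N : nat) : seq (int * int) :=
  locked [seq (c, j%:Z - N%:Z) | j <- iota 0 N.*2.+1].

Lemma mem_col c N p : (p \in col c N) = (p.1 == c) && (`|p.2| <= N)%N.
Proof.
case: p => m k; rewrite /col -lock; apply/mapP/andP.
  by move=> [j]; rewrite mem_iota => hj [-> ->]; split => //=; lia.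
move=> [/eqP hm hk]; simpl in hm, hk; rewrite hm; exists (absz (k + N%:Z)); [rewrite mem_iota /=; lia|congr (_, _); lia].
Qed.
Lemma size_col c N : size (col c N) = N.*2.+1.
Proof. by rewrite /col -lock size_map size_iota. Qed.
Lemma col_uniq c N : uniq (col c N).
Proof. by rewrite /col -lock map_inj_uniq ?iota_uniq // => i j [h]; lia. Qed.

(** Moving the box by -1 in the first coordinate gains the column -(N+1) and loses the column N;
    each column is written on the side where it is added. *)
Lemma box_shift N : perm_eq (map (fun p : int * int => (p.1 - 1, p.2)) (box N) ++ col N N)
  (box N ++ col (- N.+1%:Z) N).
Proof.
have mm p : (p \in map (fun p : int * int => (p.1 - 1, p.2)) (box N)) = ((p.1 + 1, p.2) \in box N).
  apply/mapP/idP => [[[a b] q ->]|h] /=; first by rewrite subrK.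
  by exists (p.1 + 1, p.2) => //=; case: p h => a b _; rewrite addrK.
apply: uniq_perm; rewrite ?cat_uniq ?col_uniq ?box_uniq ?andbT /=.
- apply/andP; split.
    by rewrite map_inj_uniq ?box_uniq // => -[a b] [c d] /= [h ->]; congr (_, _); lia.
  apply/hasPn => -[a b]; rewrite mem_col mm mem_box /height /= => h; apply/negP; lia.
- by apply/hasPn => -[a b]; rewrite mem_col mem_box /height /= => h; apply/negP; lia.
move=> -[a b]; rewrite !mem_cat mm !mem_col !mem_box /height /=; lia.
Qed.

(** The universal majorant: cubic decay is summable over a plane lattice. The successor keeps the
    weight finite at the origin. *)
Definition wt (p : int * int) : R := (height p).+1%:R ^- 3.

Lemma wt_gt0 p : 0 < wt p.
Proof. by rewrite invr_gt0 exprn_gt0 // ltr0n. Qed.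

(** There are 8(N+1) lattice indices of height N+1, and the bound is chosen to telescope. *)
Lemma wt_step N : \sum_(p <- ann N N.+1) wt p <= 8 * (N.+1%:R^-1 - N.+2%:R^-1).
Proof.
have -> : \sum_(p <- ann N N.+1) wt p = (size (ann N N.+1))%:R * N.+2%:R ^- 3.
  rewrite -sum1_size natr_sum mulr_suml big_seq [RHS]big_seq; apply: eq_bigr => p.
  rewrite mul1r.
  by rewrite mem_ann /wt => /andP[h1 h2]; rewrite (anti_leq (introT andP (conj h2 h1))).
have -> : size (ann N N.+1) = (8 * N.+1)%N.
  have := perm_size (box_ann N N.+1 (leqnSn N)); rewrite size_cat !size_box; move: (size _) => s; rewrite -!mulnn -!mul2n => e; nia.
rewrite natrM.
have h1 : (0 : R) < N.+1%:R by rewrite ltr0n.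
have -> : (N.+2%:R : R) = N.+1%:R + 1 by rewrite -addn1 natrD.
move: (N.+1%:R : R) h1 => x x0.
have -> : 8 * (x^-1 - (x + 1)^-1) = 8 * ((x + 1) ^+ 2 / x) * (x + 1) ^- 3.
  by field; rewrite !gt_eqF //; lra.
rewrite ler_wpM2r ?invr_ge0 ?exprn_ge0 //; first lra.
rewrite ler_wpM2l //.
by rewrite ler_pdivlMr //; nra.
Qed.

Lemma wt_ann N M : (N <= M)%N -> \sum_(p <- ann N M) wt p <= 8 * (N.+1%:R^-1 - M.+1%:R^-1).
Proof.
elim: M => [|M ih]; first by rewrite leqn0 => /eqP ->; rewrite subrr mulr0 big1_seq // => p; rewrite mem_ann; lia.
rewrite leq_eqVlt => /orP[/eqP ->|NM].
  rewrite subrr mulr0 /ann big_filter big1_seq // => p.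
  by rewrite mem_box => /andP[h1 h2]; move: h1; rewrite ltnNge h2.
have -> : \sum_(p <- ann N M.+1) wt p = \sum_(p <- ann N M) wt p + \sum_(p <- ann M M.+1) wt p.
  rewrite -big_cat; apply: perm_big; apply/permP => a.
  have := permP (box_ann N M.+1 (leqW NM)) a; have := permP (box_ann N M NM) a.
  have := permP (box_ann M M.+1 (leqnSn M)) a; rewrite !count_cat; lia.
by apply: le_trans (lerD (ih NM) (wt_step M)) _; rewrite -mulrDr addrA subrK.
Qed.

Lemma sum_le_wt (G : int * int -> R) K s : (forall p, G p <= K * wt p) ->
  \sum_(p <- s) G p <= K * \sum_(p <- s) wt p.
Proof. by move=> h; rewrite mulr_sumr; apply: ler_sum. Qed.

Lemma ann_le (G : int * int -> R) K N M : 0 <= K -> (N <= M)%N -> (forall p, G p <= K * wt p) ->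
  \sum_(p <- ann N M) G p <= 8 * K / N.+1%:R.
Proof.
move=> K0 NM h; apply: le_trans (sum_le_wt _ _ _ h) _.
have := wt_ann N M NM; have m0 : 0 < (M.+1%:R : R)^-1 by rewrite invr_gt0 ltr0n.
move: (N.+1%:R^-1 : R) (M.+1%:R^-1 : R) m0 => x y y0 h2; nra.
Qed.

Lemma box_le (G : int * int -> R) K N : 0 <= K -> (forall p, G p <= K * wt p) ->
  \sum_(p <- box N) G p <= 9 * K.
Proof.
move=> K0 h; rewrite (perm_big _ (box_ann 0 N (leq0n _))) big_cat /=.
have := ann_le G K 0 N K0 (leq0n _) h; rewrite divr1.
have -> : \sum_(p <- box 0) G p = G (0, 0) by rewrite (_ : box 0 = [:: (0, 0)]) ?big_seq1 // /box -lock.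
have := h (0, 0); rewrite /wt /height /= expr1n invr1; lra.
Qed.

Lemma boxsum_close (F : int * int -> CC) (K : R) N M : 0 <= K -> (N <= M)%N ->
  (forall p, nm (F p) <= K * wt p) ->
  nm (\sum_(p <- box M) F p - \sum_(p <- box N) F p) <= 8 * K / N.+1%:R.
Proof.
move=> K0 NM h; rewrite (perm_big _ (box_ann N M NM)) big_cat /= addrAC subrr add0r.
by apply: le_trans (nm_sum _ _ _ _) _; exact: ann_le.
Qed.

(** The constant 9 is 8 for the annuli plus 1 for the origin. The rate depends on [K] only, so it is
    uniform in any parameter of which [K] is independent; this is how limits become holomorphic. *)
Lemma boxsum_tends (F : int * int -> CC) (K : R) : 0 <= K -> (forall p, nm (F p) <= K * wt p) ->
  exists2 l, tends (fun N => \sum_(p <- box N) F p) l &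
    nm l <= 9 * K /\ forall N, nm (\sum_(p <- box N) F p - l) <= 8 * K / N.+1%:R.
Proof.
move=> K0 h.
have [|l hl] := cauchy_tends (fun N => \sum_(p <- box N) F p).
  move=> e e0; have [N hN] := nat_eps (16 * K) e e0.
  exists N => m n hm hn; have := hN N (leqnn _).
  have -> : 16 * K / N.+1%:R = 8 * K / N.+1%:R + 8 * K / N.+1%:R by ring.
  have := boxsum_close _ _ _ _ K0 hm h; have := boxsum_close _ _ _ _ K0 hn h.
  move: (8 * K / _) => x.
  have := nm_tri (\sum_(p <- box N) F p) (\sum_(p <- box m) F p) (\sum_(p <- box n) F p).
  by rewrite (nmBC (\sum_(p <- box N) F p)); lra.
exists l => //; split.
  apply: (tends_le _ _ _ 0%N hl) => n _; apply: le_trans (nm_sum _ _ _ _) _.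
  exact: box_le.
move=> N; rewrite nmBC.
have tt : tends (fun M => \sum_(p <- box M) F p - \sum_(p <- box N) F p) (l - \sum_(p <- box N) F p).
  by apply: tendsB hl _; exact: tends_cst.
by apply: (tends_le _ _ _ N tt) => M NM; apply: boxsum_close.
Qed.

Lemma nm_prod_le (s : seq (int * int)) (F : int * int -> CC) :
  nm (\prod_(p <- s) F p) <= expR (\sum_(p <- s) nm (F p - 1)).
Proof.
rewrite nm_prod expR_sum; apply: ler_prod => p _; rewrite nm_ge0 /=.
apply: le_trans (expR_ge1Dx _); have := nmD (F p - 1) 1; rewrite subrK nm1; lra.
Qed.

Lemma nm_prod1_le (s : seq (int * int)) (F : int * int -> CC) :
  nm (\prod_(p <- s) F p - 1) <= expR (\sum_(p <- s) nm (F p - 1)) - 1.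
Proof.
elim: s => [|p s ih]; first by rewrite !big_nil subrr nm0 exp.expR0 subrr.
rewrite !big_cons exp.expRD.
have -> : F p * \prod_(j <- s) F j - 1 = (F p - 1) * \prod_(j <- s) F j + (\prod_(j <- s) F j - 1) by ring.
apply: le_trans (nmD _ _) _; rewrite nmM.
have h1 := nm_prod_le s F; have h2 := expR_ge1Dx (nm (F p - 1)).
have h3 := expR_ge0 (\sum_(p <- s) nm (F p - 1)); have h4 := nm_ge0 (F p - 1).
set E := expR (\sum_(p <- s) _) in ih h1 h3 *; set x := nm (F p - 1) in h2 h4 *.
have : x * nm (\prod_(j <- s) F j) <= x * E by rewrite ler_wpM2l.
nra.
Qed.

Lemma expR_sub1_le (x : R) : 0 <= x <= 1 / 2 -> expR x - 1 <= 2 * x.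
Proof.
move=> /andP[x0 x1]; have := expR_ub x; rewrite ger0_norm // => /(_ x1).
rewrite ler_norml => /andP[_]; nra.
Qed.

(** The error is relative to the partial product, which is needed for the limit to be nonzero. The
    condition on N makes the exponent at most 1/2, where [expR x - 1 <= 2 * x]. *)
Lemma boxprod_close (F : int * int -> CC) (K : R) N M : 0 <= K -> (N <= M)%N -> 16 * K <= N.+1%:R ->
  (forall p, nm (F p - 1) <= K * wt p) ->
  nm (\prod_(p <- box M) F p - \prod_(p <- box N) F p) <=
    nm (\prod_(p <- box N) F p) * (16 * K / N.+1%:R).
Proof.
move=> K0 NM KN h; rewrite (perm_big _ (box_ann N M NM)) big_cat /=.
rewrite -[X in _ - X]mulr1 -mulrBr nmM ler_wpM2l ?nm_ge0 //.
apply: le_trans (nm_prod1_le _ _) _.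
have hs := ann_le _ _ N M K0 NM h.
have N0 : (0 : R) < N.+1%:R by rewrite ltr0n.
apply: (@le_trans _ _ (2 * (\sum_(p <- ann N M) nm (F p - 1)))).
  apply: expR_sub1_le; rewrite sumr_ge0 /=; last by move=> *; exact: nm_ge0.
  by apply: le_trans hs _; rewrite ler_pdivrMr //; lra.
have -> : 16 * K / N.+1%:R = 2 * (8 * K / N.+1%:R) by ring.
by rewrite ler_wpM2l.
Qed.

Lemma boxprod_tends (F : int * int -> CC) (K : R) : 0 <= K -> (forall p, nm (F p - 1) <= K * wt p) ->
  exists2 l, tends (fun N => \prod_(p <- box N) F p) l &
   (forall N, 16 * K <= N.+1%:R -> nm (\prod_(p <- box N) F p - l) <= expR (9 * K) * (16 * K / N.+1%:R)) /\
   ((forall p, F p != 0) -> l != 0).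
Proof.
move=> K0 h; pose P N := \prod_(p <- box N) F p.
have PB N : nm (P N) <= expR (9 * K).
  by apply: le_trans (nm_prod_le _ _) _; rewrite ler_expR; apply: box_le.
have cl N M : (N <= M)%N -> 16 * K <= N.+1%:R -> nm (P M - P N) <= expR (9 * K) * (16 * K / N.+1%:R).
  move=> NM KN; apply: le_trans (boxprod_close _ _ _ _ K0 NM KN h) _.
  by apply: ler_wpM2r; [rewrite divr_ge0 ?mulr_ge0|exact: PB].
have [N0 hN0] := nat_eps (16 * K) 1 ltr01.
have KN N : (N0 <= N)%N -> 16 * K <= N.+1%:R.
  by move=> /hN0; rewrite ler_pdivrMr ?mul1r // ltr0n.
have [|l hl] := cauchy_tends P.
  move=> e e0; have [N hN] := nat_eps (2 * (expR (9 * K) * (16 * K))) e e0.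
  exists (maxn N0 N) => m n hm hn.
  have := hN (maxn N0 N) (leq_maxr _ _).
  have k := KN _ (leq_maxl N0 N).
  have -> : 2 * (expR (9 * K) * (16 * K)) / (maxn N0 N).+1%:R =
    expR (9 * K) * (16 * K / (maxn N0 N).+1%:R) + expR (9 * K) * (16 * K / (maxn N0 N).+1%:R) by ring.
  have := cl _ _ hm k; have := cl _ _ hn k; move: (expR _ * (16 * K / _)) => x.
  have := nm_tri (P (maxn N0 N)) (P m) (P n); rewrite (nmBC (P (maxn N0 N))); lra.
exists l => //; split.
  move=> N hK; rewrite nmBC.
  have tt : tends (fun M => P M - P N) (l - P N) by apply: tendsB hl _; exact: tends_cst.
  by apply: (tends_le _ _ _ N tt) => M NM; apply: cl.
move=> F0; have [N1 hN1] := nat_eps (16 * K) (1 / 2) ltac:(lra).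
pose N := maxn N0 N1.
have PN0 : 0 < nm (P N) by rewrite nm_gt0 prodf_seq_neq0; apply/allP => p _; rewrite F0.
have tt : tends (fun M => P M - P N) (l - P N) by apply: tendsB hl _; exact: tends_cst.
(* The limit stays within half the modulus of a nonzero partial product, hence is nonzero. *)
have : nm (l - P N) <= nm (P N) * (1 / 2).
  apply: (tends_le _ _ _ N tt) => M NM.
  apply: le_trans (boxprod_close _ _ _ _ K0 NM (KN _ (leq_maxl _ _)) h) _.
  by rewrite ler_wpM2l ?nm_ge0 // hN1 // leq_maxr.
rewrite -nm_gt0 => hl2; have := nm_ge_sub (P N) (P N - l); rewrite opprB addrCA subrr addr0 nmBC; lra.
Qed.

(** * Lattice sums and the Weierstrass functions *)

Definition indep (w1 w2 : CC) : Prop :=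
  forall r s : R, r%:K * w1 + s%:K * w2 = 0 -> r = 0 /\ s = 0.

Definition latp (w1 w2 : CC) (p : int * int) : CC := latt w1 w2 p.1 p.2.
Definition nzp (p : int * int) : bool := nz p.1 p.2.
Definition Lim (u : nat -> CC) : CC := lim (u @ \oo)%classic.

Lemma Lim_tends u : (exists l, tends u l) -> tends u (Lim u).
Proof. by move=> [l h]; rewrite /Lim (tends_lim u l h). Qed.

Lemma indep_det w1 w2 : indep w1 w2 ->
  complex.Re w1 * complex.Im w2 - complex.Im w1 * complex.Re w2 != 0.
Proof.
case: w1 => a b; case: w2 => c d h; rewrite /=; apply/eqP => D.
have eis r s : r * a + s * c = 0 -> r * b + s * d = 0 -> r = 0 /\ s = 0.
  move=> h1 h2; apply: h; apply/eqP; rewrite eq_complex /= !mul0r !subr0 !addr0.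
  by rewrite h1 h2 eqxx.
have [d0 b0] : d = 0 /\ - b = 0 by apply: eis; lra.
have [c0 a0] : c = 0 /\ - a = 0 by apply: eis; lra.
have [h1 _] : (1 : R) = 0 /\ (0 : R) = 0 by apply: eis; lra.
lra.
Qed.

Lemma indep_sym w1 w2 : indep w1 w2 -> indep w2 w1.
Proof. by move=> h r s e; have [] := h s r; rewrite ?[s%:K * _ + _]addrC. Qed.

(** Cramer's rule: a coordinate times the determinant D of the basis is a determinant formed from z
    and a basis vector, of modulus at most 2 L |z|. *)
Lemma coord_bound w1 w2 : indep w1 w2 -> exists2 c : R, 0 < c &
  forall x y : R, c * `|x| <= nm (x%:K * w1 + y%:K * w2) /\ c * `|y| <= nm (x%:K * w1 + y%:K * w2).
Proof.
move=> /indep_det.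
set D := _ - _ => D0; pose L := nm w1 + nm w2 + 1.
have L1 : 0 < L by rewrite /L; have := nm_ge0 w1; have := nm_ge0 w2; lra.
have Dn : 0 < `|D| by rewrite normr_gt0.
exists (`|D| / (2 * L)); first by rewrite divr_gt0 ?mulr_gt0.
move=> x y; set z := _ + _.
have key u w : nm w <= L -> u * D = complex.Re z * complex.Im w - complex.Im z * complex.Re w \/
   u * D = - (complex.Re z * complex.Im w - complex.Im z * complex.Re w) -> `|D| / (2 * L) * `|u| <= nm z.
  move=> wL e; rewrite mulrAC ler_pdivrMr ?mulr_gt0 // -normrM mulrC.
  have -> : `|u * D| = `|complex.Re z * complex.Im w - complex.Im z * complex.Re w|.
    by case: e => ->; rewrite ?normrN.
  apply: le_trans (ler_normB _ _) _; rewrite !normrM.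
  have -> : nm z * (2 * L) = nm z * L + nm z * L by ring.
  apply: lerD; apply: ler_pM => //; rewrite ?nm_Re ?nm_Im //.
    by apply: le_trans (nm_Im _) wL.
  by apply: le_trans (nm_Re _) wL.
have l1 : nm w1 <= L by rewrite /L; have := nm_ge0 w2; lra.
have l2 : nm w2 <= L by rewrite /L; have := nm_ge0 w1; lra.
split; [apply: (key x w2 l2); left|apply: (key y w1 l1); right];
  rewrite /D /z; case: (w1) => a b; case: (w2) => c d /=; ring.
Qed.

Lemma indep_span w1 w2 : indep w1 w2 -> forall z : CC, exists s t : R, z = s%:K * w1 + t%:K * w2.
Proof.
move=> /indep_det; case: w1 => a b; case: w2 => c d /= D [x y].
exists ((x * d - y * c) / (a * d - b * c)), ((a * y - b * x) / (a * d - b * c)).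
by apply/eqP; rewrite eq_complex /=; apply/andP; split; apply/eqP; field.
Qed.

Lemma lattE w1 w2 (m k : int) : latt w1 w2 m k = (m%:~R : R)%:K * w1 + (k%:~R : R)%:K * w2.
Proof. by rewrite /latt !rmorph_int. Qed.

Lemma lat_bound w1 w2 : indep w1 w2 -> exists2 c : R, 0 < c &
  forall p, c * (height p)%:R <= nm (latp w1 w2 p).
Proof.
move=> /coord_bound [c c0 h]; exists c => // -[m k]; rewrite /latp lattE /height /=.
have [h1 h2] := h m%:~R k%:~R.
have e (i : int) : (`|i|%N)%:R = `|i%:~R| :> R by rewrite -intr_norm natr_absz.
by case: (leqP `|m|%N `|k|%N) => _; rewrite e.
Qed.

Definition sep w1 w2 (chi : pred (int * int)) (a : CC) (d : R) : Prop :=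
  0 < d /\ forall p, chi p -> d * (height p).+1%:R <= nm (a - latp w1 w2 p).

Lemma ht_gt0 p : nzp p -> (0 < height p)%N.
Proof. by case: p => m k; rewrite /nzp /nz /height /=; lia. Qed.

Lemma sep_nz w1 w2 : indep w1 w2 -> exists d, sep w1 w2 nzp 0 d.
Proof.
move=> /lat_bound [c c0 h]; exists (c / 2); split; first by rewrite divr_gt0.
move=> p /ht_gt0 hp; rewrite sub0r nmN; apply: le_trans (h p).
rewrite -mulrA ler_wpM2l ?(ltW c0) // mulrC ler_pdivrMr // -natrM ler_nat; lia.
Qed.

Lemma seq_min (T : eqType) (s : seq T) (g : T -> R) : (forall p, p \in s -> 0 < g p) ->
  exists2 d : R, 0 < d & forall p, p \in s -> d <= g p.
Proof.
elim: s => [|x s ih] h; first by exists 1.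
have [p ps|d d0 hd] := ih; first by apply: h; rewrite inE ps orbT.
exists (Order.min d (g x)); first by rewrite lt_min d0 h // mem_head.
move=> p; rewrite inE => /orP[/eqP ->|/hd hp]; rewrite ge_min; first by rewrite lexx orbT.
by rewrite hp.
Qed.

Lemma sep_off w1 w2 a : indep w1 w2 -> ~ in_latt w1 w2 a -> exists d, sep w1 w2 xpredT a d.
Proof.
move=> hi ha; have [c c0 h] := lat_bound _ _ hi.
(* Beyond height N the growth of the lattice dominates [nm a]; the finitely many indices inside the
   box are handled by a minimum. *)
pose N := (Num.truncn ((2 * nm a + c) / c)).+1.
have hN : 2 * nm a + c <= c * N%:R.
  by rewrite [c * _]mulrC -ler_pdivrMr // /N ltW // truncnS_gt.
have pos p : p \in box N -> 0 < nm (a - latp w1 w2 p).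
  move=> _; rewrite nm_gt0 subr_eq0; apply/eqP => e; apply: ha.
  by exists p.1, p.2.
have [d d0 hd] := seq_min _ _ _ pos.
exists (Order.min (d / N.+1%:R) (c / 2)).
have N0 : (0 : R) < N.+1%:R by rewrite ltr0n.
split; first by rewrite lt_min !divr_gt0.
move=> p _; case: (boolP (p \in box N)) => pb.
  apply: le_trans (hd p pb); apply: (@le_trans _ _ (d / N.+1%:R * N.+1%:R)); last by rewrite divfK // gt_eqF.
  apply: ler_pM => //; first by rewrite le_min !divr_ge0 // ltW.
    by rewrite ge_min lexx.
  by rewrite ler_nat ltnS -mem_box.
rewrite mem_box -ltnNge in pb.
have hp : N%:R + 1 <= (height p)%:R :> R by rewrite -[1]/(1%:R) -natrD ler_nat addn1.
have := nm_ge_sub (latp w1 w2 p) a; rewrite nmBC => h1; apply: le_trans h1.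
have h2 := h p.
apply: (@le_trans _ _ (c / 2 * (height p).+1%:R)).
  by rewrite ler_wpM2r // ge_min lexx orbT.
have -> : ((height p).+1%:R : R) = (height p)%:R + 1 by rewrite -addn1 natrD.
move: ((height p)%:R : R) (N%:R : R) hp hN h2 => x y; nra.
Qed.

Lemma ht1 p : (1 : R) <= (height p).+1%:R.
Proof. by rewrite -[1]/(1%:R) ler_nat. Qed.

Lemma sep_shift w1 w2 chi a d h : sep w1 w2 chi a d -> nm h <= d / 2 -> sep w1 w2 chi (a + h) (d / 2).
Proof.
move=> [d0 hd] hh; split; first by rewrite divr_gt0.
move=> p /hd; have := ht1 p; move: ((height p).+1%:R : R) => x x1 hp.
have -> : a + h - latp w1 w2 p = (a - latp w1 w2 p) + h by ring.
have := nm_ge_add (a - latp w1 w2 p) h; nra.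
Qed.

Lemma sep_neq0 w1 w2 chi a d p : sep w1 w2 chi a d -> chi p -> a - latp w1 w2 p != 0.
Proof.
move=> [d0 hd] /hd hp; rewrite -nm_gt0; apply: lt_le_trans hp.
by rewrite mulr_gt0 // ltr0n.
Qed.

Lemma sep_inv w1 w2 chi a d p k : sep w1 w2 chi a d -> chi p ->
  nm ((a - latp w1 w2 p) ^- k) <= d ^- k * (height p).+1%:R ^- k.
Proof.
move=> [d0 hd] /hd hp; rewrite nmV nmX -invfM -exprMn.
have x0 : 0 < d * (height p).+1%:R by rewrite mulr_gt0 // ltr0n.
rewrite lef_pV2 ?posrE ?exprn_gt0 //; last by apply: lt_le_trans hp.
by rewrite lerXn2r ?nnegrE ?nm_ge0 // ltW.
Qed.

Lemma wt_pow p k : (3 <= k)%N -> (height p).+1%:R ^- k <= wt p.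
Proof.
move=> k3; rewrite /wt lef_pV2 ?posrE ?exprn_gt0 ?ltr0n //.
by rewrite -!natrX ler_nat leq_pexp2l.
Qed.

Lemma taylor_terms (x h : CC) : x != 0 -> nm h <= nm x / 2 ->
  [/\ nm ((x + h) ^- 2 - x ^- 2 + 2 * h * x ^- 3 - 3 * h ^+ 2 * x ^- 4) <= 200 * nm h ^+ 3 * nm x ^- 5,
      nm ((x + h) ^- 3 - x ^- 3 + 3 * h * x ^- 4) <= 200 * nm h ^+ 2 * nm x ^- 5 &
      nm ((x + h) ^- 4 - x ^- 4) <= 200 * nm h * nm x ^- 5].
Proof.
move=> x0 hx; have X0 : 0 < nm x by rewrite nm_gt0.
have H0 := nm_ge0 h.
have h1 := nm_ge_add x h.
have xh : 0 < nm (x + h) by lra.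
have xh0 : x + h != 0 by rewrite -nm_gt0.
have inv k : nm ((x + h) ^- k) <= 2 ^+ k * nm x ^- k.
  rewrite nmV nmX -[2 ^+ k]invrK -invfM lef_pV2 ?posrE ?mulr_gt0 ?invr_gt0 ?exprn_gt0 //.
  rewrite -exprVn -exprMn lerXn2r ?nnegrE ?nm_ge0 ?mulr_ge0 ?invr_ge0 //; lra.
have hx' : nm h <= nm x by lra.
have n2 (n : nat) : nm n%:R = n%:R by exact: nm_nat.
(* Over the common denominator the numerators are at most 7, 11 and 12 times a power of [nm x], and
   the factor (x+h)^-k costs 2^k; this gives 28, 88 and 192, all below 200. *)
have bnd (P : CC) (c : R) k j : nm P <= c * nm x ^+ j -> 0 <= c -> c * 2 ^+ k <= 200 -> k = (j + 1)%N ->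
   nm (P / (x ^+ 4 * (x + h) ^+ k)) <= 200 * nm x ^- 5.
  move=> hP c0 hc kj; rewrite invfM !nmM nmV nmX.
  apply: (@le_trans _ _ (c * nm x ^+ j * (nm x ^- 4 * (2 ^+ k * nm x ^- k)))).
    apply: ler_pM; rewrite ?nm_ge0 ?mulr_ge0 ?nm_ge0 ?invr_ge0 ?exprn_ge0 ?nm_ge0 //.
    by apply: ler_pM; rewrite ?nm_ge0 ?invr_ge0 ?exprn_ge0 ?nm_ge0 ?inv.
  have -> : c * nm x ^+ j * (nm x ^- 4 * (2 ^+ k * nm x ^- k)) = c * 2 ^+ k * nm x ^- 5.
    rewrite kj !exprD expr1; field; rewrite expf_neq0 ?gt_eqF //.
  by rewrite ler_wpM2r // invr_ge0 exprn_ge0 // ltW.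
split.
- have -> : (x + h) ^- 2 - x ^- 2 + 2 * h * x ^- 3 - 3 * h ^+ 2 * x ^- 4 =
    - (h ^+ 3 * ((4 * x + 3 * h) / (x ^+ 4 * (x + h) ^+ 2))) by field; rewrite x0 xh0.
  rewrite nmN nmM nmX -[leRHS]mulrA [leRHS]mulrCA.
  rewrite ler_wpM2l ?exprn_ge0 //; apply: (bnd _ 7 2%N 1%N) => //; try lra.
  apply: le_trans (nmD _ _) _; rewrite !nmM !n2; lra.
- have -> : (x + h) ^- 3 - x ^- 3 + 3 * h * x ^- 4 =
    h ^+ 2 * ((6 * x ^+ 2 + 8 * x * h + 3 * h ^+ 2) / (x ^+ 4 * (x + h) ^+ 3)).
    by field; rewrite x0 xh0.
  rewrite nmM nmX -[leRHS]mulrA [leRHS]mulrCA.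
  rewrite ler_wpM2l ?exprn_ge0 //; apply: (bnd _ 11 3%N 2%N) => //; try lra.
  apply: le_trans (nmD _ _) _; apply: le_trans (lerD (nmD _ _) (lexx _)) _.
  by rewrite !nmM ?nmX !n2; nra.
have -> : (x + h) ^- 4 - x ^- 4 =
    - (h * ((4 * x ^+ 3 + 6 * x ^+ 2 * h + 4 * x * h ^+ 2 + h ^+ 3) / (x ^+ 4 * (x + h) ^+ 4))).
  by field; rewrite x0 xh0.
rewrite nmN nmM -[leRHS]mulrA [leRHS]mulrCA.
rewrite ler_wpM2l //; apply: (bnd _ 12 4%N 3%N) => //; try lra.
apply: le_trans (nmD _ _) _; apply: le_trans (lerD (nmD _ _) (lexx _)) _.
apply: le_trans (lerD (lerD (nmD _ _) (lexx _)) (lexx _)) _.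
rewrite !nmM ?nmX !n2; move: (nm x) (nm h) X0 H0 hx {bnd inv h1 xh hx'} => X H X0 H0 hx.
have e1 : X ^+ 2 * H <= X ^+ 2 * (X / 2) by rewrite ler_wpM2l ?exprn_ge0 ?(ltW X0).
have H2 : H ^+ 2 <= X ^+ 2 / 4.
  have -> : X ^+ 2 / 4 = (X / 2) ^+ 2 by field.
  by rewrite lerXn2r ?nnegrE //; lra.
have e2 : X * H ^+ 2 <= X * (X ^+ 2 / 4) by rewrite ler_wpM2l ?(ltW X0).
have e3 : H ^+ 3 <= X ^+ 3 / 8.
  have -> : X ^+ 3 / 8 = (X / 2) ^+ 3 by field.
  by rewrite lerXn2r ?nnegrE //; lra.
have X3 : 0 < X ^+ 3 by rewrite exprn_gt0.
lra.
Qed.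

Section Sums.
Variables (w1 w2 : CC) (chi : pred (int * int)).
Local Notation om := (latp w1 w2).
Local Notation sepnz := (sep w1 w2 nzp 0).
Local Notation sep := (sep w1 w2 chi).

Definition eis_term (k : nat) (a : CC) (p : int * int) : CC := if chi p then (a - om p) ^- k else 0.
(** The summand of wp. With [chi] equal to [xpredT] the term at the origin is a^-2 without
    correction and the sum is wp itself; with [nzp] it is the regular part wp(z) - z^-2. *)
Definition psum_term (a : CC) (p : int * int) : CC :=
  if chi p then (a - om p) ^- 2 - (if nzp p then om p ^- 2 else 0) else 0.
Definition eis_part k a N := \sum_(p <- box N) eis_term k a p.
Definition psum_part a N := \sum_(p <- box N) psum_term a p.
Definition eis k a := Lim (eis_part k a).
Definition psum a := Lim (psum_part a).

Lemma eis_term_bound k a d p : (3 <= k)%N -> sep a d -> nm (eis_term k a p) <= d ^- k * wt p.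
Proof.
move=> k3 s; have d0 : 0 < d by case: s.
have dk : 0 <= d ^- k by rewrite invr_ge0 exprn_ge0 // ltW.
rewrite /eis_term; case: ifP => [hp|_]; last by rewrite nm0 mulr_ge0 // ltW // wt_gt0.
apply: le_trans (sep_inv _ _ _ _ _ _ k s hp) _.
by rewrite ler_wpM2l // wt_pow.
Qed.

Lemma eis_tends k a d : (3 <= k)%N -> sep a d -> tends (eis_part k a) (eis k a).
Proof.
move=> k3 s; apply: Lim_tends.
have [|l hl _] := boxsum_tends (eis_term k a) (d ^- k) _ (fun p => eis_term_bound _ _ _ p k3 s); last by exists l.
by rewrite invr_ge0 exprn_ge0 // ltW //; case: s.
Qed.

(** Cubic decay comes from (a - w)^-2 - w^-2 = (a - w)^-2 a (2w - a) / w^2. The constant depends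
    only on the bound for a and on the separation, hence is uniform. *)
Lemma psum_term_bound d0 rho d : sepnz d0 -> 0 < d -> 0 <= rho -> exists2 K : R, 0 <= K &
  forall a p, nm a <= rho -> sep a d -> nm (psum_term a p) <= K * wt p.
Proof.
move=> [c0 hc] dp r0; pose K := (rho * (2 / d0 + rho / d0 ^+ 2) + 1) / d ^+ 2.
have rr : 0 <= rho * (2 / d0 + rho / d0 ^+ 2).
  by rewrite mulr_ge0 // addr_ge0 ?divr_ge0 ?exprn_ge0 // ltW.
have K0 : 0 <= K by rewrite divr_ge0 ?exprn_ge0 ?(ltW dp) // addr_ge0.
exists K => // a p ar s; rewrite /psum_term; case: ifP => [hp|_]; last by rewrite nm0 mulr_ge0 // ltW // wt_gt0.
have i2 := sep_inv _ _ _ _ _ _ 2 s hp.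
case: ifP => np; last first.
  have h0 : height p = 0%N by move/negbT: np; case: (p) => m k; rewrite /nzp /nz /height /=; lia.
  rewrite subr0; apply: le_trans i2 _; rewrite /wt h0 !expr1n !invr1 !mulr1 /K.
  by rewrite ler_pdivlMr ?exprn_gt0 // mulVf ?expf_neq0 ?gt_eqF // lerDr.
have := hc p np; rewrite sub0r nmN => ho.
set x := (height p).+1%:R in i2 ho; have x1 : 1 <= x by exact: ht1.
have x0 : 0 < x by lra.
have o0 : 0 < nm (om p) by apply: lt_le_trans ho; rewrite mulr_gt0.
have on : om p != 0 by rewrite -nm_gt0.
have an := sep_neq0 _ _ _ _ _ p s hp.
have -> : (a - om p) ^- 2 - om p ^- 2 = (a - om p) ^- 2 * (a * ((2 * om p - a) / om p ^+ 2)).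
  by field; rewrite on an.
rewrite nmM.
have b1 : nm (a * ((2 * om p - a) / om p ^+ 2)) <= rho * (2 / d0 + rho / d0 ^+ 2) / x.
  rewrite nmM -[X in _ <= X]mulrA; apply: ler_pM; rewrite ?nm_ge0 //.
  have -> : (2 * om p - a) / om p ^+ 2 = 2 / om p - a / om p ^+ 2 by field.
  apply: le_trans (nmB _ _) _; rewrite [X in _ <= X]mulrDl !nmM !nmV nmX nm_nat.
  have v1 : (nm (om p))^-1 <= d0^-1 / x by rewrite -invfM lef_pV2 ?posrE // mulr_gt0.
  apply: lerD; first by rewrite -mulrA ler_wpM2l.
  rewrite -mulrA; apply: ler_pM; rewrite ?nm_ge0 ?invr_ge0 ?exprn_ge0 ?nm_ge0 //.
  rewrite -!exprVn; apply: (@le_trans _ _ ((d0^-1 / x) ^+ 2)).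
    by rewrite lerXn2r ?nnegrE ?invr_ge0 ?nm_ge0 ?divr_ge0 ?invr_ge0 // ltW.
  rewrite exprMn ler_wpM2l ?exprn_ge0 ?invr_ge0 ?(ltW c0) //.
  by rewrite expr2 ler_piMr ?invr_ge0 ?(ltW x0) // invf_le1.
apply: le_trans (ler_pM (nm_ge0 _) (nm_ge0 _) i2 b1) _.
have -> : d ^- 2 * x ^- 2 * (rho * (2 / d0 + rho / d0 ^+ 2) / x) =
  (rho * (2 / d0 + rho / d0 ^+ 2)) / d ^+ 2 * wt p.
  rewrite /wt -/x; field; rewrite ?gt_eqF //.
rewrite ler_wpM2r ?(ltW (wt_gt0 _)) // /K ler_wpM2r ?invr_ge0 ?exprn_ge0 ?(ltW dp) // lerDl //.
Qed.

Lemma psum_unif rho d : indep w1 w2 -> 0 < d -> 0 <= rho -> exists2 K : R, 0 <= K &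
  forall a, nm a <= rho -> sep a d ->
   tends (psum_part a) (psum a) /\ forall N, nm (psum_part a N - psum a) <= 8 * K / N.+1%:R.
Proof.
move=> hi d0 r0; have [d1 s1] := sep_nz _ _ hi.
have [K K0 hK] := psum_term_bound _ _ _ s1 d0 r0.
exists K => // a ar s.
have [l hl [_ hl2]] := boxsum_tends (psum_term a) K K0 (fun p => hK a p ar s).
have tQ : tends (psum_part a) (psum a) by apply: Lim_tends; exists l.
by split => // N; rewrite -(tends_uniq _ _ _ hl tQ); exact: hl2.
Qed.

Lemma psum_tends a d : indep w1 w2 -> sep a d -> tends (psum_part a) (psum a).
Proof.
move=> hi s; have d0 : 0 < d by case: s.
by have [K K0 hK] := psum_unif _ _ hi d0 (nm_ge0 a); have [] := hK a (lexx _) s.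
Qed.

(** Termwise expansion, which replaces differentiation of the series: -2 [eis 3] and 6 [eis 4] act
    as first and second derivative of [psum]. *)
Lemma taylor a d : indep w1 w2 -> sep a d -> exists2 K : R, 0 < K & forall h, nm h <= d / 2 ->
  [/\ nm (psum (a + h) - psum a + 2 * h * eis 3 a - 3 * h ^+ 2 * eis 4 a) <= K * nm h ^+ 3,
      nm (eis 3 (a + h) - eis 3 a + 3 * h * eis 4 a) <= K * nm h ^+ 2 &
      nm (eis 4 (a + h) - eis 4 a) <= K * nm h].
Proof.
move=> hi s; have d0 : 0 < d by case: s.
exists (9 * (200 * d ^- 5)); first by rewrite !mulr_gt0 ?ltr0n // invr_gt0 exprn_gt0.
move=> h hd; have s' := sep_shift _ _ _ _ _ _ s hd.
have H0 := nm_ge0 h.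
have T p : chi p -> nm h <= nm (a - om p) / 2.
  move=> hp; case: (s) => _ /(_ p hp); have := ht1 p; nra.
have x5 p : chi p -> nm (a - om p) ^- 5 <= d ^- 5 * wt p.
  move=> hp; have := eis_term_bound 5 _ _ p isT s; rewrite /eis_term hp.
  by rewrite nmV nmX.
have tQ := psum_tends _ _ hi s; have tQ' := psum_tends _ _ hi s'.
have tE k (k3 : (3 <= k)%N) := eis_tends k _ _ k3 s; have tE' k (k3 : (3 <= k)%N) := eis_tends k _ _ k3 s'.
have gen (F : int * int -> CC) l (c : R) : 0 <= c -> tends (fun N => \sum_(p <- box N) F p) l ->
   (forall p, chi p -> nm (F p) <= 200 * c * nm (a - om p) ^- 5) -> (forall p, ~~ chi p -> F p = 0) ->
   nm l <= 9 * (200 * d ^- 5) * c.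
  move=> c0 tF b1 b0.
  have W p : nm (F p) <= 200 * c * d ^- 5 * wt p.
    have [hp|hp] := boolP (chi p).
      apply: le_trans (b1 p hp) _; rewrite -[leRHS]mulrA ler_wpM2l ?mulr_ge0 //.
      exact: x5.
    by rewrite b0 // nm0 !mulr_ge0 ?invr_ge0 ?exprn_ge0 ?(ltW d0) // ltW // wt_gt0.
  have C0 : 0 <= 200 * c * d ^- 5 by rewrite !mulr_ge0 ?invr_ge0 ?exprn_ge0 ?(ltW d0).
  have [l' tl' [hl' _]] := boxsum_tends F _ C0 W.
  rewrite (tends_uniq _ _ _ tF tl'); apply: le_trans hl' _.
  by rewrite le_eqVlt; apply/orP; left; apply/eqP; ring.
have shift p : a + h - om p = (a - om p) + h by ring.
split.
- apply: (gen (fun p => psum_term (a + h) p - psum_term a p + 2 * h * eis_term 3 a p - 3 * h ^+ 2 * eis_term 4 a p)).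
  + by rewrite exprn_ge0.
  + apply: tends_ext (tendsB _ _ _ _ (tendsD _ _ _ _ (tendsB _ _ _ _ tQ' tQ) (tendsZ (2 * h) _ _ (tE 3 isT)))
      (tendsZ (3 * h ^+ 2) _ _ (tE 4 isT))) => N.
    by rewrite /psum_part /eis_part !mulr_sumr -!sumrN -!big_split.
  + move=> p hp; rewrite /psum_term /eis_term hp shift.
    have [b _ _] := taylor_terms _ _ (sep_neq0 _ _ _ _ _ _ s hp) (T p hp).
    by move: b; set o := if _ then _ else _; rewrite opprB addrA subrK.
  + by move=> p /negPf hp; rewrite /psum_term /eis_term hp !mulr0 !subr0 addr0.
- apply: (gen (fun p => eis_term 3 (a + h) p - eis_term 3 a p + 3 * h * eis_term 4 a p)).
  + by rewrite exprn_ge0.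
  + apply: tends_ext (tendsD _ _ _ _ (tendsB _ _ _ _ (tE' 3 isT) (tE 3 isT)) (tendsZ (3 * h) _ _ (tE 4 isT))) => N.
    by rewrite /eis_part !mulr_sumr -!sumrN -!big_split.
  + move=> p hp; rewrite /eis_term hp shift.
    by have [_ b _] := taylor_terms _ _ (sep_neq0 _ _ _ _ _ _ s hp) (T p hp).
  + by move=> p /negPf hp; rewrite /eis_term hp !mulr0 subr0 addr0.
- apply: (gen (fun p => eis_term 4 (a + h) p - eis_term 4 a p)) => //.
  + apply: tends_ext (tendsB _ _ _ _ (tE' 4 isT) (tE 4 isT)) => N.
    by rewrite /eis_part -!sumrN -!big_split.
  + move=> p hp; rewrite /eis_term hp shift.
    by have [_ _ b] := taylor_terms _ _ (sep_neq0 _ _ _ _ _ _ s hp) (T p hp).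
  + by move=> p /negPf hp; rewrite /eis_term hp subr0.
Qed.

(** The partial sums are finite sums of inverses, each with its pole at distance at least d from a,
    and they converge uniformly on the disc of radius d/2. *)
Lemma psum_hol a d : indep w1 w2 -> sep a d -> hol psum a.
Proof.
move=> hi s; have d0 : 0 < d by case: s.
have d2 : 0 < d / 2 by rewrite divr_gt0.
exists (d / 2) => //; apply: happ_lim => e e0.
have [|K K0 hK] := psum_unif (nm a + d / 2) _ hi d2; first by have := nm_ge0 a; lra.
have [N hN] := nat_eps (8 * K) e e0.
exists (psum_part ^~ N).
  apply: (happ_sum _ _ _ (fun p z => psum_term z p)) => p; rewrite /psum_term; case hp: (chi p); last exact: happC.
  apply: happB; [exact: ltW| |exact: happC].
  have -> : (fun z => (z - om p) ^- 2) = (fun z => (z - om p)^-1 ^+ 2) by apply/funext => z; rewrite exprVn.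
  apply: happX; first exact: ltW.
  apply: happ_inv; [exact: ltW| | exact: sep_neq0 s hp|].
    by apply: happB; [exact: ltW|exact: happ_id|exact: happC].
  move=> h hd; have -> : a + h - om p - (a - om p) = h by ring.
  case: (s) => _ /(_ p hp); have := ht1 p; nra.
move=> h hd; have [|_ h2] := hK (a + h) _ (sep_shift _ _ _ _ _ _ s hd).
  by have := nmD a h; lra.
by rewrite nmBC; apply: le_trans (h2 N) _; apply: hN.
Qed.
End Sums.

(** * Symmetries and periods of the Weierstrass functions *)

Lemma big_box0 (T : Type) (idx : T) (op : Monoid.com_law idx) N (F : int * int -> T) :
  \big[op/idx]_(p <- box N) F p = op (F (0, 0)) (\big[op/idx]_(p <- box N | nzp p) F p).
Proof.
rewrite (bigD1_seq (0, 0)) ?box_uniq ?mem_box //=; congr (op _ _).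
by apply: eq_bigl => -[m k]; rewrite /nzp /nz /= xpair_eqE negb_and.
Qed.

Lemma latp0 w1 w2 : latp w1 w2 (0, 0) = 0.
Proof. by rewrite /latp /latt /= !mul0r addr0. Qed.
Lemma latpN w1 w2 p : latp w1 w2 (- p.1, - p.2) = - latp w1 w2 p.
Proof. by rewrite /latp /latt /= !rmorphN; ring. Qed.
Lemma nzpN p : nzp (- p.1, - p.2) = nzp p.
Proof. by rewrite /nzp /nz /= !oppr_eq0. Qed.
Lemma latp_swap w1 w2 p : latp w1 w2 (p.2, p.1) = latp w2 w1 p.
Proof. by rewrite /latp /latt /= addrC. Qed.
Lemma nzp_swap p : nzp (p.2, p.1) = nzp p.
Proof. by rewrite /nzp /nz /= orbC. Qed.
Lemma latp_shift w1 w2 p : latp w1 w2 (p.1 - 1, p.2) = latp w1 w2 p - w1.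
Proof. by rewrite /latp /latt /= rmorphB /=; ring. Qed.

Lemma big_box_opp (T : Type) (idx : T) (op : Monoid.com_law idx) N (F : int * int -> T) :
  \big[op/idx]_(p <- box N) F (- p.1, - p.2) = \big[op/idx]_(p <- box N) F p.
Proof. by rewrite -[RHS](perm_big _ (box_opp N)) big_map. Qed.

Lemma big_box_swap (T : Type) (idx : T) (op : Monoid.com_law idx) N (F : int * int -> T) :
  \big[op/idx]_(p <- box N) F (p.2, p.1) = \big[op/idx]_(p <- box N) F p.
Proof. by rewrite -[RHS](perm_big _ (box_swap N)) big_map. Qed.

Lemma big_box_shift (T : Type) (idx : T) (op : Monoid.com_law idx) N (F : int * int -> T) :
  op (\big[op/idx]_(p <- box N) F (p.1 - 1, p.2)) (\big[op/idx]_(p <- col N N) F p) =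
  op (\big[op/idx]_(p <- box N) F p) (\big[op/idx]_(p <- col (- N.+1%:Z) N) F p).
Proof. by rewrite -[RHS]big_cat -(perm_big _ (box_shift N)) big_cat big_map. Qed.

Lemma in_lattN w1 w2 z : in_latt w1 w2 (- z) <-> in_latt w1 w2 z.
Proof.
have H y : in_latt w1 w2 y -> in_latt w1 w2 (- y).
  by move=> [m [k ->]]; exists (- m), (- k); rewrite /latt !rmorphN; ring.
by split => [/H|/H //]; rewrite opprK.
Qed.
Lemma in_lattD w1 w2 y z : in_latt w1 w2 y -> in_latt w1 w2 z -> in_latt w1 w2 (y + z).
Proof.
move=> [m [k ->]] [m' [k' ->]]; exists (m + m'), (k + k').
by rewrite /latt !rmorphD /=; ring.
Qed.
Lemma in_lattB w1 w2 y z : in_latt w1 w2 y -> in_latt w1 w2 z -> in_latt w1 w2 (y - z).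
Proof. by move=> hy /in_lattN; apply: in_lattD. Qed.
Lemma in_latt1 w1 w2 : in_latt w1 w2 w1.
Proof. by exists 1, 0; rewrite /latt mul1r mul0r addr0. Qed.
Lemma in_latt2 w1 w2 : in_latt w1 w2 w2.
Proof. by exists 0, 1; rewrite /latt mul1r mul0r add0r. Qed.
Lemma in_latt0 w1 w2 : in_latt w1 w2 0.
Proof. by exists 0, 0; rewrite /latt !mul0r addr0. Qed.
Lemma in_latt_swap w1 w2 z : in_latt w2 w1 z <-> in_latt w1 w2 z.
Proof. by split=> -[m [k ->]]; exists k, m; rewrite /latt addrC. Qed.
Lemma notin_lattD w1 w2 y z : ~ in_latt w1 w2 y -> in_latt w1 w2 z -> ~ in_latt w1 w2 (y + z).
Proof. by move=> hy hz h; apply: hy; rewrite -(addrK z y); exact: in_lattB. Qed.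

Lemma sep_sub w1 w2 (c1 c2 : pred (int * int)) a d : (forall p, c2 p -> c1 p) ->
  sep w1 w2 c1 a d -> sep w1 w2 c2 a d.
Proof. by move=> h [d0 hd]; split => // p /h; exact: hd. Qed.

Lemma sepT_off w1 w2 a d : sep w1 w2 xpredT a d -> ~ in_latt w1 w2 a.
Proof.
move=> s [m [k e]]; have := sep_neq0 _ _ _ _ _ (m, k) s isT.
by rewrite /latp /= e subrr eqxx.
Qed.

(* The square boxes are not translation invariant; periodicity needs that the boundary terms are negligible. *)
Lemma col_bound w1 w2 a d (K : R) c N (G : int * int -> R) : sep w1 w2 xpredT a d -> 0 <= K ->
  (N <= `|c|)%N ->
  (forall p, G p <= K * nm ((a - latp w1 w2 p) ^- 2)) ->
  \sum_(p <- col c N) G p <= 2 * K * d ^- 2 / N.+1%:R.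
Proof.
move=> s K0 cN hG; have d0 : 0 < d by case: s.
have N0 : (0 : R) < N.+1%:R by rewrite ltr0n.
apply: (@le_trans _ _ (\sum_(p <- col c N) K * (d ^- 2 * N.+1%:R ^- 2))).
  rewrite big_seq [leRHS]big_seq; apply: ler_sum => p; rewrite mem_col => /andP[/eqP p1 p2].
  apply: le_trans (hG p) _; rewrite ler_wpM2l //.
  apply: le_trans (sep_inv _ _ _ _ _ p 2 s isT) _.
  rewrite ler_wpM2l ?invr_ge0 ?exprn_ge0 ?(ltW d0) // lef_pV2 ?posrE ?exprn_gt0 ?ltr0n //.
  rewrite lerXn2r ?nnegrE ?ler0n // ler_nat ltnS /height p1; apply: leq_trans cN _; exact: leq_maxl.
rewrite big_const_seq count_predT size_col iter_addr_0 -[leLHS]mulr_natl.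
have -> : 2 * K * d ^- 2 / N.+1%:R = (2 * N.+1%:R) * (K * (d ^- 2 * N.+1%:R ^- 2)).
  by field; rewrite ?gt_eqF.
rewrite ler_wpM2r ?mulr_ge0 ?invr_ge0 ?exprn_ge0 ?(ltW d0) ?(ltW N0) //.
by rewrite -natrM ler_nat; lia.
Qed.

Lemma tends_small (u : nat -> CC) (K : R) : (forall N, nm (u N) <= K / N.+1%:R) -> tends u 0.
Proof.
move=> h e e0; have [N hN] := nat_eps K e e0; exists N => n /hN hn.
by rewrite subr0; apply: le_trans hn.
Qed.

Lemma col_sum_small w1 w2 a d k (c : nat -> int) : sep w1 w2 xpredT a d -> (2 <= k)%N ->
  (forall N, N <= `|c N|)%N -> tends (fun N => \sum_(p <- col (c N) N) (a - latp w1 w2 p) ^- k) 0.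
Proof.
move=> s k2 hc; have d0 : 0 < d by case: s.
apply: (@tends_small _ (2 * d ^- (k - 2) * d ^- 2)) => N.
apply: le_trans (nm_sum _ _ _ _) _.
apply: (col_bound _ _ _ _ _ _ _ _ s) => //; first by rewrite invr_ge0 exprn_ge0 // ltW.
move=> p.
have -> : (a - latp w1 w2 p) ^- k = (a - latp w1 w2 p) ^- (k - 2) * (a - latp w1 w2 p) ^- 2.
  by rewrite -invfM -exprD subnK.
rewrite nmM ler_wpM2r ?nm_ge0 //.
apply: le_trans (sep_inv _ _ _ _ _ p (k - 2) s isT) _.
rewrite ler_piMr ?invr_ge0 ?exprn_ge0 ?(ltW d0) // invf_le1 ?exprn_gt0 ?ltr0n //.
by rewrite exprn_ege1 // ht1.
Qed.

Section Functions.
Variables (w1 w2 : CC).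
Hypothesis hi : indep w1 w2.
Local Notation om := (latp w1 w2).
Local Notation QT := (psum w1 w2 xpredT).
Local Notation QZ := (psum w1 w2 nzp).
Local Notation ET := (eis w1 w2 xpredT).
Local Notation EZ := (eis w1 w2 nzp).
Local Notation sep := (sep w1 w2).

Lemma wpQZ z : wp w1 w2 z = z ^- 2 + QZ z.
Proof.
rewrite /wp; set f := (fun N => _); rewrite (_ : f = psum_part w1 w2 nzp z) //; apply/funext => N; rewrite /f sq_sumE.
by apply: eq_bigr => p _; rewrite /psum_term /nzp /latp; case: ifP.
Qed.

Lemma psum_part_split z N : psum_part w1 w2 xpredT z N = z ^- 2 + psum_part w1 w2 nzp z N.
Proof.
rewrite /psum_part !big_box0.
have -> : psum_term w1 w2 xpredT z (0, 0) = z ^- 2 by rewrite /psum_term /= latp0 !subr0.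
have -> : psum_term w1 w2 nzp z (0, 0) = 0 by [].
rewrite /= add0r; congr (_ + _).
rewrite big_mkcond [RHS]big_mkcond; apply: eq_bigr => p _.
by case: ifP => // h; rewrite /psum_term h.
Qed.

Lemma eis_part_split k z N : eis_part w1 w2 xpredT k z N = z ^- k + eis_part w1 w2 nzp k z N.
Proof.
rewrite /eis_part !big_box0.
have -> : eis_term w1 w2 xpredT k z (0, 0) = z ^- k by rewrite /eis_term /= latp0 !subr0.
have -> : eis_term w1 w2 nzp k z (0, 0) = 0 by [].
rewrite /= add0r; congr (_ + _).
rewrite big_mkcond [RHS]big_mkcond; apply: eq_bigr => p _.
by case: ifP => // h; rewrite /eis_term h.
Qed.

Lemma wpQT z d : sep xpredT z d -> wp w1 w2 z = QT z.
Proof.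
move=> s; have sz : sep nzp z d by apply: sep_sub s.
rewrite wpQZ; apply: tends_uniq (psum_tends _ _ _ _ _ hi s).
apply: tends_ext (tendsD _ _ _ _ (tends_cst (z ^- 2)) (psum_tends _ _ _ _ _ hi sz)) => N.
by rewrite psum_part_split.
Qed.

Lemma ET_EZ k z d : (3 <= k)%N -> sep xpredT z d -> ET k z = z ^- k + EZ k z.
Proof.
move=> k3 s; have sz : sep nzp z d by apply: sep_sub s.
apply: tends_uniq (eis_tends _ _ _ _ _ _ k3 s) _.
apply: tends_ext (tendsD _ _ _ _ (tends_cst (z ^- k)) (eis_tends _ _ _ _ _ _ k3 sz)) => N.
by rewrite eis_part_split.
Qed.

Lemma wp'E z : wp' w1 w2 z = - 2 * ET 3 z.
Proof.
rewrite /wp'; set f := (fun N => _); rewrite (_ : f = eis_part w1 w2 xpredT 3 z) //; apply/funext => N; rewrite /f sq_sumE.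
by apply: eq_bigr => p _.
Qed.

Lemma g2LE : g2L w1 w2 = 60 * EZ 4 0.
Proof.
rewrite /g2L; set f := (fun N => _); rewrite (_ : f = eis_part w1 w2 nzp 4 0) //; apply/funext => N; rewrite /f sq_sumE.
apply: eq_bigr => p _; rewrite /eis_term /nzp /latp; case: ifP => // _.
by rewrite sub0r -[in RHS]exprVn invrN exprNn -signr_odd /= mul1r exprVn.
Qed.

Lemma psum0 : QZ 0 = 0.
Proof.
have [d s] := sep_nz _ _ hi; apply: tends_uniq (psum_tends _ _ _ _ _ hi s) _.
apply: tends_ext (tends_cst 0) => N; rewrite /psum_part big1 // => p _; rewrite /psum_term; case: (nzp p) => //.
by rewrite sub0r sqrrN subrr.
Qed.

Lemma EZ30 : EZ 3 0 = 0.
Proof.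
have [d s] := sep_nz _ _ hi; apply: tends_uniq (eis_tends _ _ _ 3 _ _ isT s) _.
apply: tends_ext (tends_cst 0) => N.
have e : eis_part w1 w2 nzp 3 0 N = - eis_part w1 w2 nzp 3 0 N.
  rewrite {1}/eis_part -big_box_opp /eis_part -sumrN; apply: eq_bigr => p _; rewrite /eis_term nzpN latpN.
  case: ifP => _; last by rewrite oppr0.
  by rewrite !sub0r opprK -[in RHS]exprVn invrN exprNn -signr_odd /= mulN1r opprK exprVn.
apply/esym/eqP; rewrite -(mulrI_eq0 _ (lregP (_ : (2 : CC) != 0))) ?pnatr_eq0 //.
by rewrite mulr_natl mulr2n {1}e addNr.
Qed.

Lemma sepN z d : sep xpredT z d -> sep xpredT (- z) d.
Proof.
move=> [d0 hd]; split => // p _; have := hd (- p.1, - p.2) isT.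
by rewrite latpN opprK -nmN opprD /height /= !abszN.
Qed.

Lemma wp_even z : ~ in_latt w1 w2 z -> wp w1 w2 (- z) = wp w1 w2 z.
Proof.
move=> /(sep_off _ _ _ hi)[d s]; rewrite (wpQT _ _ s) (wpQT _ _ (sepN _ _ s)).
apply: tends_uniq (psum_tends _ _ _ _ _ hi (sepN _ _ s)) _.
apply: tends_ext (psum_tends _ _ _ _ _ hi s) => N.
rewrite /psum_part -[RHS]big_box_opp; apply: eq_bigr => p _; rewrite /psum_term nzpN latpN /=.
have -> : - z - - om p = - (z - om p) by ring.
by rewrite !sqrrN.

Qed.

Lemma wp'_odd z : ~ in_latt w1 w2 z -> wp' w1 w2 (- z) = - wp' w1 w2 z.
Proof.
move=> /(sep_off _ _ _ hi)[d s]; rewrite !wp'E -mulrN; congr (_ * _).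
apply: tends_uniq (eis_tends _ _ _ 3 _ _ isT (sepN _ _ s)) _.
apply: tends_ext (tendsN _ _ (eis_tends _ _ _ 3 _ _ isT s)) => N.
rewrite /eis_part -[RHS]big_box_opp -sumrN; apply: eq_bigr => p _; rewrite /eis_term latpN /=.
have -> : - z - - om p = - (z - om p) by ring.
by rewrite -[in RHS]exprVn invrN exprNn -signr_odd /= mulN1r exprVn.
Qed.

Lemma wp_per1 z : ~ in_latt w1 w2 z -> wp w1 w2 (z + w1) = wp w1 w2 z.
Proof.
move=> hz; have [d s] := sep_off _ _ _ hi hz.
have [d' s'] := sep_off _ _ _ hi (notin_lattD _ _ _ _ hz (in_latt1 w1 w2)).
rewrite (wpQT _ _ s) (wpQT _ _ s').
apply: tends_uniq (psum_tends _ _ _ _ _ hi s') _.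
(* The lost and the gained boundary column both contribute nothing in the limit. *)
have c1 := col_sum_small _ _ _ _ 2 (fun N => N%:Z) s isT (fun N => leqnn N).
have c2 := col_sum_small _ _ _ _ 2 (fun N => - N.+1%:Z) s isT (fun N => ltac:(rewrite abszN; exact: leqnSn)).
rewrite -[QT z]addr0 -(subr0 0).
apply: tends_ext (tendsD _ _ _ _ (psum_tends _ _ _ _ _ hi s) (tendsB _ _ _ _ c2 c1)) => N.
have := big_box_shift _ _ _ N (fun p => (z - om p) ^- 2) => /= e.
have e' : \sum_(p <- box N) (z - om (p.1 - 1, p.2)) ^- 2 = \sum_(p <- box N) (z - om p) ^- 2 +
  (\sum_(p <- col (- N.+1%:Z) N) (z - om p) ^- 2 - \sum_(p <- col N N) (z - om p) ^- 2).
  by rewrite addrA -e addrK.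
have QE y : psum_part w1 w2 xpredT y N = \sum_(p <- box N) (y - om p) ^- 2 - \sum_(p <- box N) (if nzp p then om p ^- 2 else 0).
  by rewrite /psum_part -sumrB.
rewrite !QE addrAC -e'; congr (_ - _); apply: eq_bigr => p _.
by rewrite latp_shift; congr (_ ^- 2); ring.
Qed.

Lemma wp'_per1 z : ~ in_latt w1 w2 z -> wp' w1 w2 (z + w1) = wp' w1 w2 z.
Proof.
move=> hz; have [d s] := sep_off _ _ _ hi hz.
have [d' s'] := sep_off _ _ _ hi (notin_lattD _ _ _ _ hz (in_latt1 w1 w2)).
rewrite !wp'E; congr (_ * _).
apply: tends_uniq (eis_tends _ _ _ 3 _ _ isT s') _.
have c1 := col_sum_small _ _ _ _ 3 (fun N => N%:Z) s isT (fun N => leqnn N).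
have c2 := col_sum_small _ _ _ _ 3 (fun N => - N.+1%:Z) s isT (fun N => ltac:(rewrite abszN; exact: leqnSn)).
rewrite -[ET 3 z]addr0 -(subr0 0).
apply: tends_ext (tendsD _ _ _ _ (eis_tends _ _ _ 3 _ _ isT s) (tendsB _ _ _ _ c2 c1)) => N.
have := big_box_shift _ _ _ N (fun p => (z - om p) ^- 3) => /= e.
have e' : \sum_(p <- box N) (z - om (p.1 - 1, p.2)) ^- 3 = \sum_(p <- box N) (z - om p) ^- 3 +
  (\sum_(p <- col (- N.+1%:Z) N) (z - om p) ^- 3 - \sum_(p <- col N N) (z - om p) ^- 3).
  by rewrite addrA -e addrK.
rewrite /eis_part /eis_term /= -e'; apply: eq_bigr => p _.
by rewrite latp_shift; congr (_ ^- 3); ring.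
Qed.
End Functions.

Lemma wp_swap w1 w2 z : wp w2 w1 z = wp w1 w2 z.
Proof.
rewrite !wpQZ; congr (_ + _); rewrite /psum; congr Lim; apply/funext => N.
rewrite /psum_part -big_box_swap; apply: eq_bigr => p _.
by rewrite /psum_term nzp_swap latp_swap.
Qed.

Lemma wp'_swap w1 w2 z : wp' w2 w1 z = wp' w1 w2 z.
Proof.
rewrite !wp'E; congr (_ * _); rewrite /eis; congr Lim; apply/funext => N.
rewrite /eis_part -big_box_swap; apply: eq_bigr => p _.
by rewrite /eis_term latp_swap.
Qed.

(** From the two generators to the whole lattice. Periodicity is known only off the lattice, so the
    induction also carries along that the translated point stays off it. *)
Lemma per_latt (T : Type) (f : CC -> T) w1 w2 :
  (forall z, ~ in_latt w1 w2 z -> f (z + w1) = f z) -> (forall z, ~ in_latt w1 w2 z -> f (z + w2) = f z) ->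
  forall z w, ~ in_latt w1 w2 z -> in_latt w1 w2 w -> f (z + w) = f z.
Proof.
move=> p1 p2 z w hz [m [k ->]].
have H u : in_latt w1 w2 u -> (forall z, ~ in_latt w1 w2 z -> f (z + u) = f z) ->
   forall (i : int) z, ~ in_latt w1 w2 z -> f (z + i%:~R * u) = f z /\ ~ in_latt w1 w2 (z + i%:~R * u).
  move=> hu pu; have nat_case (n : nat) y : ~ in_latt w1 w2 y -> f (y + n%:R * u) = f y /\ ~ in_latt w1 w2 (y + n%:R * u).
    move=> hy; elim: n => [|n [ih1 ih2]]; first by rewrite mul0r addr0.
    by rewrite -addn1 natrD mulrDl mul1r addrA pu //; split => //; exact: notin_lattD.
  case=> n y hy; first exact: nat_case.
  have hn : ~ in_latt w1 w2 (y - n.+1%:R * u).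
    have hl : in_latt w1 w2 (n.+1%:R * u).
      by elim: (n.+1) => [|j ih]; [rewrite mul0r; exact: in_latt0|rewrite -addn1 natrD mulrDl mul1r; exact: in_lattD].
    by apply: notin_lattD => //; apply/in_lattN.
  rewrite NegzE rmorphN mulNr; split => //.
  by have [<- _] := nat_case n.+1 _ hn; rewrite subrK.
have [e1 h1] := H _ (in_latt1 w1 w2) p1 m _ hz.
have [e2 _] := H _ (in_latt2 w1 w2) p2 k _ h1.
by rewrite /latt addrA e2.
Qed.

Lemma wp_per w1 w2 z w : indep w1 w2 -> ~ in_latt w1 w2 z -> in_latt w1 w2 w -> wp w1 w2 (z + w) = wp w1 w2 z.
Proof.
move=> hi; apply: per_latt => y hy; first exact: wp_per1.
by rewrite -!(wp_swap w1 w2) wp_per1 //; [exact: indep_sym|move/in_latt_swap].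
Qed.

Lemma wp'_per w1 w2 z w : indep w1 w2 -> ~ in_latt w1 w2 z -> in_latt w1 w2 w -> wp' w1 w2 (z + w) = wp' w1 w2 z.
Proof.
move=> hi; apply: per_latt => y hy; first exact: wp'_per1.
by rewrite -!(wp'_swap w1 w2) wp'_per1 //; [exact: indep_sym|move/in_latt_swap].
Qed.

(** * Taylor expansion of the exponential *)

Lemma small_zero (c : CC) (r K : R) : 0 < r -> (forall h, h != 0 -> nm h <= r -> nm c <= K * nm h) -> c = 0.
Proof.
move=> r0 H; apply: nm_small => e e0.
pose d : R := Order.min r (e / (`|K| + 1)).
have k0 : 0 < `|K| + 1 by rewrite ltr_wpDl.
have d0 : 0 < d by rewrite lt_min r0 divr_gt0.
have nd : nm d%:K = d by rewrite nm_real gtr0_norm.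
apply: le_trans (H d%:K _ _) _; first by rewrite -nm_gt0 nd.
  by rewrite nd ge_min lexx.
rewrite nd; apply: (@le_trans _ _ ((`|K| + 1) * d)).
  by rewrite ler_wpM2r ?(ltW d0) //; have := ler_norm K; lra.
rewrite mulrC -ler_pdivlMr // /d ge_min; apply/orP; right; exact: lexx.
Qed.

Lemma cexp_hol a : hol cexp a.
Proof. by exists 1 => //; apply: (happ_cexp _ id) => //; exact: happ_id. Qed.

Lemma hol_bound f a : hol f a -> exists K r : R, [/\ 0 < K, 0 < r & forall h, nm h <= r -> nm (f (a + h)) <= K].
Proof. by move=> [r r0 h]; have [K K0 hK] := happ_bound _ _ _ (ltW r0) h; exists K, r. Qed.

(** Three successive divisions by h; the last quotient is bounded near a and supplies the
    remainder. *)
Lemma hol_taylor f a : hol f a -> exists c1 c2 : CC, exists K r : R, [/\ 0 < K, 0 < r &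
  forall h, nm h <= r -> nm (f (a + h) - (f a + c1 * h + c2 * h ^+ 2)) <= K * nm h ^+ 3].
Proof.
have step f' : hol f' a -> exists2 g, hol g a & exists2 r : R, 0 < r & forall h, nm h <= r -> f' (a + h) = f' a + h * g (a + h).
  move=> hf; have [||g hg [r r0 fg]] := hol_div (fun z => f' z - f' a) a.
  - by apply: holB => //; exact: holC.
  - by rewrite subrr.
  by exists g => //; exists r => // h /fg <- /=; rewrite [RHS]addrC subrK.
move=> /step [g1 /[dup] /step [g2 /[dup] /step [g3 hg3 [r3 r30 e3]] _ [r2 r20 e2]] _ [r1 r10 e1]].
have [K [r [K0 r0 hK]]] := hol_bound _ _ hg3.
exists (g1 a), (g2 a), K, (Order.min (Order.min r1 r2) (Order.min r3 r)).
split => //; first by rewrite !lt_min r10 r20 r30.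
move=> h; rewrite !le_min => /andP[/andP[h1 h2] /andP[h3 h4]].
rewrite e1 // e2 // e3 //.
have -> : f a + h * (g1 a + h * (g2 a + h * g3 (a + h))) - (f a + g1 a * h + g2 a * h ^+ 2) = g3 (a + h) * h ^+ 3 by ring.
by rewrite nmM nmX ler_wpM2r ?exprn_ge0 ?nm_ge0 // hK.
Qed.

(** Holomorphy gives an expansion with unknown coefficients. The linear one is identified by
    [cexp_lin], the quadratic one by cexp(2h) = cexp(h)^2, which forces 4 c2 = 2 c2 + 1. *)
Lemma cexp_taylor : exists K r : R, [/\ 0 < K, 0 < r &
  forall h, nm h <= r -> nm (cexp h - (1 + h + h ^+ 2 / 2)) <= K * nm h ^+ 3].
Proof.
have [c1 [c2 [K [r [K0 r0 hK]]]]] := hol_taylor _ _ (cexp_hol 0).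
have H h : nm h <= r -> nm (cexp h - (1 + c1 * h + c2 * h ^+ 2)) <= K * nm h ^+ 3.
  by move=> /hK; rewrite add0r cexp0.
have E1 : c1 - 1 = 0.
  apply: (@small_zero _ (Order.min (Order.min r 1) (1 / 2)) (12 + K + nm c2)); first by rewrite !lt_min r0 !divr_gt0 // ltr01.
  move=> h h0; rewrite !le_min => /andP[/andP[hr h1] h2].
  have hp : 0 < nm h by rewrite nm_gt0.
  rewrite -(ler_pM2r hp) -nmM.
  have -> : (c1 - 1) * h = (cexp h - 1 - h) - (cexp h - (1 + c1 * h + c2 * h ^+ 2)) - c2 * h ^+ 2 by ring.
  apply: le_trans (nmB _ _) _; apply: le_trans (lerD (nmB _ _) (lexx _)) _.
  have := cexp_lin h h2; have := H h hr; rewrite nmM nmX.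
  have : nm h ^+ 3 <= nm h ^+ 2 by rewrite exprSr ler_piMr ?exprn_ge0 // ltW.
  move: (nm h) hp (nm (cexp h - 1 - h)) (nm (cexp h - (1 + c1 * h + c2 * h ^+ 2))) => x x0 A B h3 hB hA.
  have : K * x ^+ 3 <= K * x ^+ 2 by rewrite ler_wpM2l // ltW.
  have := nm_ge0 c2; nra.
have c11 : c1 = 1 by apply/eqP; rewrite -subr_eq0 E1.
have E2 : 2 * c2 - 1 = 0.
  pose L := 2 * K * (3 + nm c2) + K ^+ 2 + 8 * K + 2 * nm c2 + nm c2 ^+ 2.
  apply: (@small_zero _ (Order.min (r / 2) 1) L).
    by rewrite lt_min ltr01 andbT divr_gt0.
  move=> h h0; rewrite !le_min => /andP[hr h1].
  have hp : 0 < nm h by rewrite nm_gt0.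
  have hp2 : 0 < nm h ^+ 2 by rewrite exprn_gt0.
  rewrite -(ler_pM2r hp2) -nmX -nmM nmX.
  pose q := cexp h - (1 + c1 * h + c2 * h ^+ 2).
  pose q2 := cexp (2 * h) - (1 + c1 * (2 * h) + c2 * (2 * h) ^+ 2).
  have hq : nm q <= K * nm h ^+ 3 by apply: H; lra.
  have hq2 : nm q2 <= 8 * K * nm h ^+ 3.
    have -> : 8 * K * nm h ^+ 3 = K * (nm (2 * h)) ^+ 3 by rewrite nmM nm_nat; ring.
    by apply: H; rewrite nmM nm_nat; lra.
  have e : (2 * c2 - 1) * h ^+ 2 = q * (2 * (1 + h + c2 * h ^+ 2)) + q ^+ 2 - q2 + h ^+ 3 * (2 * c2 + c2 ^+ 2 * h).
    have ce : cexp (2 * h) = cexp h ^+ 2 by rewrite cexpX.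
    by rewrite /q /q2 ce c11; ring.
  rewrite e; apply: le_trans (nmD _ _) _.
  apply: le_trans (lerD (nmB _ _) (lexx _)) _.
  apply: le_trans (lerD (lerD (nmD _ _) (lexx _)) (lexx _)) _.
  set x := nm h in hp hp2 hr h1 hq hq2 *.
  have x3 : 0 < x ^+ 3 by rewrite exprn_gt0.
  have n1 : nm (2 * (1 + h + c2 * h ^+ 2)) <= 2 * (3 + nm c2).
    rewrite nmM nm_nat ler_wpM2l //.
    apply: le_trans (nmD _ _) _; apply: le_trans (lerD (nmD _ _) (lexx _)) _.
    rewrite nm1 nmM nmX -/x; have := nm_ge0 c2.
    have : x ^+ 2 <= 1 by rewrite exprn_ile1 // ltW.
    nra.
  have n2 : nm (2 * c2 + c2 ^+ 2 * h) <= 2 * nm c2 + nm c2 ^+ 2.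
    by apply: le_trans (nmD _ _) _; rewrite !nmM nm_nat -/x; have := nm_ge0 c2; nra.
  have -> : L * x * x ^+ 2 = K * x ^+ 3 * (2 * (3 + nm c2)) + K ^+ 2 * x ^+ 3 + 8 * K * x ^+ 3 + x ^+ 3 * (2 * nm c2 + nm c2 ^+ 2).
    by rewrite /L; ring.
  apply: lerD; last by rewrite nmM nmX -/x ler_wpM2l // ltW.
  apply: lerD => //; apply: lerD; first by rewrite nmM; apply: ler_pM; rewrite ?nm_ge0.
  rewrite nmX; apply: (@le_trans _ _ ((K * x ^+ 3) ^+ 2)).
    by rewrite lerXn2r ?nnegrE ?nm_ge0 // mulr_ge0 // ltW.
  rewrite exprMn ler_wpM2l ?exprn_ge0 ?(ltW K0) // expr2 ler_piMr ?(ltW x3) //.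
  by rewrite exprn_ile1 // ltW.
exists K, r; split => // h /H; rewrite c11.
have -> : c2 = 1 / 2 by apply: (@mulfI _ 2); rewrite ?pnatr_eq0 // mulrC; move/eqP: E2; rewrite subr_eq0 => /eqP; rewrite mulrC => ->; field.
by congr (nm _ <= _); ring.
Qed.

(** * The sigma function *)

(** The primary factor of genus 2: its exponential cancels the terms of order 1 and 2, so the
    distance to 1 is of third order and matches the weight [wt]. *)
Definition weierstrass_factor (t : CC) : CC := (1 - t) * cexp (t + t ^+ 2 / 2).

Lemma weierstrass_factor_bound (T : R) : 0 <= T -> exists2 K : R, 0 < K & forall t, nm t <= T -> nm (weierstrass_factor t - 1) <= K * nm t ^+ 3.
Proof.
move=> T0; have [K [r [K0 r0 hK]]] := cexp_taylor.
pose t0 := Order.min (1 / 2) (r / 2).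
have t00 : 0 < t0 by rewrite lt_min !divr_gt0.
(* B bounds the factor crudely for all t in question. For t above the threshold t0 this already
   gives B / t0^3 times |t|^3; below it the Taylor estimate supplies 2 + 16 K. *)
pose B := (1 + T) * expR (T + T ^+ 2) + 1.
have B0 : 0 < B by rewrite ltr_wpDl // mulr_ge0 ?expR_ge0 // addr_ge0.
exists (2 + 16 * K + B / t0 ^+ 3).
  by rewrite !addr_gt0 ?divr_gt0 ?exprn_gt0 ?mulr_gt0.
move=> t tT; have x0 := nm_ge0 t.
have x3 : 0 <= nm t ^+ 3 by rewrite exprn_ge0.
have d0 : 0 <= B / t0 ^+ 3 by rewrite divr_ge0 ?exprn_ge0 // ltW.
case: (lerP (nm t) t0) => h.
  have h1 : nm t <= 1 / 2 by apply: le_trans h _; rewrite ge_min lexx.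
  have h2 : nm t <= r / 2 by apply: le_trans h _; rewrite ge_min lexx orbT.
  pose s := t + t ^+ 2 / 2.
  have ss : s = t * (1 + t / 2) by rewrite /s; field.
  have n12 : nm (1 + t / 2) <= 2.
    by apply: le_trans (nmD _ _) _; rewrite nm1 nmM nmV nm_nat; lra.
  have ns : nm s <= 2 * nm t by rewrite ss nmM mulrC ler_wpM2r.
  have := hK s ltac:(lra) => hs.
  have e : weierstrass_factor t - 1 = t ^+ 3 * (- (1 / 2) - 3 / 8 * t - t ^+ 2 / 8) + (1 - t) * (cexp s - (1 + s + s ^+ 2 / 2)).
    by rewrite /weierstrass_factor -/s /s; field.
  rewrite e; apply: le_trans (nmD _ _) _; rewrite nmM nmX [nm ((1 - t) * _)]nmM.
  have b1 : nm (- (1 / 2) - 3 / 8 * t - t ^+ 2 / 8) <= 2.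
    apply: le_trans (nmB _ _) _; apply: le_trans (lerD (nmB _ _) (lexx _)) _.
    by rewrite nmN !nmM !nmV !nm_nat ?nm1; nra.
  have b2 : nm (1 - t) <= 2 by apply: le_trans (nmB _ _) _; rewrite nm1; lra.
  have b3 : nm (cexp s - (1 + s + s ^+ 2 / 2)) <= K * (8 * nm t ^+ 3).
    apply: le_trans hs _; rewrite ler_wpM2l ?(ltW K0) //.
    have -> : 8 * nm t ^+ 3 = (2 * nm t) ^+ 3 by ring.
    by rewrite lerXn2r ?nnegrE ?nm_ge0 ?mulr_ge0.
  have : nm (1 - t) * nm (cexp s - (1 + s + s ^+ 2 / 2)) <= 2 * (K * (8 * nm t ^+ 3)).
    by apply: ler_pM; rewrite ?nm_ge0.
  have : nm t ^+ 3 * nm (- (1 / 2) - 3 / 8 * t - t ^+ 2 / 8) <= nm t ^+ 3 * 2 by rewrite ler_wpM2l.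
  have : 0 <= B / t0 ^+ 3 * nm t ^+ 3 by rewrite mulr_ge0.
  rewrite !mulrDl; lra.
have : nm (weierstrass_factor t - 1) <= B.
  apply: le_trans (nmB _ _) _; rewrite nm1 lerD2r nmM; apply: ler_pM; rewrite ?nm_ge0 //.
    by apply: le_trans (nmB _ _) _; rewrite nm1; lra.
  apply: le_trans (nm_cexp_le _) _; rewrite ler_expR; apply: le_trans (nmD _ _) _.
  rewrite !nmM nmV nm_nat.
  have : nm t * nm t <= T * T by apply: ler_pM.
  have := mulr_ge0 x0 x0; rewrite expr2; lra.
move=> hB; apply: le_trans hB _.
apply: (@le_trans _ _ (B / t0 ^+ 3 * nm t ^+ 3)).
  rewrite mulrAC ler_pdivlMr ?exprn_gt0 // ler_wpM2l ?(ltW B0) //.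
  by rewrite lerXn2r ?nnegrE // ltW.
rewrite ler_wpM2r // lerDr addr_ge0 // mulr_ge0 // ltW //.
Qed.

Definition sfac (w1 w2 z : CC) (p : int * int) : CC := if nzp p then weierstrass_factor (z / latp w1 w2 p) else 1.
Definition sprod w1 w2 z N := \prod_(p <- box N) sfac w1 w2 z p.
(* [sig0] is sigma(z)/z, with the removable singularity filled in. *)
Definition sig0 w1 w2 z := Lim (sprod w1 w2 z).

Section Sigma.
Variables (w1 w2 : CC).
Hypothesis hi : indep w1 w2.
Local Notation om := (latp w1 w2).
Local Notation sfac := (sfac w1 w2).
Local Notation sprod := (sprod w1 w2).
Local Notation sig0 := (sig0 w1 w2).
Local Notation sg := (wsigma w1 w2).

Lemma om_neq0 p : nzp p -> om p != 0.
Proof.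
have [d s] := sep_nz _ _ hi => np; have := sep_neq0 _ _ _ _ _ p s np.
by rewrite sub0r oppr_eq0.
Qed.

Lemma sfac_bound (rho : R) : 0 <= rho -> exists2 K : R, 0 <= K &
  forall z p, nm z <= rho -> nm (sfac z p - 1) <= K * wt p.
Proof.
move=> r0; have [d s] := sep_nz _ _ hi; have d0 : 0 < d by case: s.
have [K K0 hK] := weierstrass_factor_bound (rho / d) ltac:(by rewrite divr_ge0 // ltW).
have rd : 0 <= rho / d by rewrite divr_ge0 // ltW.
exists (K * (rho / d) ^+ 3); first by rewrite mulr_ge0 ?exprn_ge0 ?(ltW K0).
move=> z p hz; rewrite /sfac; case: ifP => np; last first.
  by rewrite subrr nm0 mulr_ge0 ?(ltW (wt_gt0 p)) // mulr_ge0 ?exprn_ge0 ?(ltW K0).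
have ho : nm (z / om p) <= rho / d * (height p).+1%:R^-1.
  rewrite nmM nmV -mulrA -invfM; apply: ler_pM; rewrite ?nm_ge0 ?invr_ge0 ?nm_ge0 //.
  have := (s.2 p np); rewrite sub0r nmN => h.
  have p0 : 0 < d * (height p).+1%:R by rewrite mulr_gt0 ?ltr0n.
  by rewrite lef_pV2 ?posrE //; apply: lt_le_trans h.
have h1 : nm (z / om p) <= rho / d.
  apply: le_trans ho _; rewrite ler_piMr // invf_le1 ?ltr0n //; exact: ht1.
apply: le_trans (hK _ h1) _; rewrite -mulrA ler_wpM2l ?(ltW K0) //.
rewrite /wt -exprVn -exprMn lerXn2r ?nnegrE ?nm_ge0 // mulr_ge0 // invr_ge0 ler0n.
Qed.

Lemma sig_unif (rho : R) : 0 <= rho -> exists2 K : R, 0 <= K & forall z, nm z <= rho ->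
  tends (sprod z) (sig0 z) /\
  (forall N, 16 * K <= N.+1%:R -> nm (sprod z N - sig0 z) <= expR (9 * K) * (16 * K / N.+1%:R)).
Proof.
move=> r0; have [K K0 hK] := sfac_bound _ r0; exists K => // z hz.
have [l hl [h1 _]] := boxprod_tends (sfac z) K K0 (fun p => hK z p hz).
have t : tends (sprod z) (sig0 z) by apply: Lim_tends; exists l.
by split => // N; rewrite -(tends_uniq _ _ _ hl t); exact: h1.
Qed.

Lemma sig0_tends z : tends (sprod z) (sig0 z).
Proof. by have [K K0 h] := sig_unif (nm z) (nm_ge0 z); have [] := h z (lexx _). Qed.

Lemma sfac_neq0 z p : ~ in_latt w1 w2 z -> sfac z p != 0.
Proof.
move=> hz; rewrite /sfac; case: ifP => np; last exact: oner_neq0.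
rewrite /weierstrass_factor mulf_neq0 ?cexp_neq0 // subr_eq0; apply/eqP => e; apply: hz.
exists p.1, p.2; rewrite -[latt _ _ _ _]mul1r e divfK //; exact: om_neq0.
Qed.

Lemma sig0_neq0 z : ~ in_latt w1 w2 z -> sig0 z != 0.
Proof.
move=> hz; have [K K0 hK] := sfac_bound _ (nm_ge0 z).
have [l hl [_ h1]] := boxprod_tends (sfac z) K K0 (fun p => hK z p (lexx _)).
rewrite (tends_uniq _ _ _ (sig0_tends z) hl); apply: h1 => p; exact: sfac_neq0.
Qed.

Lemma sig0_0 : sig0 0 = 1.
Proof.
apply: tends_uniq (sig0_tends 0) _; apply: tends_ext (tends_cst 1) => N.
rewrite /sprod big1 // => p _; rewrite /sfac; case: ifP => // _.
by rewrite /weierstrass_factor mul0r expr0n /= mul0r addr0 cexp0 subr0 mulr1.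
Qed.

Lemma wsigma_tends z : tends (fun N => z * sprod z N) (sg z).
Proof.
rewrite /wsigma.
have -> : (fun N => z * sq_prod N (fun m k => if nz m k then (1 - z / latt w1 w2 m k) *
       cexp (z / latt w1 w2 m k + (z / latt w1 w2 m k) ^+ 2 / 2) else 1)) = (fun N => z * sprod z N).
  by apply/funext => N; rewrite sq_prodE.
by apply: Lim_tends; exists (z * sig0 z); apply: tendsZ; exact: sig0_tends.
Qed.

Lemma wsigma_sig0 z : sg z = z * sig0 z.
Proof. exact: tends_uniq (wsigma_tends z) (tendsZ _ _ _ (sig0_tends z)). Qed.

Lemma wsigma0 : sg 0 = 0.
Proof. by rewrite wsigma_sig0 mul0r. Qed.

Lemma wsigma_latt z : in_latt w1 w2 z -> sg z = 0.
Proof.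
move=> [m [k e]]; have [z0|z0] := eqVneq z 0; first by rewrite z0 wsigma0.
have np : nzp (m, k).
  rewrite /nzp /nz /=; apply: contraNT z0; rewrite negb_or !negbK => /andP[/eqP m0 /eqP k0].
  by rewrite e m0 k0 /latt !mul0r addr0.
apply: tends_uniq (wsigma_tends z) _ => e' e0; exists (height (m, k)) => n hn.
have -> : sprod z n = 0.
  rewrite /sprod (bigD1_seq (m, k)) ?box_uniq ?mem_box //= {1}/sfac np /weierstrass_factor.
  by rewrite e /latp /= mulfV ?subrr ?mul0r //; exact: (om_neq0 (m, k)).
by rewrite mulr0 subrr nm0 ltW.
Qed.

Lemma wsigma_neq0 z : ~ in_latt w1 w2 z -> sg z != 0.
Proof.
move=> hz; rewrite wsigma_sig0 mulf_neq0 ?sig0_neq0 //; apply/eqP => z0; apply: hz.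
by rewrite z0; exact: in_latt0.
Qed.

Lemma wsigma_eq0 z : sg z = 0 <-> in_latt w1 w2 z.
Proof.
split; last exact: wsigma_latt.
by move=> h; have [//|/wsigma_neq0] := pselect (in_latt w1 w2 z); rewrite h eqxx.
Qed.

Lemma sig0_even z : sig0 (- z) = sig0 z.
Proof.
apply: tends_uniq (sig0_tends (- z)) _; apply: tends_ext (sig0_tends z) => N.
rewrite /sprod -[RHS]big_box_opp; apply: eq_bigr => p _.
by rewrite /sfac nzpN latpN invrN mulrNN.
Qed.

Lemma wsigma_odd z : sg (- z) = - sg z.
Proof. by rewrite !wsigma_sig0 sig0_even mulNr. Qed.

Lemma sig0_hol a : hol sig0 a.
Proof.
exists 1 => //; apply: happ_lim => e e0.
have [|K K0 hK] := sig_unif (nm a + 1); first by have := nm_ge0 a; lra.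
have [N1 hN1] := nat_eps (16 * K) 1 ltr01.
have [N2 hN2] := nat_eps (expR (9 * K) * (16 * K)) e e0.
pose N := maxn N1 N2.
exists (sprod ^~ N).
  apply: (happ_prod _ _ _ (fun p z => sfac z p)) => // p; rewrite /sfac; case: (nzp p); last exact: happC.
  have hq : happ 1 (fun z => z / om p) a by apply: happM => //; [exact: happ_id|exact: happC].
  apply: happM => //; first by apply: happB => //; exact: happC.
  apply: happ_cexp => //; apply: happD => //; apply: happM => //; last exact: happC.
  exact: happX.
move=> h hd; have [|_ h2] := hK (a + h); first by have := nmD a h; lra.
rewrite nmBC; apply: le_trans (h2 N _) _.
  by have := hN1 N (leq_maxl _ _); rewrite ler_pdivrMr ?mul1r // ltr0n.
by rewrite mulrA; exact: (hN2 N (leq_maxr _ _)).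
Qed.

Lemma wsigma_hol a : hol sg a.
Proof.
have : hol (fun z => z * sig0 z) a by apply: holM; [exact: hol_id|exact: sig0_hol].
by apply: hol_ext; exists 1 => // h _; rewrite wsigma_sig0.
Qed.

(* In sigma(a+x) sigma(a-x) / sigma(a)^2 the exponential factors depend only on x, so that periodicity in a
   follows without the quasi-periodicity of sigma. *)
Definition sgN z N := z * sprod z N.

Lemma sgN_quot a x N : ~ in_latt w1 w2 a ->
  sgN (a + x) N * sgN (a - x) N / sgN a N ^+ 2 =
  \prod_(p <- box N) (1 - x ^+ 2 / (a - om p) ^+ 2) * \prod_(p <- box N | nzp p) cexp (x ^+ 2 / om p ^+ 2).
Proof.
move=> ha.
have a0 : a != 0 by apply/eqP => e; apply: ha; rewrite e; exact: in_latt0.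
have S z : sprod z N = \prod_(p <- box N | nzp p) sfac z p.
  by rewrite /sprod big_box0 /= {1}/sfac /nzp /nz /= mul1r.
rewrite /sgN !S big_box0 /= latp0 subr0 -[RHS]mulrA -[X in _ = _ * X]big_split /=.
have S0 z : \prod_(p <- box N | nzp p) sfac z p = \prod_(p <- box N | nzp p) weierstrass_factor (z / om p).
  by apply: eq_bigr => p np; rewrite /sfac np.
have -> : \prod_(p <- box N | nzp p) ((1 - x ^+ 2 / (a - om p) ^+ 2) * cexp (x ^+ 2 / om p ^+ 2)) =
  (\prod_(p <- box N | nzp p) sfac (a + x) p * \prod_(p <- box N | nzp p) sfac (a - x) p) /
  \prod_(p <- box N | nzp p) sfac a p ^+ 2.
  rewrite -big_split -prodf_div /=; apply: eq_bigr => p np.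
  have o0 := om_neq0 p np.
  have ao : a - om p != 0 by rewrite subr_eq0; apply/eqP => e; apply: ha; exists p.1, p.2.
  have oa : om p - a != 0 by rewrite -opprB oppr_eq0.
  rewrite /sfac np /weierstrass_factor exprMn.
  set e1 := cexp (x ^+ 2 / _); set e2 := cexp _; set e3 := cexp _; set e4 := cexp _.
  (* The exponents at a + x and a - x add up to twice the exponent at a plus x^2 / w^2; this is
     where the dependence on a cancels. *)
  have ee : e2 * e3 = e4 ^+ 2 * e1.
    by rewrite /e1 /e2 /e3 /e4 cexpX -!cexpD; congr cexp; field.
  have e40 : e4 != 0 by exact: cexp_neq0.
  have -> : (1 - (a + x) / om p) * e2 * ((1 - (a - x) / om p) * e3) =
    (1 - (a + x) / om p) * (1 - (a - x) / om p) * (e2 * e3) by ring.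
  by rewrite ee; field; rewrite e40 o0 ao oa.
have P0 : \prod_(p <- box N | nzp p) sfac a p != 0.
  by rewrite prodf_seq_neq0; apply/allP => p _; apply/implyP => _; exact: sfac_neq0.
by rewrite prodrXl; field; rewrite a0 P0.
Qed.

(** By [sgN_quot] the partial quotients at a + w1 and at a differ by two boundary columns. A column
    has 2N+1 factors 1 + O(N^-2), so its product tends to 1. *)
Lemma quot_per1 a x : ~ in_latt w1 w2 a ->
  sg (a + w1 + x) * sg (a + w1 - x) / sg (a + w1) ^+ 2 = sg (a + x) * sg (a - x) / sg a ^+ 2.
Proof.
move=> ha; have ha' := notin_lattD _ _ _ _ ha (in_latt1 w1 w2).
have [d s] := sep_off _ _ _ hi ha.
have d0 : 0 < d by case: s.
pose c (k : nat -> int) N := \prod_(p <- col (k N) N) (1 - x ^+ 2 / (a - om p) ^+ 2).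
have tq y : ~ in_latt w1 w2 y -> tends (fun N => sgN (y + x) N * sgN (y - x) N / sgN y N ^+ 2)
   (sg (y + x) * sg (y - x) / sg y ^+ 2).
  move=> hy; apply: tendsM; first by apply: tendsM; exact: wsigma_tends.
  apply: tendsV; first by rewrite expf_neq0 // wsigma_neq0.
  by apply: tendsX; exact: wsigma_tends.
have c1 (k : nat -> int) : (forall N, N <= `|k N|)%N -> tends (c k) 1.
  move=> hk e e0; pose K := 2 * nm x ^+ 2 * d ^- 2.
  have K0 : 0 <= K by rewrite !mulr_ge0 ?exprn_ge0 ?invr_ge0 ?exprn_ge0 ?nm_ge0 // ltW.
  have [N1 hN1] := nat_eps K (1 / 2) ltac:(lra).
  have [N2 hN2] := nat_eps (2 * K) e e0.
  exists (maxn N1 N2) => n; rewrite geq_max => /andP[/hN1 n1 /hN2 n2].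
  have hb : \sum_(p <- col (k n) n) nm (1 - x ^+ 2 / (a - om p) ^+ 2 - 1) <= K / n.+1%:R.
    apply: (col_bound _ _ _ _ _ _ _ _ s) => //; first by rewrite exprn_ge0 ?nm_ge0.
    by move=> p; rewrite addrAC subrr sub0r nmN nmM nmX.
  apply: le_trans (nm_prod1_le _ _) _.
  apply: (@le_trans _ _ (2 * (K / n.+1%:R))); last by rewrite mulrA.
  apply: (@le_trans _ _ (expR (K / n.+1%:R) - 1)); first by rewrite lerD2r ler_expR.
  by apply: expR_sub1_le; rewrite n1 divr_ge0.
have t1 := c1 (fun N => N%:Z) (fun N => leqnn N).
have t2 := c1 (fun N => - N.+1%:Z) (fun N => ltac:(rewrite abszN; exact: leqnSn)).
rewrite -[LHS]mulr1 -[RHS]mulr1.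
apply: tends_uniq (tendsM _ _ _ _ (tq _ ha') t1) _.
apply: tends_ext (tendsM _ _ _ _ (tq _ ha) t2) => N.
rewrite !sgN_quot //.
have := big_box_shift _ _ _ N (fun p => 1 - x ^+ 2 / (a - om p) ^+ 2) => /= e.
have e' : \prod_(p <- box N) (1 - x ^+ 2 / (a - om (p.1 - 1, p.2)) ^+ 2) =
   \prod_(p <- box N) (1 - x ^+ 2 / (a + w1 - om p) ^+ 2).
  by apply: eq_bigr => p _; rewrite latp_shift; congr (1 - _ / (_ ^+ 2)); ring.
by rewrite -e' /c mulrAC -e /= mulrAC.
Qed.
End Sigma.

Lemma wsigma_swap w1 w2 z : indep w1 w2 -> wsigma w2 w1 z = wsigma w1 w2 z.
Proof.
move=> hi; have hi' := indep_sym _ _ hi; rewrite (wsigma_sig0 _ _ hi') (wsigma_sig0 _ _ hi) /sig0.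
have -> // : sprod w2 w1 z = sprod w1 w2 z.
apply/funext => N; rewrite /sprod -[RHS]big_box_swap; apply: eq_bigr => p _.
by rewrite /sfac nzp_swap latp_swap.
Qed.

Lemma quot_per2 w1 w2 a x : indep w1 w2 -> ~ in_latt w1 w2 a ->
  wsigma w1 w2 (a + w2 + x) * wsigma w1 w2 (a + w2 - x) / wsigma w1 w2 (a + w2) ^+ 2 =
  wsigma w1 w2 (a + x) * wsigma w1 w2 (a - x) / wsigma w1 w2 a ^+ 2.
Proof.
move=> hi ha; rewrite -!(wsigma_swap w1 w2) //; apply: quot_per1; first exact: indep_sym.
by move/in_latt_swap.
Qed.

(** * The product formula for sigma *)

(** Writing f = h g, evenness of f makes g odd off 0, so continuity gives g(0) = 0 and a second
    division is possible. *)
Lemma hol_even_div f r : 0 < r -> hol f 0 -> f 0 = 0 -> (forall h, h != 0 -> nm h <= r -> f (- h) = f h) ->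
  exists2 g, hol g 0 & exists2 r' : R, 0 < r' & forall h, nm h <= r' -> f h = h ^+ 2 * g h.
Proof.
move=> r0 hf f0 ev.
have [g hg [r1 r10 fg]] := hol_div _ _ hf f0.
have g0 : g 0 = 0.
  apply: nm_small => e e0; have [d d0 hd] := hol_cont _ _ hg e e0.
  pose m := Order.min (Order.min r r1) d.
  have m0 : 0 < m by rewrite !lt_min r0 r10.
  have nmm : nm m%:K = m by rewrite nm_real gtr0_norm.
  have mn : m%:K != 0 by rewrite -nm_gt0 nmm.
  have [mr1 mr2 mr3] : [/\ m <= r, m <= r1 & m <= d] by rewrite /m !ge_min !lexx /= !orbT.
  have e1 := fg m%:K ltac:(by rewrite nmm); have e2 := fg (- m%:K) ltac:(by rewrite nmN nmm).
  have od : g (- m%:K) = - g m%:K.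
    apply: (mulfI mn); move: e1 e2; rewrite !add0r ev // ?nmm // => -> /eqP.
    by rewrite mulNr -subr_eq0 opprK mulrN => /eqP h; apply/eqP; rewrite -subr_eq0 opprK addrC h.
  have h1 := hd m%:K ltac:(by rewrite nmm); have h2 := hd (- m%:K) ltac:(by rewrite nmN nmm).
  rewrite !add0r od in h1 h2.
  have := nmD (- (g m%:K - g 0)) (- (- g m%:K - g 0)).
  have -> : - (g m%:K - g 0) - (- g m%:K - g 0) = 2 * g 0 by ring.
  rewrite !nmN nmM nm_nat; lra.
have [k hk [r2 r20 gk]] := hol_div _ _ hg g0.
exists k => //; exists (Order.min r1 r2); first by rewrite lt_min r10.
move=> h; rewrite le_min => /andP[h1 h2]; rewrite -[h in LHS]add0r fg // gk // add0r expr2 mulrA //.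
Qed.

Lemma small_notin w1 w2 : indep w1 w2 -> exists2 d : R, 0 < d & forall h, h != 0 -> nm h <= d -> ~ in_latt w1 w2 h.
Proof.
move=> hi; have [d [d0 hd]] := sep_nz _ _ hi; exists d => // h h0 hh [m [k e]].
have np : nzp (m, k).
  rewrite /nzp /nz /=; apply: contraNT h0; rewrite negb_or !negbK => /andP[/eqP m0 /eqP k0].
  by rewrite e m0 k0 /latt !mul0r addr0.
have := hd _ np; rewrite sub0r nmN /latp /= -e.
have : (2 : R) <= (height (m, k)).+1%:R by rewrite ler_nat ltnS ht_gt0.
move: ((height (m, k)).+1%:R : R) => x; nra.
Qed.

Section WeierstrassA.
Variables (w1 w2 : CC).
Hypothesis hi : indep w1 w2.
Local Notation sg := (wsigma w1 w2).
Local Notation p_ := (wp w1 w2).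
Local Notation inL := (in_latt w1 w2).

Lemma near_notin a : ~ inL a -> exists2 d : R, 0 < d & forall h, nm h <= d -> ~ inL (a + h).
Proof.
move=> /(sep_off _ _ _ hi) [d s]; exists (d / 2); first by rewrite divr_gt0 //; case: s.
by move=> h hh; apply: sepT_off (sep_shift _ _ _ _ _ _ s hh).
Qed.

Lemma wp_hol a : ~ inL a -> hol p_ a.
Proof.
move=> ha; have [d s] := sep_off _ _ _ hi ha.
apply: hol_ext (psum_hol _ _ _ _ _ hi s); exists (d / 2); first by rewrite divr_gt0 //; case: s.
by move=> h hh; rewrite (wpQT _ _ hi _ _ (sep_shift _ _ _ _ _ _ s hh)).
Qed.

Lemma wsigma_addB a b : ~ inL a -> ~ inL b ->
  sg (a + b) * sg (a - b) = - (sg a ^+ 2 * sg b ^+ 2 * (p_ a - p_ b)).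
Proof.
move=> ha hb; have sb := wsigma_neq0 _ _ hi _ hb.
pose f0 z := sg (z + b) * sg (z - b) / sg z ^+ 2 / sg b ^+ 2 + p_ z - p_ b.
have f0_hol z : ~ inL z -> hol f0 z.
  move=> hz; apply: holB; last exact: holC.
  apply: holD; last exact: wp_hol.
  apply: holM; last exact: holC.
  apply: holM.
    by apply: holM; apply: hol_shift; exact: wsigma_hol.
  by apply: (hol_inv (fun z => sg z ^+ 2)); [apply: holX; exact: wsigma_hol|rewrite expf_neq0 // wsigma_neq0].
pose s := sig0 w1 w2; pose phi := psum w1 w2 nzp.
(* Up to the constant wp(b), this is z^2 [s z ^+ 2] times [f0], with the pole at 0 cleared. It is
   even near 0 and vanishes there because sigma(b) sigma(-b) / sigma(b)^2 = -1, so z^2 divides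
   it. *)
pose M z := sg (z + b) * sg (z - b) / sg b ^+ 2 + s z ^+ 2 * (1 + z ^+ 2 * phi z).
have [d1 s1] := sep_nz _ _ hi.
have M_hol : hol M 0.
  apply: holD.
    apply: holM; last exact: holC.
    by apply: holM; apply: hol_shift; exact: wsigma_hol.
  apply: holM; first by apply: holX; exact: sig0_hol.
  apply: holD; first exact: holC.
  by apply: holM; [apply: holX; exact: hol_id|exact: psum_hol s1].
have M0 : M 0 = 0.
  rewrite /M sub0r wsigma_odd // add0r /s sig0_0 // expr0n /= mul0r addr0 expr1n mulr1.
  by rewrite mulrN mulNr -expr2 mulfV ?expf_neq0 // addNr.
have [d d0 hd] := small_notin _ _ hi.
have M_even h : h != 0 -> nm h <= d -> M (- h) = M h.
  move=> h0 hh; have hl := hd h h0 hh.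
  have ph : phi (- h) = phi h.
    by have := wp_even _ _ hi _ hl; rewrite !wpQZ sqrrN => /addrI.
  rewrite /M ph /s sig0_even // sqrrN; congr (_ / _ + _).
  have -> : - h + b = - (h - b) by ring.
  have -> : - h - b = - (h + b) by ring.
  by rewrite (wsigma_odd _ _ hi (h - b)) (wsigma_odd _ _ hi (h + b)) mulrNN mulrC.
have [M2 M2_hol [r r0 hM2]] := hol_even_div _ _ d0 M_hol M0 M_even.
pose f1 z := M2 z / s z ^+ 2 - p_ b.
have f1_hol : hol f1 0.
  apply: holB; last exact: holC; apply: holM => //.
  apply: (hol_inv (fun z => s z ^+ 2)); first by apply: holX; exact: sig0_hol.
  by rewrite /s sig0_0 // expr1n oner_eq0.
have f01 h : h != 0 -> nm h <= Order.min r d -> f0 h = f1 h.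
  move=> h0; rewrite le_min => /andP[hr hhd]; have hl := hd h h0 hhd.
  have sn : s h != 0 by exact: sig0_neq0.
  rewrite /f0 /f1 wpQZ -/phi (wsigma_sig0 _ _ hi h) -/s.
  have -> : M2 h = M h / h ^+ 2 by rewrite hM2 // mulrAC mulfV ?expf_neq0 // mul1r.
  rewrite /M; move: (sg (h + b)) (sg (h - b)) (sg b) (s h) (phi h) (p_ b) sb sn => t1 t2 t3 t4 f2 q1 n3 n4.
  by field; rewrite n3 h0 n4.
(* At lattice points [f0] only has the default values of division, so the value at 0 of the
   holomorphic extension [f1] is put there by hand. *)
pose f z := if pselect (inL z) then f1 0 else f0 z.
have f_in z : inL z -> f z = f1 0 by rewrite /f; case: pselect.
have f_out z : ~ inL z -> f z = f0 z by rewrite /f; case: pselect.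
have per w : inL w -> (forall z, ~ inL z -> f0 (z + w) = f0 z) -> forall z, f (z + w) = f z.
  move=> hw hf z; have [hz|hz] := pselect (inL z).
    by rewrite !f_in //; exact: in_lattD.
  by rewrite !f_out ?hf //; exact: notin_lattD.
have per1 : forall z, f (z + w1) = f z.
  apply: per; first exact: in_latt1.
  by move=> z hz; rewrite /f0 quot_per1 // wp_per //; exact: in_latt1.
have per2 : forall z, f (z + w2) = f z.
  apply: per; first exact: in_latt2.
  by move=> z hz; rewrite /f0 quot_per2 // wp_per //; exact: in_latt2.
have f_hol0 : hol f 0.
  apply: hol_ext f1_hol; exists (Order.min r d); first by rewrite lt_min r0.
  move=> h hh; rewrite add0r; have [->|h0] := eqVneq h 0; first by rewrite f_in //; exact: in_latt0.
  rewrite f_out ?f01 //; apply: hd => //; apply: le_trans hh _; by rewrite ge_min lexx orbT.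
have perL w : inL w -> forall z, f (z + w) = f z.
  move=> [m [k ->]] z.
  have H u : (forall z, f (z + u) = f z) -> forall (i : int) z, f (z + i%:~R * u) = f z.
    move=> hu; have fn (n : nat) y : f (y + n%:R * u) = f y.
      elim: n => [|n ih]; first by rewrite mul0r addr0.
      by rewrite -addn1 natrD mulrDl mul1r addrA hu.
    case=> n y; first exact: fn.
    by rewrite NegzE rmorphN mulNr -[in RHS](subrK (n.+1%:R * u) y) fn.
  by rewrite /latt addrA !H.
have f_hol z : hol f z.
  have [hz|hz] := pselect (inL z).
    move: f_hol0 => [r' r'0 h]; exists r' => // e /h [p hp]; exists p => x xr.
    by rewrite [z + x]addrC perL //; have := hp x xr; rewrite add0r.
  have [d' d'0 hd'] := near_notin _ hz.
  apply: hol_ext (f0_hol z hz); exists d' => // h /hd' hh.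
  by rewrite f_out.
have := liouville f w1 w2 f_hol (indep_span _ _ hi) per1 per2 a b.
(* At z = b the factor sigma(z - b) vanishes, so the constant value is 0. *)
rewrite !f_out // /f0 [b - b]subrr wsigma0 // mulr0 !mul0r add0r subrr => e.
have sa := wsigma_neq0 _ _ hi _ ha.
have solve (t x y p q : CC) : x != 0 -> y != 0 -> t / x ^+ 2 / y ^+ 2 + p - q = 0 -> t = - (x ^+ 2 * y ^+ 2 * (p - q)).
  move=> x0 y0 t0; have -> : t = (t / x ^+ 2 / y ^+ 2 + p - q) * (x ^+ 2 * y ^+ 2) - x ^+ 2 * y ^+ 2 * (p - q).
    by field; rewrite x0 y0.
  by rewrite t0 mul0r sub0r.
exact: solve sa sb e.
Qed.
End WeierstrassA.

(** * Addition theorem for the Weierstrass functions *)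

Definition near0 (P : CC -> Prop) : Prop := exists2 r : R, 0 < r & forall h, h != 0 -> nm h <= r -> P h.

Lemma near0_and P Q : near0 P -> near0 Q -> near0 (fun h => P h /\ Q h).
Proof.
move=> [r r0 hP] [s s0 hQ]; exists (Order.min r s); first by rewrite lt_min r0.
by move=> h h0; rewrite le_min => /andP[h1 h2]; split; [exact: hP|exact: hQ].
Qed.

Lemma near0_imp (P Q : CC -> Prop) : (forall h, h != 0 -> P h -> Q h) -> near0 P -> near0 Q.
Proof. by move=> PQ [r r0 hP]; exists r => // h h0 hr; apply: PQ => //; exact: hP. Qed.

(** Punctured limits at 0, so that difference quotients and functions with poles at 0 need no value
    there. *)
Definition lim0 (f : CC -> CC) (l : CC) : Prop := forall e : R, 0 < e -> near0 (fun h => nm (f h - l) <= e).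

Lemma lim0C c : lim0 (fun=> c) c.
Proof. by move=> e e0; exists 1 => // h _ _; rewrite subrr nm0 ltW. Qed.

Lemma lim0_id : lim0 id 0.
Proof. by move=> e e0; exists e => // h _; rewrite subr0. Qed.

Lemma lim0D f g l m : lim0 f l -> lim0 g m -> lim0 (fun h => f h + g h) (l + m).
Proof.
move=> hf hg e e0; apply: near0_imp (near0_and _ _ (hf (e / 2) ltac:(lra)) (hg (e / 2) ltac:(lra))) => h _ [h1 h2].
have -> : f h + g h - (l + m) = (f h - l) + (g h - m) by ring.
by apply: le_trans (nmD _ _) _; lra.
Qed.

Lemma lim0M f g l m : lim0 f l -> lim0 g m -> lim0 (fun h => f h * g h) (l * m).
Proof.
move=> hf hg e e0.
have lp := nm_ge0 l; have mp := nm_ge0 m.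
pose d : R := Order.min 1 (e / (nm l + nm m + 1)).
have k0 : 0 < nm l + nm m + 1 by lra.
have d0 : 0 < d by rewrite lt_min ltr01 divr_gt0.
apply: near0_imp (near0_and _ _ (hf d d0) (hg d d0)) => h _ [h1 h2].
have -> : f h * g h - l * m = (f h - l) * (g h - m) + l * (g h - m) + (f h - l) * m by ring.
apply: le_trans (nmD _ _) _; apply: le_trans (lerD (nmD _ _) (lexx _)) _; rewrite !nmM.
have d1 : d <= 1 by rewrite /d ge_min lexx.
have d2 : d * (nm l + nm m + 1) <= e by rewrite -ler_pdivlMr // /d ge_min lexx orbT.
have x1 := nm_ge0 (f h - l); have x2 := nm_ge0 (g h - m).
have : nm (f h - l) * nm (g h - m) <= d * 1 by apply: ler_pM => //; lra.
have : nm l * nm (g h - m) <= nm l * d by rewrite ler_wpM2l.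
have : nm (f h - l) * nm m <= d * nm m by rewrite ler_wpM2r.
lra.
Qed.

Lemma lim0N f l : lim0 f l -> lim0 (fun h => - f h) (- l).
Proof. by move=> hf e /hf; apply: near0_imp => h _ h1; rewrite -opprD nmN. Qed.
Lemma lim0B f g l m : lim0 f l -> lim0 g m -> lim0 (fun h => f h - g h) (l - m).
Proof. by move=> hf hg; apply: lim0D => //; exact: lim0N. Qed.
Lemma lim0X f l n : lim0 f l -> lim0 (fun h => f h ^+ n) (l ^+ n).
Proof.
move=> hf; elim: n => [|n ih]; first by rewrite expr0; apply: lim0C.
rewrite exprS => e e0; apply: near0_imp (lim0M _ _ _ _ hf ih e e0) => h _.
by rewrite exprS.
Qed.

Lemma lim0_eq f g l m : lim0 f l -> lim0 g m -> near0 (fun h => f h = g h) -> l = m.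
Proof.
move=> hf hg fg; apply/eqP; rewrite -subr_eq0; apply/eqP/nm_small => e e0.
have [r r0 H] := near0_and _ _ fg (near0_and _ _ (hf (e / 2) ltac:(lra)) (hg (e / 2) ltac:(lra))).
have nr : nm r%:K = r by rewrite nm_real gtr0_norm.
have [|| h1 [h2 h3]] := H r%:K; first by rewrite -nm_gt0 nr.
  by rewrite nr.
have := nm_tri (g r%:K) l m; rewrite (nmBC l (g _)); rewrite h1 in h2; lra.
Qed.

Lemma lim0_ext f g l : near0 (fun h => f h = g h) -> lim0 f l -> lim0 g l.
Proof. by move=> fg hf e /hf h; apply: near0_imp (near0_and _ _ fg h) => x _ [<-]. Qed.

Lemma lim0_neg f l : lim0 f l -> lim0 (fun h => f (- h)) l.
Proof.
move=> hf e /hf [r r0 h]; exists r => // x x0 xr; apply: h; rewrite ?oppr_eq0 ?nmN //.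
Qed.

Lemma lim0_hol f a : hol f a -> lim0 (fun h => f (a + h)) (f a).
Proof. by move=> hf e e0; have [d d0 hd] := hol_cont _ _ hf e e0; exists d => // h _; exact: hd. Qed.

Lemma lim0_O f (K r : R) : 0 < r -> (forall h, nm h <= r -> nm (f h) <= K * nm h) -> lim0 f 0.
Proof.
move=> r0 H e e0; have k0 : 0 < `|K| + 1 by rewrite ltr_wpDl.
exists (Order.min r (e / (`|K| + 1))); first by rewrite lt_min r0 divr_gt0.
move=> h _; rewrite le_min subr0 ler_pdivlMr // => /andP[h1 h2].
apply: le_trans (H h h1) _; apply: le_trans h2; rewrite mulrC ler_wpM2l ?nm_ge0 //.
by have := ler_norm K; lra.
Qed.

Section Taylor.
Variables (w1 w2 : CC).
Hypothesis hi : indep w1 w2.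
Local Notation sg := (wsigma w1 w2).
Local Notation p_ := (wp w1 w2).
Local Notation p' := (wp' w1 w2).
Local Notation inL := (in_latt w1 w2).

(** The second derivative of wp, given directly by its series. *)
Definition wp2 a := 6 * eis w1 w2 xpredT 4 a.
Definition G4 := eis w1 w2 nzp 4 0.

Lemma near0_notin a : ~ inL a -> near0 (fun h => ~ inL (a + h)).
Proof. by move=> /(near_notin _ _ hi) [d d0 hd]; exists d => // h _; exact: hd. Qed.

Lemma near0_notinN a : ~ inL a -> near0 (fun h => ~ inL (a - h)).
Proof. by move=> /(near_notin _ _ hi) [d d0 hd]; exists d => // h _ hh; apply: hd; rewrite nmN. Qed.

Lemma near0_lat : near0 (fun h => ~ inL h).
Proof. by have [d d0 hd] := small_notin _ _ hi; exists d. Qed.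

Lemma wp_lim a : ~ inL a ->
  [/\ lim0 (fun h => (p_ (a + h) - p_ a) / h) (p' a),
      lim0 (fun h => (p_ (a + h) + p_ (a - h) - 2 * p_ a) / h ^+ 2) (wp2 a) &
      lim0 (fun h => (p' (a + h) - p' a) / h) (wp2 a)].
Proof.
move=> ha; have [d s] := sep_off _ _ _ hi ha; have d0 : 0 < d by case: s.
have [K K0 hK] := taylor _ _ _ _ _ hi s.
have d2 : 0 < Order.min (d / 2) 1 by rewrite lt_min ltr01 andbT divr_gt0.
have pE h : nm h <= d / 2 -> p_ (a + h) = psum w1 w2 xpredT (a + h).
  by move=> hh; apply: (wpQT _ _ hi); exact: sep_shift s hh.
have pE0 : p_ a = psum w1 w2 xpredT a by apply: (wpQT _ _ hi); exact: s.
pose rr h := psum w1 w2 xpredT (a + h) - psum w1 w2 xpredT a + 2 * h * eis w1 w2 xpredT 3 a - 3 * h ^+ 2 * eis w1 w2 xpredT 4 a.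
pose qq h := eis w1 w2 xpredT 3 (a + h) - eis w1 w2 xpredT 3 a + 3 * h * eis w1 w2 xpredT 4 a.
have L1 : lim0 (fun h => rr h / h ^+ 2) 0.
  apply: (@lim0_O _ K (Order.min (d / 2) 1) d2) => h; rewrite le_min => /andP[hd _].
  have [->|h0] := eqVneq h 0; first by rewrite expr2 mul0r invr0 !mulr0 nm0 mulr0.
  have [b _ _] := hK h hd; rewrite nmM nmV nmX ler_pdivrMr ?exprn_gt0 ?nm_gt0 //.
  by rewrite -mulrA -exprS.
have L2 : lim0 (fun h => qq h / h) 0.
  apply: (@lim0_O _ K (Order.min (d / 2) 1) d2) => h; rewrite le_min => /andP[hd _].
  have [->|h0] := eqVneq h 0; first by rewrite invr0 mulr0 nm0 mulr0.
  have [_ b _] := hK h hd; rewrite nmM nmV ler_pdivrMr ?nm_gt0 //.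
  by rewrite -mulrA -expr2.
have nd : near0 (fun h => nm h <= d / 2) by exists (d / 2) => //; rewrite divr_gt0.
split.
- have := lim0D _ _ _ _ (lim0C (p' a)) (lim0D _ _ _ _ (lim0M _ _ _ _ (lim0C (wp2 a / 2)) lim0_id) (lim0M _ _ _ _ L1 lim0_id)).
  rewrite !mulr0 !addr0; apply: lim0_ext; apply: near0_imp nd => h h0 hd.
  by rewrite pE // pE0 wp'E /wp2 /rr; field.
- have := lim0D _ _ _ _ (lim0C (wp2 a)) (lim0D _ _ _ _ L1 (lim0_neg _ _ L1)).
  rewrite !addr0; apply: lim0_ext; apply: near0_imp nd => h h0 hd.
  by rewrite !pE ?nmN // pE0 /wp2 /rr; field.
have := lim0D _ _ _ _ (lim0C (wp2 a)) (lim0M _ _ _ _ (lim0C (- 2)) L2).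
rewrite !mulr0 !addr0; apply: lim0_ext; apply: near0_imp nd => h h0 hd.
by rewrite !wp'E /wp2 /qq; field.
Qed.

(** The Laurent expansions at 0 up to the first regular term: wp = h^-2 + 3 G4 h^2 + ..., followed
    by its first two derivatives. *)
Lemma wp_lim0 :
  [/\ lim0 (fun h => (p_ h - h ^- 2) / h ^+ 2) (3 * G4),
      lim0 (fun h => (p' h + 2 * h ^- 3) / h) (6 * G4) &
      lim0 (fun h => wp2 h - 6 * h ^- 4) (6 * G4)].
Proof.
have [d s] := sep_nz _ _ hi; have d0 : 0 < d by case: s.
have [K K0 hK] := taylor _ _ _ _ _ hi s.
have d2 : 0 < d / 2 by rewrite divr_gt0.
pose rr h := psum w1 w2 nzp h - 3 * h ^+ 2 * G4.
pose qq h := eis w1 w2 nzp 3 h + 3 * h * G4.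
pose tt h := eis w1 w2 nzp 4 h - G4.
have rE h : nm h <= d / 2 -> [/\ nm (rr h) <= K * nm h ^+ 3, nm (qq h) <= K * nm h ^+ 2 & nm (tt h) <= K * nm h].
  by move=> /hK; rewrite add0r psum0 // EZ30 // !subr0 mulr0 addr0.
have L1 : lim0 (fun h => rr h / h ^+ 2) 0.
  apply: (@lim0_O _ K _ d2) => h hd.
  have [->|h0] := eqVneq h 0; first by rewrite expr2 mul0r invr0 !mulr0 nm0 mulr0.
  have [b _ _] := rE h hd; rewrite nmM nmV nmX ler_pdivrMr ?exprn_gt0 ?nm_gt0 //.
  by rewrite -mulrA -exprS.
have L2 : lim0 (fun h => qq h / h) 0.
  apply: (@lim0_O _ K _ d2) => h hd.
  have [->|h0] := eqVneq h 0; first by rewrite invr0 mulr0 nm0 mulr0.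
  have [_ b _] := rE h hd; rewrite nmM nmV ler_pdivrMr ?nm_gt0 //.
  by rewrite -mulrA -expr2.
have L3 : lim0 tt 0 by apply: (@lim0_O _ K _ d2) => h hd; have [] := rE h hd.
have nl := near0_lat.
split.
- have := lim0D _ _ _ _ (lim0C (3 * G4)) L1.
  rewrite !addr0; apply: lim0_ext; apply: near0_imp nl => h h0 hl.
  by rewrite wpQZ /rr; field.
- have := lim0D _ _ _ _ (lim0C (6 * G4)) (lim0M _ _ _ _ (lim0C (- 2)) L2).
  rewrite !mulr0 !addr0; apply: lim0_ext; apply: near0_imp nl => h h0 hl.
  have [d' s'] := sep_off _ _ _ hi hl.
  by rewrite wp'E (ET_EZ _ _ 3 _ _ isT s') /qq; field.
have := lim0D _ _ _ _ (lim0C (6 * G4)) (lim0M _ _ _ _ (lim0C 6) L3).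
rewrite !mulr0 !addr0; apply: lim0_ext; apply: near0_imp nl => h h0 hl.
have [d' s'] := sep_off _ _ _ hi hl.
by rewrite /wp2 (ET_EZ _ _ 4 _ _ isT s') /tt; field.
Qed.
End Taylor.

(** The product of the four values sigma(a ± b ± h) is computed in two ways, by pairing the factors
    as (a ± h) ± b and as (a ± b) ± h. *)
Lemma quad_alg (F : fieldType) (A B H x1 x2 y1 y2 s1 s2 s3 s4 p q h P M C D : F) :
  A != 0 -> B != 0 -> H != 0 ->
  s1 * s3 = - (x1 ^+ 2 * B ^+ 2 * (P - q)) -> s2 * s4 = - (x2 ^+ 2 * B ^+ 2 * (M - q)) ->
  s1 * s2 = - (y1 ^+ 2 * H ^+ 2 * (C - h)) -> s3 * s4 = - (y2 ^+ 2 * H ^+ 2 * (D - h)) ->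
  x1 * x2 = - (A ^+ 2 * H ^+ 2 * (p - h)) -> y1 * y2 = - (A ^+ 2 * B ^+ 2 * (p - q)) ->
  (P - q) * (M - q) * (p - h) ^+ 2 = (p - q) ^+ 2 * (C - h) * (D - h).
Proof.
move=> A0 B0 H0 e1 e2 e3 e4 e5 e6.
have N0 : A ^+ 4 * H ^+ 4 * B ^+ 4 != 0 by rewrite !mulf_neq0 ?expf_neq0.
apply: (mulfI N0).
transitivity ((x1 * x2) ^+ 2 * (B ^+ 4 * ((P - q) * (M - q)))); first by rewrite e5; ring.
transitivity ((y1 * y2) ^+ 2 * (H ^+ 4 * ((C - h) * (D - h)))); last by rewrite e6; ring.
transitivity ((s1 * s3) * (s2 * s4)); first by rewrite e1 e2; ring.
transitivity ((s1 * s2) * (s3 * s4)); first by ring.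
by rewrite e3 e4; ring.
Qed.

(** The relation of [quad_id], multiplied by h^2 and expressed through quantities that stay finite
    as h tends to 0: [t c] is H - c with the pole h^-2 removed. *)
Lemma sum_alg (F : fieldType) (h p q P M H C D : F) : h != 0 ->
  (P - q) * (M - q) * (p - H) ^+ 2 = (p - q) ^+ 2 * (C - H) * (D - H) ->
  let t c := h ^+ 2 * ((H - h ^- 2) / h ^+ 2) - c in
  ((p - q) * ((P + M - 2 * p) / h ^+ 2) - (P - p) / h * ((M - p) / - h)) * (1 + h ^+ 2 * t p) ^+ 2 +
    (p - q) ^+ 2 * (2 * t p + h ^+ 2 * t p ^+ 2) =
  (p - q) ^+ 2 * (t C + t D + h ^+ 2 * (t C * t D)).
Proof.
move=> h0 e t; apply/eqP; rewrite -subr_eq0; apply/eqP.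
have : h ^+ 2 * ((P - q) * (M - q) * (p - H) ^+ 2) - h ^+ 2 * ((p - q) ^+ 2 * (C - H) * (D - H)) = 0.
  by rewrite e subrr.
by move=> <-; rewrite /t; field; rewrite ?oppr_eq0 h0.
Qed.

Lemma ode_alg (F : fieldType) (b p d1 d2 A B C : F) : b != 0 ->
  let q := b ^- 2 + b ^+ 2 * A in let q1 := b * B - 2 * b ^- 3 in let q2 := 6 * b ^- 4 + C in
  2 * (p - q) ^+ 3 - (p - q) * (d2 + q2) + d1 ^+ 2 - q1 ^+ 2 = 0 ->
  d2 - 6 * p ^+ 2 + C + 4 * B + b ^+ 2 * (2 * p ^+ 3 - 6 * p ^+ 2 * b ^+ 2 * A + 12 * p * A + 6 * p * b ^+ 4 * A ^+ 2
    - 6 * b ^+ 2 * A ^+ 2 - 2 * b ^+ 6 * A ^+ 3 - p * d2 + d2 * b ^+ 2 * A - p * C + b ^+ 2 * A * C + d1 ^+ 2 - b ^+ 2 * B ^+ 2) = 0.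
Proof. by move=> b0 q q1 q2 /(congr1 (fun x => b ^+ 2 * x)); rewrite mulr0 => <-; rewrite /q /q1 /q2; field. Qed.

Lemma ode_rest_lim (A B C : CC -> CC) (p d1 d2 : CC) :
  (exists m, lim0 A m) -> (exists m, lim0 B m) -> (exists m, lim0 C m) ->
  exists m, lim0 (fun b => 2 * p ^+ 3 - 6 * p ^+ 2 * b ^+ 2 * A b + 12 * p * A b + 6 * p * b ^+ 4 * A b ^+ 2
    - 6 * b ^+ 2 * A b ^+ 2 - 2 * b ^+ 6 * A b ^+ 3 - p * d2 + d2 * b ^+ 2 * A b - p * C b + b ^+ 2 * A b * C b + d1 ^+ 2 - b ^+ 2 * B b ^+ 2) m.
Proof.
move=> hA hB hC.
have cM f g : (exists m, lim0 f m) -> (exists m, lim0 g m) -> exists m, lim0 (fun h => f h * g h) m.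
  by move=> [m hm] [n hn]; exists (m * n); exact: lim0M.
have cD f g : (exists m, lim0 f m) -> (exists m, lim0 g m) -> exists m, lim0 (fun h => f h + g h) m.
  by move=> [m hm] [n hn]; exists (m + n); exact: lim0D.
have cN f : (exists m, lim0 f m) -> exists m, lim0 (fun h => - f h) m.
  by move=> [m hm]; exists (- m); exact: lim0N.
have cX f n : (exists m, lim0 f m) -> exists m, lim0 (fun h => f h ^+ n) m.
  by move=> [m hm]; exists (m ^+ n); exact: lim0X.
have cC c : exists m, lim0 (fun=> c) m by exists c; exact: lim0C.
have ci : exists m, lim0 (fun h => h) m by exists 0; exact: lim0_id.
repeat lazymatch goal with
| |- ex (fun m => lim0 (fun _ => ?c) m) => exact: (cC c)
| |- ex (fun m => lim0 (fun b => b) m) => exact: ci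
| |- ex (fun m => lim0 (fun b => @?f b + @?g b) m) => apply: (cD f g)
| |- ex (fun m => lim0 (fun b => - @?f b) m) => apply: (cN f)
| |- ex (fun m => lim0 (fun b => @?f b * @?g b) m) => apply: (cM f g)
| |- ex (fun m => lim0 (fun b => @?f b ^+ ?n) m) => apply: (cX f n)
| |- _ => assumption
end.
Qed.

(** Applied to three pairs of collinear points, the addition formula for wp yields the claim and its
    analogue for q, both only up to sign. A wrong sign in the claim forces p1 = q1 under either sign
    of the analogue, and then the sign does not matter. *)
Lemma line_alg (F : fieldType) (p q C p1 q1 C1 : F) : (2 : F) != 0 -> p - q != 0 -> C - q != 0 -> C - p != 0 ->
  4 * (p - q) ^+ 2 * C = (p1 - q1) ^+ 2 - 4 * (p + q) * (p - q) ^+ 2 ->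
  4 * (C - q) ^+ 2 * p = (C1 + q1) ^+ 2 - 4 * (C + q) * (C - q) ^+ 2 ->
  4 * (C - p) ^+ 2 * q = (C1 + p1) ^+ 2 - 4 * (C + p) * (C - p) ^+ 2 ->
  (p - q) * (C1 + p1) = - ((p1 - q1) * (C - p)).
Proof.
move=> n2 d0 Cq Cp e1 e2 e3.
have s1 : ((p - q) * (C1 + q1)) ^+ 2 = ((p1 - q1) * (C - q)) ^+ 2.
  rewrite !exprMn.
  have -> : (C1 + q1) ^+ 2 = 4 * (C - q) ^+ 2 * p + 4 * (C + q) * (C - q) ^+ 2 by rewrite e2; ring.
  have -> : (p1 - q1) ^+ 2 = 4 * (p - q) ^+ 2 * C + 4 * (p + q) * (p - q) ^+ 2 by rewrite e1; ring.
  by ring.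
have s2 : ((p - q) * (C1 + p1)) ^+ 2 = ((p1 - q1) * (C - p)) ^+ 2.
  rewrite !exprMn.
  have -> : (C1 + p1) ^+ 2 = 4 * (C - p) ^+ 2 * q + 4 * (C + p) * (C - p) ^+ 2 by rewrite e3; ring.
  have -> : (p1 - q1) ^+ 2 = 4 * (p - q) ^+ 2 * C + 4 * (p + q) * (p - q) ^+ 2 by rewrite e1; ring.
  by ring.
move/eqP: s2; rewrite eqf_sqr => /orP[/eqP s2|/eqP //].
have m0 : p1 - q1 = 0.
  move/eqP: s1; rewrite eqf_sqr => /orP[/eqP s1|/eqP s1].
    have : 2 * (p - q) * (p1 - q1) = 0.
      have : (p - q) * (C1 + p1) - (p - q) * (C1 + q1) + (p - q) * (p1 - q1) = (p1 - q1) * (C - p) - (p1 - q1) * (C - q) + (p - q) * (p1 - q1) by rewrite s1 s2.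
      have -> : (p1 - q1) * (C - p) - (p1 - q1) * (C - q) + (p - q) * (p1 - q1) = 0 by ring.
      by move=> <-; ring.
    by move/eqP; rewrite !mulf_eq0 (negPf n2) (negPf d0) => /eqP.
  have : 2 * (C - p) * (p1 - q1) = 0.
    have : (p - q) * (C1 + p1) - (p - q) * (C1 + q1) - (p - q) * (p1 - q1) = (p1 - q1) * (C - p) + (p1 - q1) * (C - q) - (p - q) * (p1 - q1) by rewrite s1 s2 opprK.
    have -> : (p - q) * (C1 + p1) - (p - q) * (C1 + q1) - (p - q) * (p1 - q1) = 0 by ring.
    by move=> ->; ring.
  by move/eqP; rewrite !mulf_eq0 (negPf n2) (negPf Cp) => /eqP.
by rewrite s2 m0 !mul0r oppr0.
Qed.

Section Addition.
Variables (w1 w2 : CC).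
Hypothesis hi : indep w1 w2.
Local Notation sg := (wsigma w1 w2).
Local Notation p_ := (wp w1 w2).
Local Notation p' := (wp' w1 w2).
Local Notation p2 := (wp2 w1 w2).
Local Notation inL := (in_latt w1 w2).
Local Notation G := (G4 w1 w2).
Local Notation sA := (wsigma_addB w1 w2 hi).
Local Notation nz0 := (wsigma_neq0 w1 w2 hi).

Lemma wp_eq a b : ~ inL a -> ~ inL b -> (p_ a = p_ b <-> inL (a + b) \/ inL (a - b)).
Proof.
move=> ha hb; have e := sA a b ha hb; split.
  move=> pq; rewrite pq subrr mulr0 oppr0 in e; move/eqP: e; rewrite mulf_eq0.
  by move=> /orP[/eqP|/eqP] h; [left|right]; apply/(wsigma_eq0 _ _ hi).
move=> h; have z : sg (a + b) * sg (a - b) = 0.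
  by case: h => h; rewrite (wsigma_latt _ _ hi _ h) ?mulr0 ?mul0r.
apply/eqP; rewrite -subr_eq0; apply: contraT => n0.
have : sg a ^+ 2 * sg b ^+ 2 * (p_ a - p_ b) != 0 by rewrite !mulf_neq0 ?expf_neq0 ?nz0.
by rewrite -[_ * _]opprK -e z oppr0 eqxx.
Qed.

(** The product formula for a and a - h, divided by h, as h tends to 0. *)
Lemma wsigma_dbl a : ~ inL a -> sg (2 * a) = - (sg a ^+ 4 * p' a).
Proof.
move=> ha; have [l1 _ _] := wp_lim _ _ hi _ ha.
have L := lim0M _ _ _ _ (lim0_neg _ _ (lim0_hol _ _ (wsigma_hol _ _ hi (2 * a)))) (lim0_hol _ _ (sig0_hol _ _ hi 0)).
rewrite sig0_0 // mulr1 in L.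
have M := lim0M _ _ _ _ (lim0C (- sg a ^+ 2)) (lim0M _ _ _ _ (lim0X _ _ 2 (lim0_neg _ _ (lim0_hol _ _ (wsigma_hol _ _ hi a)))) (lim0_neg _ _ l1)).
have -> : - (sg a ^+ 4 * p' a) = - sg a ^+ 2 * (sg a ^+ 2 * p' a) by ring.
apply: lim0_eq L M _.
apply: near0_imp (near0_notinN _ _ hi _ ha) => h h0 hl.
have := sA a (a - h) ha hl.
have -> : a + (a - h) = 2 * a + - h by ring.
have -> : a - (a - h) = h by ring.
rewrite (wsigma_sig0 _ _ hi h) add0r => e; apply: (mulIf h0).
have -> : sg (2 * a + - h) * sig0 w1 w2 h * h = sg (2 * a + - h) * (h * sig0 w1 w2 h) by ring.
by rewrite e; field.
Qed.

Lemma quad_id a b h : ~ inL a -> ~ inL b -> ~ inL h -> ~ inL (a + h) -> ~ inL (a - h) ->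
  ~ inL (a + b) -> ~ inL (a - b) ->
  (p_ (a + h) - p_ b) * (p_ (a - h) - p_ b) * (p_ a - p_ h) ^+ 2 =
  (p_ a - p_ b) ^+ 2 * (p_ (a + b) - p_ h) * (p_ (a - b) - p_ h).
Proof.
move=> ha hb hh hp hm bp bm.
have e1 := sA (a + h) b hp hb; have e2 := sA (a - h) b hm hb.
have e3 := sA (a + b) h bp hh; have e4 := sA (a - b) h bm hh.
have e5 := sA a h ha hh; have e6 := sA a b ha hb.
have q1 : a + h + b = a + b + h by ring.
have q2 : a + h - b = a - b + h by ring.
have q3 : a - h + b = a + b - h by ring.
have q4 : a - h - b = a - b - h by ring.
rewrite q1 q2 in e1; rewrite q3 q4 in e2.
have A0 := nz0 _ ha; have B0 := nz0 _ hb; have H0 := nz0 _ hh.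
exact: (quad_alg _ _ _ _ _ _ _ _ _ _ _ _ _ _ _ _ _ _ _ A0 B0 H0 e1 e2 e3 e4 e5 e6).
Qed.

(** The limit of [quad_id] as h tends to 0: the second difference quotient of wp at a and the
    product of its two one-sided first quotients survive. *)
Lemma wp_sum a b : ~ inL a -> ~ inL b -> p_ a <> p_ b ->
  (p_ a - p_ b) ^+ 2 * (p_ (a + b) + p_ (a - b)) =
  2 * p_ a * (p_ a - p_ b) ^+ 2 - (p_ a - p_ b) * p2 a + p' a ^+ 2.
Proof.
move=> ha hb pq.
have [bp bm] : ~ inL (a + b) /\ ~ inL (a - b).
  by split => h; apply: pq; apply/wp_eq => //; [left|right].
have [l1 l2 _] := wp_lim _ _ hi _ ha; have [m1 _ _] := wp_lim0 _ _ hi.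
have l1' := lim0_neg _ _ l1.
pose U h := (p_ a - p_ b) * ((p_ (a + h) + p_ (a - h) - 2 * p_ a) / h ^+ 2)
   - (p_ (a + h) - p_ a) / h * ((p_ (a + - h) - p_ a) / - h).
have LU : lim0 U ((p_ a - p_ b) * p2 a - p' a * p' a).
  by apply: lim0B; [apply: lim0M l2; exact: lim0C|exact: lim0M].
have Lh2 : lim0 (fun h => h ^+ 2) 0 by have := lim0X id 0 2 lim0_id; rewrite expr0n.
pose t c h := h ^+ 2 * ((p_ h - h ^- 2) / h ^+ 2) - c.
have Lt c : lim0 (t c) (- c).
  rewrite -(sub0r c) -(mul0r (3 * G)); apply: lim0B; last exact: lim0C.
  exact: lim0M.
have L1 := lim0D _ _ _ _ (lim0M _ _ _ _ LU (lim0X _ _ 2 (lim0D _ _ _ _ (lim0C 1) (lim0M _ _ _ _ Lh2 (Lt (p_ a))))))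
   (lim0M _ _ _ _ (lim0C ((p_ a - p_ b) ^+ 2)) (lim0D _ _ _ _ (lim0M _ _ _ _ (lim0C 2) (Lt (p_ a))) (lim0M _ _ _ _ Lh2 (lim0X _ _ 2 (Lt (p_ a)))))).
have L2 := lim0M _ _ _ _ (lim0C ((p_ a - p_ b) ^+ 2))
   (lim0D _ _ _ _ (lim0D _ _ _ _ (Lt (p_ (a + b))) (Lt (p_ (a - b)))) (lim0M _ _ _ _ Lh2 (lim0M _ _ _ _ (Lt (p_ (a + b))) (Lt (p_ (a - b)))))).
have eis : near0 (fun h => U h * (1 + h ^+ 2 * t (p_ a) h) ^+ 2 +
    (p_ a - p_ b) ^+ 2 * (2 * t (p_ a) h + h ^+ 2 * t (p_ a) h ^+ 2) =
    (p_ a - p_ b) ^+ 2 * (t (p_ (a + b)) h + t (p_ (a - b)) h + h ^+ 2 * (t (p_ (a + b)) h * t (p_ (a - b)) h))).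
  apply: near0_imp (near0_and _ _ (near0_lat _ _ hi) (near0_and _ _ (near0_notin _ _ hi _ ha) (near0_notinN _ _ hi _ ha))).
  move=> h h0 [hl [hp hm]]; have e := quad_id _ _ _ ha hb hl hp hm bp bm.
  by apply: sum_alg e.
have e := lim0_eq _ _ _ _ L1 L2 eis.
move: e; rewrite !mul0r !addr0 expr1n mulr1 => e.
have -> : (p_ a - p_ b) ^+ 2 * (p_ (a + b) + p_ (a - b)) = - ((p_ a - p_ b) ^+ 2 * (- p_ (a + b) - p_ (a - b))) by ring.
by rewrite -e; ring.
Qed.

(** The left side of [wp_sum] is symmetric in a and b, since wp is even; so its right side is
    too. *)
Lemma wp2_sub a b : ~ inL a -> ~ inL b -> p_ a <> p_ b ->
  2 * (p_ a - p_ b) ^+ 3 - (p_ a - p_ b) * (p2 a + p2 b) + p' a ^+ 2 - p' b ^+ 2 = 0.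
Proof.
move=> ha hb pq; have e1 := wp_sum _ _ ha hb pq.
have e2 := wp_sum _ _ hb ha (fun e => pq (esym e)).
have bm : ~ inL (a - b) by move=> h; apply: pq; apply/wp_eq => //; right.
have ev : p_ (b - a) = p_ (a - b) by rewrite -opprB wp_even.
rewrite ev [b + a]addrC in e2.
move: e1 e2; move: (p_ a) (p_ b) (p' a) (p' b) (p2 a) (p2 b) (p_ (a + b)) (p_ (a - b)) => p q p1 q1 pp qq C D e1 e2.
have : (p - q) ^+ 2 * (C + D) - (q - p) ^+ 2 * (C + D) = 0 by ring.
by rewrite e1 e2 => <-; ring.
Qed.

Lemma near0_wp_neq a : ~ inL a -> near0 (fun h => p_ a <> p_ h).
Proof.
move=> ha.
apply: near0_imp (near0_and _ _ (near0_lat _ _ hi) (near0_and _ _ (near0_notin _ _ hi _ ha) (near0_notinN _ _ hi _ ha))).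
by move=> h h0 [hl [hp hm]] pq; case: (proj1 (wp_eq _ _ ha hl) pq).
Qed.

(** The limit of [wp2_sub] as b tends to 0; 30 G4 is g2 / 2. *)
Lemma wp2_ode a : ~ inL a -> p2 a = 6 * p_ a ^+ 2 - 30 * G.
Proof.
move=> ha; have [lA lB lC] := wp_lim0 _ _ hi.
have L0 : lim0 (fun h => h ^+ 2) 0 by have := lim0X id 0 2 lim0_id; rewrite expr0n.
set A := (fun h => _) in lA; set B := (fun h => _) in lB; set C := (fun h => _) in lC.
pose p := p_ a; pose d1 := p' a; pose d2 := p2 a.
have [m hm] := ode_rest_lim _ _ _ p d1 d2 (ex_intro _ _ lA) (ex_intro _ _ lB) (ex_intro _ _ lC).
have L := lim0D _ _ _ _ (lim0D _ _ _ _ (lim0D _ _ _ _ (lim0C (d2 - 6 * p ^+ 2)) lC) (lim0M _ _ _ _ (lim0C 4) lB)) (lim0M _ _ _ _ L0 hm).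
have e : d2 - 6 * p ^+ 2 + 6 * G + 4 * (6 * G) + 0 * m = 0.
  apply: lim0_eq L (lim0C 0) _.
  apply: near0_imp (near0_and _ _ (near0_lat _ _ hi) (near0_wp_neq a ha)) => h h0 [hl pq].
  apply: ode_alg => //.
  have -> : h ^- 2 + h ^+ 2 * A h = p_ h by rewrite /A; field.
  have -> : h * B h - 2 * h ^- 3 = p' h by rewrite /B; field.
  have -> : 6 * h ^- 4 + C h = p2 h by rewrite /C; ring.
  exact: wp2_sub.
have -> : p2 a = (d2 - 6 * p ^+ 2 + 6 * G + 4 * (6 * G) + 0 * m) + 6 * p_ a ^+ 2 - 30 * G by rewrite /d2 /p; ring.
by rewrite e add0r.
Qed.

Lemma wp_latt_eq a b : ~ inL a -> ~ inL b -> inL (a - b) -> p_ a = p_ b /\ p' a = p' b.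
Proof.
by move=> ha hb h; rewrite -(subrK b a) addrC wp_per // wp'_per.
Qed.

Lemma wp_lattN_eq a b : ~ inL a -> ~ inL b -> inL (a + b) -> p_ a = p_ b /\ p' a = - p' b.
Proof.
move=> ha hb h; have hb' : ~ inL (- b) by move/in_lattN.
have [|-> ->] := wp_latt_eq a (- b) ha hb'; first by rewrite opprK.
by rewrite wp_even // wp'_odd.
Qed.

(** The first integral of the differential equation, found without integrating: inserting [wp2_ode]
    into [wp2_sub] leaves exactly the difference of the two sides. It is undivided, so no sign of
    wp' has to be chosen. *)
Lemma wp_cubic_const a b : ~ inL a -> ~ inL b ->
  p' a ^+ 2 - 4 * p_ a ^+ 3 + 60 * G * p_ a = p' b ^+ 2 - 4 * p_ b ^+ 3 + 60 * G * p_ b.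
Proof.
move=> ha hb; have [pq|pq] := pselect (p_ a = p_ b).
  case: (proj1 (wp_eq _ _ ha hb) pq) => h.
    by have [-> ->] := wp_lattN_eq _ _ ha hb h; rewrite sqrrN.
  by have [-> ->] := wp_latt_eq _ _ ha hb h.
have := wp2_sub _ _ ha hb pq; rewrite !wp2_ode //.
move: (p_ a) (p_ b) (p' a) (p' b) => p q p1 q1 e.
by apply/eqP; rewrite -subr_eq0; apply/eqP; rewrite -e; ring.
Qed.

(** The product formula for the pair a + b, a - b involves sigma(2a) sigma(2b), which [wsigma_dbl]
    evaluates. *)
Lemma wp_diff a b : ~ inL a -> ~ inL b -> p_ a <> p_ b ->
  (p_ a - p_ b) ^+ 2 * (p_ (a + b) - p_ (a - b)) = - (p' a * p' b).
Proof.
move=> ha hb pq.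
have [bp bm] : ~ inL (a + b) /\ ~ inL (a - b).
  by split => h; apply: pq; apply/wp_eq => //; [left|right].
have e1 := sA _ _ bp bm; have e2 := sA _ _ ha hb.
have q1 : a + b + (a - b) = 2 * a by ring.
have q2 : a + b - (a - b) = 2 * b by ring.
rewrite q1 q2 !wsigma_dbl // in e1.
have A0 := nz0 _ ha; have B0 := nz0 _ hb.
have N0 : sg a ^+ 4 * sg b ^+ 4 != 0 by rewrite !mulf_neq0 ?expf_neq0.
move: N0 e1 e2; move: (sg a) (sg b) (sg (a + b)) (sg (a - b)) (p_ a) (p_ b) (p' a) (p' b) (p_ (a + b)) (p_ (a - b)).
move=> A B C D p q p1 q1' P M N0 e1 e2; apply: (mulfI N0).
have -> : A ^+ 4 * B ^+ 4 * ((p - q) ^+ 2 * (P - M)) = (- (A ^+ 2 * B ^+ 2 * (p - q))) ^+ 2 * (P - M) by ring.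
rewrite -e2 exprMn.
have -> : C ^+ 2 * D ^+ 2 * (P - M) = - (- (C ^+ 2 * D ^+ 2 * (P - M))) by ring.
by rewrite -e1; ring.
Qed.

Lemma wp_addE a b : ~ inL a -> ~ inL b -> p_ a <> p_ b ->
  4 * (p_ a - p_ b) ^+ 2 * p_ (a + b) = (p' a - p' b) ^+ 2 - 4 * (p_ a + p_ b) * (p_ a - p_ b) ^+ 2.
Proof.
move=> ha hb pq; have e1 := wp_sum _ _ ha hb pq; have e2 := wp2_sub _ _ ha hb pq; have e3 := wp_diff _ _ ha hb pq.
rewrite !wp2_ode // in e1 e2.
move: e1 e2 e3; move: (p_ a) (p_ b) (p' a) (p' b) (p_ (a + b)) (p_ (a - b)) => p q p1 q1 P M e1 e2 e3.
have -> : 4 * (p - q) ^+ 2 * P = 2 * ((p - q) ^+ 2 * (P + M)) + 2 * ((p - q) ^+ 2 * (P - M)) by ring.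
rewrite e1 e3; apply/eqP; rewrite -subr_eq0; apply/eqP.
by rewrite -e2; ring.
Qed.

(** [line_alg] applied to a, b and -(a+b). If wp(a+b) equals wp(a) or wp(b), the points differ by
    sign and a period, and the claim is checked directly. *)
Lemma wp'_addE a b : ~ inL a -> ~ inL b -> p_ a <> p_ b ->
  (p_ a - p_ b) * (p' (a + b) + p' a) = - ((p' a - p' b) * (p_ (a + b) - p_ a)).
Proof.
move=> ha hb pq.
have bp : ~ inL (a + b) by move=> h; apply: pq; apply/wp_eq => //; left.
have nb : ~ inL (- b) by move/in_lattN.
have na : ~ inL (- a) by move/in_lattN.
have [Cq|Cq] := pselect (p_ (a + b) = p_ b).
  case: (proj1 (wp_eq _ _ bp hb) Cq) => h; last by exfalso; apply: ha; move: h; rewrite addrK.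
  by have [-> ->] := wp_lattN_eq _ _ bp hb h; ring.
have [Cp|Cp] := pselect (p_ (a + b) = p_ a).
  case: (proj1 (wp_eq _ _ bp ha) Cp) => h; last by exfalso; apply: hb; move: h; rewrite addrAC subrr add0r.
  by have [-> ->] := wp_lattN_eq _ _ bp ha h; ring.
have e1 := wp_addE _ _ ha hb pq.
have e2 := wp_addE (a + b) (- b) bp nb.
have e3 := wp_addE (a + b) (- a) bp na.
have q2 : a + b - a = b by ring.
rewrite wp_even // wp'_odd // addrK in e2; rewrite wp_even // wp'_odd // q2 in e3.
apply: line_alg e1 _ _; rewrite ?pnatr_eq0 ?subr_eq0 //; try by apply/eqP.
  by rewrite e2 // opprK.
by rewrite e3 // opprK.
Qed.

Lemma lim0_wp' a : ~ inL a -> lim0 (fun h => p' (a + h)) (p' a).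
Proof.
move=> ha; have [_ _ l] := wp_lim _ _ hi _ ha.
have := lim0D _ _ _ _ (lim0C (p' a)) (lim0M _ _ _ _ lim0_id l); rewrite mul0r addr0.
by apply: lim0_ext; exists 1 => // h h0 _; field.
Qed.

Lemma dbl_notin_latt a : ~ inL a -> p' a != 0 -> ~ inL (2 * a).
Proof.
move=> ha h0 /(wsigma_latt _ _ hi); rewrite wsigma_dbl // => /eqP.
by rewrite oppr_eq0 mulf_eq0 expf_eq0 /= (negPf (nz0 _ ha)) (negPf h0).
Qed.

(** The addition formulas for a and a + h, divided by the appropriate power of h, as h tends to
    0. *)
Lemma wp_dblE a : ~ inL a -> p' a != 0 ->
  4 * p' a ^+ 2 * p_ (2 * a) = p2 a ^+ 2 - 8 * p_ a * p' a ^+ 2 /\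
  p' a * (p' (2 * a) + p' a) = - (p2 a * (p_ (2 * a) - p_ a)).
Proof.
move=> ha n0; have h2 := dbl_notin_latt _ ha n0.
have [l1 _ l2] := wp_lim _ _ hi _ ha.
have lp := lim0_hol _ _ (wp_hol _ _ hi _ h2); have lp' := lim0_wp' _ h2.
have la := lim0_hol _ _ (wp_hol _ _ hi _ ha).
have N : near0 (fun h => [/\ ~ inL (a + h), p_ a <> p_ (a + h) & a + (a + h) = 2 * a + h]).
  apply: near0_imp (near0_and _ _ (near0_notin _ _ hi _ ha) (near0_and _ _ (near0_lat _ _ hi) (near0_notin _ _ hi _ h2))).
  move=> h h0 [i1 [i3 i2]]; have e : a + (a + h) = 2 * a + h by ring.
  split => // pq; case: (proj1 (wp_eq _ _ ha i1) pq); first by rewrite e.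
  have -> : a - (a + h) = - h by ring.
  by move/in_lattN.
split.
  have L := lim0M _ _ _ _ (lim0M _ _ _ _ (lim0C 4) (lim0X _ _ 2 l1)) lp.
  have M := lim0B _ _ _ _ (lim0X _ _ 2 l2) (lim0M _ _ _ _ (lim0M _ _ _ _ (lim0C 4) (lim0D _ _ _ _ (lim0C (p_ a)) la)) (lim0X _ _ 2 l1)).
  have -> : 8 * p_ a * p' a ^+ 2 = 4 * (p_ a + p_ a) * p' a ^+ 2 by ring.
  apply: lim0_eq L M _; apply: near0_imp N => h h0 [i1 pq e].
  have := wp_addE _ _ ha i1 pq; rewrite e.
  move: (p_ a) (p_ (a + h)) (p' a) (p' (a + h)) (p_ (2 * a + h)) => p q p1 q1 C eis.
  have -> : 4 * ((q - p) / h) ^+ 2 * C = (4 * (p - q) ^+ 2 * C) / h ^+ 2 by field.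
  by rewrite eis; field.
have L := lim0M _ _ _ _ l1 (lim0D _ _ _ _ lp' (lim0C (p' a))).
have M := lim0N _ _ (lim0M _ _ _ _ l2 (lim0B _ _ _ _ lp (lim0C (p_ a)))).
apply: lim0_eq L M _; apply: near0_imp N => h h0 [i1 pq e].
have := wp'_addE _ _ ha i1 pq; rewrite e.
move: (p_ a) (p_ (a + h)) (p' a) (p' (a + h)) (p_ (2 * a + h)) (p' (2 * a + h)) => p q p1 q1 C C1 eis.
have -> : (q - p) / h * (C1 + p1) = - ((p - q) * (C1 + p1)) / h by field.
by rewrite eis; field.
Qed.
End Addition.

(** * Uniformization of the curve *)

Lemma chord_alg (F : fieldType) (a1 a2 a3 c x1 y1 x2 y2 p q p1 q1 C C1 : F) : (2 : F) != 0 -> (3 : F) != 0 ->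
  12 * c = a1 ^+ 2 + 4 * a2 -> x1 = p - c -> x2 = q - c -> y1 = (p1 - a1 * x1 - a3) / 2 -> y2 = (q1 - a1 * x2 - a3) / 2 ->
  x1 != x2 ->
  4 * (p - q) ^+ 2 * C = (p1 - q1) ^+ 2 - 4 * (p + q) * (p - q) ^+ 2 ->
  (p - q) * (C1 + p1) = - ((p1 - q1) * (C - p)) ->
  let l := (y2 - y1) / (x2 - x1) in let n := (y1 * x2 - y2 * x1) / (x2 - x1) in
  let x3 := l ^+ 2 + a1 * l - a2 - x1 - x2 in
  x3 = C - c /\ - (l + a1) * x3 - n - a3 = (C1 - a1 * x3 - a3) / 2.
Proof.
move=> n2 n3 hc ex1 ex2 ey1 ey2 nx eC eC1 l n x3.
have d0 : p - q != 0.
  have -> : p - q = x1 - x2 by rewrite ex1 ex2; ring.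
  by rewrite subr_eq0.
have d0' : q - p != 0 by rewrite -opprB oppr_eq0.
have n4 : (4 : F) != 0 by rewrite (_ : (4 : F) = 2 * 2) ?mulf_neq0 //; ring.
have ha2 : a2 = (12 * c - a1 ^+ 2) / 4 by rewrite hc; field.
have x2x1 : x2 - x1 = q - p by rewrite ex1 ex2; ring.
have CE : C = ((p1 - q1) / (2 * (p - q))) ^+ 2 - p - q.
  have n0 : 4 * (p - q) ^+ 2 != 0 by rewrite mulf_neq0 ?expf_neq0.
  by apply: (mulfI n0); rewrite eC; field; rewrite n2 d0.
have C1E : C1 = - p1 - (p1 - q1) / (p - q) * (C - p).
  by apply: (mulfI d0); have -> : (p - q) * C1 = (p - q) * (C1 + p1) - (p - q) * p1; [ring|rewrite eC1; field].
have lE : l = (p1 - q1) / (2 * (p - q)) - a1 / 2.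
  by rewrite /l x2x1 ey1 ey2 ex1 ex2; field; rewrite n2 d0 d0'.
have e3 : x3 = C - c by rewrite /x3 lE CE ex1 ex2 ha2; field; rewrite n2 d0 n4.
split => //; rewrite e3.
have nE : n = y1 - l * x1 by rewrite /n /l; field; rewrite subr_eq0 eq_sym.
by rewrite nE lE C1E ey1 ex1; field; rewrite n2 d0.
Qed.

(** Here [c] is b2/12 and [g] is g2/4, so that [48 * g] is c4 and [6 * p ^+ 2 - 2 * g] is the second
    derivative of wp. *)
Lemma tangent_alg (F : fieldType) (a1 a2 a3 a4 a6 c g x y p p1 C C1 : F) : (2 : F) != 0 -> (3 : F) != 0 ->
  12 * c = a1 ^+ 2 + 4 * a2 -> 48 * g = (a1 ^+ 2 + 4 * a2) ^+ 2 - 24 * (2 * a4 + a1 * a3) ->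
  x = p - c -> y = (p1 - a1 * x - a3) / 2 -> p1 != 0 ->
  y ^+ 2 + a1 * x * y + a3 * y = x ^+ 3 + a2 * x ^+ 2 + a4 * x + a6 ->
  4 * p1 ^+ 2 * C = (6 * p ^+ 2 - 2 * g) ^+ 2 - 8 * p * p1 ^+ 2 ->
  p1 * (C1 + p1) = - ((6 * p ^+ 2 - 2 * g) * (C - p)) ->
  let l := (3 * x ^+ 2 + 2 * a2 * x + a4 - a1 * y) / (2 * y + a1 * x + a3) in
  let n := (- x ^+ 3 + a4 * x + 2 * a6 - a3 * y) / (2 * y + a1 * x + a3) in
  let x3 := l ^+ 2 + a1 * l - a2 - x - x in
  x3 = C - c /\ - (l + a1) * x3 - n - a3 = (C1 - a1 * x3 - a3) / 2.
Proof.
move=> n2 n3 hc hg ex ey n1 cv eC eC1 l n x3.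
have n4 : (4 : F) != 0 by rewrite (_ : (4 : F) = 2 * 2) ?mulf_neq0 //; ring.
have n12 : (12 : F) != 0 by rewrite (_ : (12 : F) = 4 * 3) ?mulf_neq0 //; ring.
have n48 : (48 : F) != 0 by rewrite (_ : (48 : F) = 4 * 12) ?mulf_neq0 //; ring.
have ha2 : a2 = (12 * c - a1 ^+ 2) / 4 by rewrite hc; field.
have ha4 : a4 = ((144 * c ^+ 2 - 48 * g) / 24 - a1 * a3) / 2.
  have n24 : (24 : F) != 0 by rewrite (_ : (24 : F) = 2 * 12) ?mulf_neq0 //; ring.
  have -> : 144 * c ^+ 2 = (12 * c) ^+ 2 by ring.
  by rewrite hg hc; field; rewrite n2 n24.
have dE : 2 * y + a1 * x + a3 = p1 by rewrite ey; field.
have CE : C = ((6 * p ^+ 2 - 2 * g) / (2 * p1)) ^+ 2 - 2 * p.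
  have n0 : 4 * p1 ^+ 2 != 0 by rewrite mulf_neq0 ?expf_neq0.
  by apply: (mulfI n0); rewrite eC; field; rewrite n2 n1.
have C1E : C1 = - p1 - (6 * p ^+ 2 - 2 * g) / p1 * (C - p).
  by apply: (mulfI n1); have -> : p1 * C1 = p1 * (C1 + p1) - p1 * p1; [ring|rewrite eC1; field].
have n24 : (24 : F) != 0 by rewrite (_ : (24 : F) = 2 * 12) ?mulf_neq0 //; ring.
have lE : l = (6 * p ^+ 2 - 2 * g) / (2 * p1) - a1 / 2.
  by rewrite /l dE ey ex ha4 ha2; field; rewrite ?n2 ?n1 ?n4 ?n24.
have e3 : x3 = C - c by rewrite /x3 lE CE ex ha2; field; rewrite n2 n1 n4.
split => //; rewrite e3.
have nE : n = y - l * x.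
  apply: (mulIf n1); rewrite /n /l dE divfK //.
  have -> : (y - (3 * x ^+ 2 + 2 * a2 * x + a4 - a1 * y) / p1 * x) * p1 =
    y * p1 - (3 * x ^+ 2 + 2 * a2 * x + a4 - a1 * y) * x by field.
  have -> : 2 * a6 = 2 * (y ^+ 2 + a1 * x * y + a3 * y - x ^+ 3 - a2 * x ^+ 2 - a4 * x) by rewrite cv; ring.
  by rewrite -dE; ring.
by rewrite nE lE C1E ey ex; field; rewrite n2 n1.
Qed.

Lemma ec_add_chord E x1 y1 x2 y2 : x1 != x2 ->
  ec_add E (EPt x1 y1) (EPt x2 y2) =
  let l := (y2 - y1) / (x2 - x1) in let n := (y1 * x2 - y2 * x1) / (x2 - x1) in
  let x3 := l ^+ 2 + (a1 E)%:~R * l - (a2 E)%:~R - x1 - x2 in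
  EPt x3 (- (l + (a1 E)%:~R) * x3 - n - (a3 E)%:~R).
Proof. by move=> /negPf nx; rewrite /ec_add nx. Qed.

Lemma ec_add_tangent E x y1 y : y1 + y + (a1 E)%:~R * x + (a3 E)%:~R != 0 ->
  ec_add E (EPt x y1) (EPt x y) =
  let l := (3 * x ^+ 2 + 2 * (a2 E)%:~R * x + (a4 E)%:~R - (a1 E)%:~R * y1) / (2 * y1 + (a1 E)%:~R * x + (a3 E)%:~R) in
  let n := (- x ^+ 3 + (a4 E)%:~R * x + 2 * (a6 E)%:~R - (a3 E)%:~R * y1) / (2 * y1 + (a1 E)%:~R * x + (a3 E)%:~R) in
  let x3 := l ^+ 2 + (a1 E)%:~R * l - (a2 E)%:~R - x - x in
  EPt x3 (- (l + (a1 E)%:~R) * x3 - n - (a3 E)%:~R).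
Proof. by move=> /negPf ny; rewrite /ec_add eqxx ny. Qed.

Lemma ec_add_opp E x y1 y : y1 + y + (a1 E)%:~R * x + (a3 E)%:~R = 0 -> ec_add E (EPt x y1) (EPt x y) = EInf.
Proof. by move=> /eqP e; rewrite /ec_add eqxx e. Qed.

Section Unif.
Variables (E : wcoef) (w1 w2 : CC).
Hypothesis hp : period_basis E w1 w2.
Local Notation p_ := (wp w1 w2).
Local Notation p' := (wp' w1 w2).
Local Notation inL := (in_latt w1 w2).
Local Notation cor := (corresponds E w1 w2).

Lemma period_indep : indep w1 w2.
Proof. by case: hp. Qed.

Lemma CC2_neq0 : (2 : CC) != 0. Proof. by rewrite pnatr_eq0. Qed.
Lemma CC3_neq0 : (3 : CC) != 0. Proof. by rewrite pnatr_eq0. Qed.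

Lemma b2_div12 : 12 * ((b2 E)%:~R / 12) = (a1 E)%:~R ^+ 2 + 4 * (a2 E)%:~R :> CC.
Proof.
rewrite mulrC divfK ?pnatr_eq0 // /b2 rmorphD rmorphXn rmorphM /=.
by congr (_ + _ * _); rewrite -[4]/(4%:~R) .
Qed.

Lemma G4_c4 : 48 * (15 * G4 w1 w2) = ((a1 E)%:~R ^+ 2 + 4 * (a2 E)%:~R) ^+ 2
   - 24 * (2 * (a4 E)%:~R + (a1 E)%:~R * (a3 E)%:~R) :> CC.
Proof.
case: hp => _ [g2 _]; rewrite g2LE -/(G4 w1 w2) in g2.
have -> : 48 * (15 * G4 w1 w2) = 12 * (60 * G4 w1 w2) by ring.
rewrite g2 fmorph_div /= ratr_int -[12 in X in _ / X]/(12%:R) ratr_nat mulrC divfK ?pnatr_eq0 //.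
by rewrite /c4 /b2 /b4 !(rmorphB, rmorphD, rmorphM, rmorphXn) /=.
Qed.

Lemma cor_latt z w P : cor z P -> inL w -> cor (z + w) P.
Proof.
case: P => [|x y] /=; first exact: in_lattD.
move=> [hz [hx hy]] hw; split; first exact: notin_lattD.
by rewrite wp_per ?wp'_per //; exact: period_indep.
Qed.

Lemma cor_neg z P : cor z P -> cor (- z) (ec_neg E P).
Proof.
case: P => [|x y] /=; first by move/in_lattN.
move=> [hz [hx hy]]; split; first by move/in_lattN.
rewrite wp_even ?wp'_odd //; try exact: period_indep; split => //.
rewrite !(rmorphB, rmorphN, rmorphM) /= !ratr_int hy.
by field.
Qed.

Lemma cor_uniq z P Q : cor z P -> cor z Q -> P = Q.
Proof.
case: P => [|x y]; case: Q => [|x' y'] //=.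
- by move=> h [].
- by move=> [h _] /h.
move=> [_ [hx hy]] [_ [hx' hy']].
have ex : x = x' by apply: (fmorph_inj (ratr : {rmorphism rat -> CC})); rewrite /= hx hx'.
congr (EPt _ _) => //; apply: (fmorph_inj (ratr : {rmorphism rat -> CC})).
by rewrite /= hy hy' ex.
Qed.

(** By [wp_eq] the branches of [ec_add] correspond to different values of wp, to z1 + z2 in the
    lattice, and to z1 - z2 in the lattice. The curve equation enters in the tangent case, where the
    intercept contains a6. *)
Lemma cor_add z1 z2 P1 P2 : on_curve E P1 -> cor z1 P1 -> cor z2 P2 -> cor (z1 + z2) (ec_add E P1 P2).
Proof.
move=> oc; case: P1 oc => [|x1 y1] oc h1 h2; first by rewrite addrC; exact: cor_latt.
case: P2 h2 => [|x2 y2] h2; first exact: cor_latt.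
have i := period_indep.
case: (h1) => l1 [hx1 hy1]; case: (h2) => l2 [hx2 hy2].
have pE : p_ z1 = ratr x1 + (b2 E)%:~R / 12 by rewrite hx1 subrK.
have qE : p_ z2 = ratr x2 + (b2 E)%:~R / 12 by rewrite hx2 subrK.
have p'E : p' z1 = ratr (2 * y1 + (a1 E)%:~R * x1 + (a3 E)%:~R).
  by rewrite 2!rmorphD 2!rmorphM /= !ratr_int ratr_nat hy1; field.
have q'E : p' z2 = ratr (2 * y2 + (a1 E)%:~R * x2 + (a3 E)%:~R).
  by rewrite 2!rmorphD 2!rmorphM /= !ratr_int ratr_nat hy2; field.
have [ex|nx] := eqVneq x1 x2; last first.
  have pq : p_ z1 <> p_ z2.
    by rewrite pE qE => /addIr /(fmorph_inj (ratr : {rmorphism rat -> CC})); apply/eqP.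
  have nr : ratr x1 != ratr x2 :> CC by rewrite (inj_eq (fmorph_inj _)).
  have l3 : ~ inL (z1 + z2) by move=> h; apply: pq; apply/wp_eq => //; left.
  have [e1 e2] := chord_alg _ _ _ _ _ _ _ _ _ _ _ _ _ _ _ CC2_neq0 CC3_neq0 b2_div12 hx1 hx2 hy1 hy2 nr
    (wp_addE _ _ i _ _ l1 l2 pq) (wp'_addE _ _ i _ _ l1 l2 pq).
  rewrite ec_add_chord //; split; first by [].
  split; first by rewrite -e1 !(rmorphB, rmorphD, rmorphN, rmorphM, rmorphXn, fmorphV) /= !ratr_int.
  by rewrite !(rmorphB, rmorphD, rmorphN, rmorphM, rmorphXn, fmorphV) /= !ratr_int; exact: e2.
have epq : p_ z1 = p_ z2 by rewrite pE qE ex.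
have neg : p' z1 + p' z2 = 2 * ratr (y1 + y2 + (a1 E)%:~R * x2 + (a3 E)%:~R).
  by rewrite p'E q'E -rmorphD -[2 in RHS](ratr_nat CC 2) -rmorphM ex; congr (ratr _); ring.
have dup_in z : ~ inL z -> p' z = 0 -> inL (z + z).
  by move=> hz h0; apply/(wsigma_eq0 _ _ i); rewrite -mulr2n -mulr_natl wsigma_dbl // h0 mulr0 oppr0.
rewrite ex; have [e0|n0] := eqVneq (y1 + y2 + (a1 E)%:~R * x2 + (a3 E)%:~R) 0.
  rewrite ec_add_opp //=.
  (* If it is z1 - z2 that is a period, then wp' vanishes at z1, so 2 z1 and with it z1 + z2 is a
     period too. *)
  case: (proj1 (wp_eq _ _ i _ _ l1 l2) epq) => // hm.
  have [_ e] := wp_latt_eq _ _ i _ _ l1 l2 hm.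
  have h0 : p' z1 = 0.
    move/eqP: neg; rewrite e0 raddf0 mulr0 -e -mulr2n -mulr_natl mulf_eq0 (negPf CC2_neq0) => /eqP //.
  have -> : z1 + z2 = (z1 + z1) - (z1 - z2) by ring.
  by apply: in_lattB => //; exact: dup_in.
have hm : inL (z1 - z2).
  case: (proj1 (wp_eq _ _ i _ _ l1 l2) epq) => // hs; exfalso.
  have [_ e] := wp_lattN_eq _ _ i _ _ l1 l2 hs.
  move/esym/eqP: neg; rewrite e addNr mulf_eq0 (negPf CC2_neq0) /= fmorph_eq0 (negPf n0) //.
have [_ e] := wp_latt_eq _ _ i _ _ l1 l2 hm.
have p'0 : p' z1 != 0.
  apply: contra n0 => /eqP h0; have := neg; rewrite -e h0 addr0 => /esym/eqP.
  by rewrite mulf_eq0 (negPf CC2_neq0) /= fmorph_eq0.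
have -> : z1 + z2 = 2 * z1 + (- (z1 - z2)) by ring.
have [D1 D2] := wp_dblE _ _ i _ l1 p'0.
rewrite wp2_ode // in D1 D2.
have g2 : 30 * G4 w1 w2 = 2 * (15 * G4 w1 w2) by ring.
rewrite g2 in D1 D2.
have cv : ratr y1 ^+ 2 + (a1 E)%:~R * ratr x1 * ratr y1 + (a3 E)%:~R * ratr y1 =
   ratr x1 ^+ 3 + (a2 E)%:~R * ratr x1 ^+ 2 + (a4 E)%:~R * ratr x1 + (a6 E)%:~R :> CC.
  have := congr1 (ratr : rat -> CC) oc.
  by rewrite !(rmorphD, rmorphM, rmorphXn) /= !ratr_int.
have [e1 e2] := tangent_alg _ _ _ _ _ _ _ _ _ _ _ _ _ _ CC2_neq0 CC3_neq0 b2_div12 G4_c4 hx1 hy1 p'0 cv D1 D2.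
apply: cor_latt; last by apply/in_lattN.
rewrite ec_add_tangent // -ex; split; first exact: dbl_notin_latt.
have r2 : ratr 2 = 2 :> CC by rewrite ratr_nat.
have r3 : ratr 3 = 3 :> CC by rewrite ratr_nat.
move: (2 : rat) r2 (3 : rat) r3 => t2 r2 t3 r3.
split; first by rewrite -e1 !(rmorphB, rmorphD, rmorphN, rmorphM, rmorphXn, fmorphV) /= !ratr_int r2 r3.
by rewrite !(rmorphB, rmorphD, rmorphN, rmorphM, rmorphXn, fmorphV) /= !ratr_int r2 r3; exact: e2.
Qed.

Lemma curve_wp z x y : cor z (EPt x y) ->
  4 * (ratr (y ^+ 2 + (a1 E)%:~R * x * y + (a3 E)%:~R * y - (x ^+ 3 + (a2 E)%:~R * x ^+ 2 + (a4 E)%:~R * x + (a6 E)%:~R)) : CC)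
  = p' z ^+ 2 - 4 * p_ z ^+ 3 + 60 * G4 w1 w2 * p_ z + (c6 E)%:~R / 216.
Proof.
move=> [_ [hx hy]].
have pE : p_ z = ratr x + ((a1 E)%:~R ^+ 2 + 4 * (a2 E)%:~R) / 12.
  have -> : ((a1 E)%:~R ^+ 2 + 4 * (a2 E)%:~R) / 12 = (b2 E)%:~R / 12 :> CC.
    by rewrite -b2_div12 mulrAC divff ?mul1r // pnatr_eq0.
  by rewrite hx subrK.
have p'E : p' z = 2 * ratr y + (a1 E)%:~R * ratr x + (a3 E)%:~R by rewrite hy; field.
have GE : 60 * G4 w1 w2 = (((a1 E)%:~R ^+ 2 + 4 * (a2 E)%:~R) ^+ 2 - 24 * (2 * (a4 E)%:~R + (a1 E)%:~R * (a3 E)%:~R)) / 12.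
  by rewrite -G4_c4; field.
have c6E : (c6 E)%:~R = - ((a1 E)%:~R ^+ 2 + 4 * (a2 E)%:~R) ^+ 3
   + 36 * ((a1 E)%:~R ^+ 2 + 4 * (a2 E)%:~R) * (2 * (a4 E)%:~R + (a1 E)%:~R * (a3 E)%:~R) - 216 * ((a3 E)%:~R ^+ 2 + 4 * (a6 E)%:~R) :> CC.
  rewrite /c6 /b2 /b4 /b6; move: (a1 E) (a2 E) (a3 E) (a4 E) (a6 E) => A1 A2 A3 A4 A6.
  ring.
have L : ratr (y ^+ 2 + (a1 E)%:~R * x * y + (a3 E)%:~R * y - (x ^+ 3 + (a2 E)%:~R * x ^+ 2 + (a4 E)%:~R * x + (a6 E)%:~R)) =
  ratr y ^+ 2 + (a1 E)%:~R * ratr x * ratr y + (a3 E)%:~R * ratr y -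
  (ratr x ^+ 3 + (a2 E)%:~R * ratr x ^+ 2 + (a4 E)%:~R * ratr x + (a6 E)%:~R) :> CC.
  by rewrite !(rmorphB, rmorphD, rmorphM, rmorphXn) /= !ratr_int.
rewrite L pE p'E GE c6E.
move: (ratr x : CC) (ratr y : CC) ((a1 E)%:~R : CC) ((a2 E)%:~R : CC) ((a3 E)%:~R : CC) ((a4 E)%:~R : CC) ((a6 E)%:~R : CC).
by move=> X Y A1 A2 A3 A4 A6; field.
Qed.

Definition param (z : CC) (P : ecpt) : Prop := cor z P /\ on_curve E P.

(** By [curve_wp] the defect of the curve equation is a cubic expression in wp and wp', which is
    constant by [wp_cubic_const]; it vanishes everywhere because it vanishes at [P0]. *)
Lemma param_on_curve z0 P0 z P : P0 <> EInf -> param z0 P0 -> cor z P -> on_curve E P.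
Proof.
case: P0 => [//|x0 y0] _ [h0 c0]; case: P => [//|x y] h.
have e0 := curve_wp _ _ _ h0; have e := curve_wp _ _ _ h.
have n4 : (4 : CC) != 0 by rewrite pnatr_eq0.
rewrite (wp_cubic_const _ _ period_indep z z0) in e; [|by case: h|by case: h0].
rewrite -e0 in e; have := fmorph_inj (ratr : {rmorphism rat -> CC}) (mulfI n4 e).
by rewrite /= in c0 *; rewrite c0 subrr => /eqP; rewrite subr_eq0 => /eqP.
Qed.

Lemma param_add z1 z2 P1 P2 : param z1 P1 -> param z2 P2 -> param (z1 + z2) (ec_add E P1 P2).
Proof.
move=> [h1 c1] [h2 c2]; have h := cor_add _ _ _ _ c1 h1 h2; split => //.
case: P1 h1 c1 h => [|x y] h1 c1 h; first by case: P2 h2 c2 h.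
by apply: (param_on_curve z1 (EPt x y)) h.
Qed.

Lemma param_neg z P : param z P -> param (- z) (ec_neg E P).
Proof.
move=> [h c]; have h' := cor_neg _ _ h; split => //.
case: P h c h' => [//|x y] h c h'.
by apply: (param_on_curve z (EPt x y)) h'.
Qed.

Lemma param0 : param 0 EInf.
Proof. by split => //; exact: in_latt0. Qed.

Lemma param_mulz z P (k : int) : param z P -> param (k%:~R * z) (ec_mulz E k P).
Proof.
move=> h; have nn (n : nat) : param (n%:R * z) (iter n (ec_add E P) EInf).
  elim: n => [|n ih]; first by rewrite mul0r; exact: param0.
  by rewrite iterS -addn1 natrD mulrDl mul1r addrC; exact: param_add.
case: k => n; first exact: nn.
by rewrite NegzE rmorphN mulNr; apply: param_neg; exact: nn.
Qed.

Lemma param_lincomb n (P : 'I_n -> ecpt) (z : 'I_n -> CC) (v : 'rV[int]_n) :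
  (forall i, param (z i) (P i)) -> param (\sum_(i < n) (v ord0 i)%:~R * z i) (ec_lincomb E v P).
Proof.
move=> h; rewrite /ec_lincomb; elim/big_rec2: _ => [|i y1 y2 _ ih]; first exact: param0.
by apply: param_add => //; exact: param_mulz.
Qed.
End Unif.

(** * Denominators of sums of points *)

Lemma prime_dvdzM (l : nat) (a b : int) : prime l -> (l%:Z %| a * b)%Z = (l%:Z %| a)%Z || (l%:Z %| b)%Z.
Proof. by move=> pl; rewrite !dvdzE abszM /= Euclid_dvdM. Qed.

Lemma prime_dvdzX (l : nat) (a : int) n : prime l -> (0 < n)%N -> (l%:Z %| a ^+ n)%Z = (l%:Z %| a)%Z.
Proof. by move=> pl n0; rewrite !dvdzE abszX /= Euclid_dvdX // n0 andbT. Qed.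

Lemma prime_notdvd1 (l : nat) (a b : int) : prime l -> coprimez a b -> (l%:Z %| a)%Z -> (l%:Z %| b)%Z -> False.
Proof.
move=> pl; rewrite coprimezE !dvdzE /= => /eqP g la lb.
have : (l %| gcdn `|a| `|b|)%N by rewrite dvdn_gcd la lb.
by rewrite g dvdn1 => /eqP l1; rewrite l1 in pl.
Qed.

Lemma coprimez_prime (a b : int) : (forall l : nat, prime l -> (l%:Z %| a)%Z -> (l%:Z %| b)%Z -> False) -> coprimez a b.
Proof.
move=> h; rewrite coprimezE /coprime; apply/negPn/negP => g1.
have [l pl lg] : exists2 l, prime l & (l %| gcdn `|a| `|b|)%N.
  case: (posnP (gcdn `|a| `|b|)) => [->|g0]; first by exists 2%N.
  exists (pdiv (gcdn `|a| `|b|)); last exact: pdiv_dvd.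
  by apply: pdiv_prime; rewrite ltn_neqAle eq_sym g1.
move: lg; rewrite dvdn_gcd => /andP[la lb].
by apply: (h l pl); rewrite dvdzE.
Qed.

(** If the projectively equal triples are w and t, and t is primitive, then w is an integral
    multiple of t; only the first entries are compared. *)
Lemma prim_dvd (w0 w1 w2 t0 t1 t2 : int) :
  (forall l : nat, prime l -> (l%:Z %| t0)%Z -> (l%:Z %| t1)%Z -> (l%:Z %| t2)%Z -> False) ->
  w1 * t0 = w0 * t1 -> w2 * t0 = w0 * t2 -> (t0 %| w0)%Z.
Proof.
move=> h e1 e2.
have c : coprimez t0 (gcdz t1 t2).
  apply: coprimez_prime => l pl l0; rewrite dvdz_gcd => /andP[l1 l2].
  exact: (h l pl).
have [u [v uv]] := Bezoutz t1 t2.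
have h0 : (t0 %| gcdz t1 t2 * w0)%Z.
  rewrite -uv; have -> : (u * t1 + v * t2) * w0 = (u * w1 + v * w2) * t0.
    transitivity (u * (w0 * t1) + v * (w0 * t2)); first by ring.
    by rewrite -e1 -e2; ring.
  exact: dvdz_mull.
by rewrite Gauss_dvdzr in h0.
Qed.

Lemma integral_rat (t : rat) (b c : int) : t ^+ 2 + b%:~R * t = c%:~R -> exists Y : int, t = Y%:~R.
Proof.
move=> e; have dn : (denq t)%:~R != 0 :> rat by rewrite intr_eq0 denq_neq0.
have e2 : numq t ^+ 2 = (c * denq t - b * numq t) * denq t.
  apply: (@intr_inj rat); rewrite !(rmorphM, rmorphB, rmorphXn) /= -e.
  by rewrite -{3 4}(divq_num_den t); field.
have cp : coprimez (denq t) (numq t) by rewrite coprimez_sym coprimezE; exact: coprime_num_den.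
have : (denq t %| numq t ^+ 2)%Z by rewrite e2 dvdz_mull.
rewrite expr2 Gauss_dvdzr // => d1.
have d : denq t = 1.
  have : (denq t %| gcdz (denq t) (numq t))%Z by rewrite dvdz_gcd dvdzz.
  move/eqP: cp => ->; rewrite dvdz1 => /eqP; have := denq_gt0 t; lia.
by exists (numq t); rewrite -{1}(divq_num_den t) d divr1.
Qed.

Section Curve.
Variable E : wcoef.
Local Notation A1 := (a1 E).
Local Notation A2 := (a2 E).
Local Notation A3 := (a3 E).
Local Notation A4 := (a4 E).
Local Notation A6 := (a6 E).
Local Notation B2 := (b2 E).
Local Notation B4 := (b4 E).
Local Notation B6 := (b6 E).
Local Notation B8 := (b8 E).

Lemma curve_int (x y : rat) : on_curve E (EPt x y) -> exists Y : int, y * (denq x)%:~R ^+ 2 = Y%:~R /\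
  Y ^+ 2 + A1 * numq x * denq x * Y + A3 * denq x ^+ 2 * Y =
  denq x * (numq x ^+ 3 + A2 * numq x ^+ 2 * denq x + A4 * numq x * denq x ^+ 2 + A6 * denq x ^+ 3).
Proof.
rewrite /= => cv; have dn : (denq x)%:~R != 0 :> rat by rewrite intr_eq0 denq_neq0.
pose N := numq x ^+ 3 + A2 * numq x ^+ 2 * denq x + A4 * numq x * denq x ^+ 2 + A6 * denq x ^+ 3.
have e : (y * (denq x)%:~R ^+ 2) ^+ 2 + (A1 * numq x * denq x + A3 * denq x ^+ 2)%:~R * (y * (denq x)%:~R ^+ 2) = (denq x * N)%:~R.
  have -> : (y * (denq x)%:~R ^+ 2) ^+ 2 + (A1 * numq x * denq x + A3 * denq x ^+ 2)%:~R * (y * (denq x)%:~R ^+ 2) =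
    (denq x)%:~R ^+ 4 * (y ^+ 2 + A1%:~R * x * y + A3%:~R * y).
    rewrite !(rmorphD, rmorphM, rmorphXn) /=; move: (divq_num_den x) dn.
    by move: ((numq x)%:~R) ((denq x)%:~R) => a z <- dn; field.
  rewrite cv /N !(rmorphD, rmorphM, rmorphXn) /=; move: (divq_num_den x) dn.
  by move: ((numq x)%:~R) ((denq x)%:~R) => a z <- dn; field.
have [Y hY] := integral_rat _ _ _ e; exists Y; split => //.
apply: (@intr_inj rat); rewrite -/N -e hY !(rmorphD, rmorphM, rmorphXn) /=; ring.
Qed.

(** In the integral equation Y (Y + Z (...)) = Z N the factor N is prime to Z, which forces Z to be
    a square. *)
Lemma curve_denom (x y : rat) : on_curve E (EPt x y) -> exists D : nat,
  [/\ (0 < D)%N, denq x = D%:Z ^+ 2 & ell_denom (EPt x y) = D].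
Proof.
move=> /curve_int [Y [_ e]]; set Z := denq x in e *; set A := numq x in e.
have Z0 : 0 < Z by exact: denq_gt0.
set N := _ + A6 * Z ^+ 3 in e.
have cN : coprimez N Z.
  apply: coprimez_prime => l pl lN lZ.
  have lA : (l%:Z %| A ^+ 3)%Z.
    have -> : A ^+ 3 = N - (A2 * A ^+ 2 + A4 * A * Z + A6 * Z ^+ 2) * Z by rewrite /N; ring.
    by rewrite rpredB // dvdz_mull.
  rewrite prime_dvdzX // in lA.
  by apply: (prime_notdvd1 _ _ _ pl _ lA lZ); rewrite coprimezE; exact: coprime_num_den.
pose g := gcdz Y Z.
have g0 : 0 < g by rewrite lt0r gcdz_eq0 negb_and (gt_eqF Z0) orbT /= .
have /dvdzP [y' Yy] : (g %| Y)%Z by exact: dvdz_gcdl.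
have /dvdzP [z' Zz] : (g %| Z)%Z by exact: dvdz_gcdr.
have cyz : coprimez y' z'.
  apply/eqP; have : g * gcdz y' z' = g.
    by rewrite -[X in X * _ = _](gtz0_abs g0) mulz_gcdr ![g * _]mulrC -Yy -Zz.
  by rewrite -[RHS]mulr1 => /(mulfI (lt0r_neq0 g0)).
have g_neq : g != 0 by rewrite gt_eqF.
(* z' is prime to the cofactor of g, and g is prime to N; so z' and g divide each other and Z =
   g^2. *)
have e2 : g * (y' * (y' + z' * (A1 * A + A3 * Z))) = z' * N.
  apply: (mulfI g_neq).
  transitivity (Z * N); last by rewrite {1}Zz; ring.
  rewrite -e Yy; have -> : A1 * A * Z * (y' * g) = A1 * A * (z' * g) * (y' * g) by rewrite -Zz.
  have -> : A3 * Z ^+ 2 * (y' * g) = A3 * Z * (z' * g) * (y' * g) by rewrite -Zz; ring.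
  by ring.
have z0 : 0 < z' by move: Z0; rewrite Zz pmulr_lgt0.
have zg : (z' %| g)%Z.
  have c1 : coprimez z' (y' * (y' + z' * (A1 * A + A3 * Z))).
    rewrite coprimezMr coprimez_sym cyz /= coprimez_prime // => l pl l1 l2.
    have l3 : (l%:Z %| y')%Z.
      have -> : y' = y' + z' * (A1 * A + A3 * Z) - z' * (A1 * A + A3 * Z) by rewrite addrK.
      by rewrite rpredB // dvdz_mulr.
    exact: (prime_notdvd1 _ _ _ pl cyz l3 l1).
  by rewrite -(Gauss_dvdzl _ c1) e2 dvdz_mulr.
have gz : (g %| z')%Z.
  have c2 : coprimez g N.
    apply: coprimez_prime => l pl lg lN; apply: (prime_notdvd1 _ _ _ pl cN lN).
    by rewrite Zz dvdz_mull.
  by rewrite -(Gauss_dvdzl _ c2) -e2 dvdz_mulr.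
have gz' : z' = g.
  rewrite -(gtz0_abs z0) -(gtz0_abs g0); congr Posz; apply/eqP.
  by rewrite eqn_dvd; move: zg gz; rewrite !dvdzE => -> ->.
have ZE : Z = g ^+ 2 by rewrite Zz gz' expr2.
exists `|g|%N; have ga : `|g|%N%:Z = g by rewrite gtz0_abs.
split; [by rewrite absz_gt0|by rewrite ga|].
rewrite /ell_denom -/Z ZE abszX.
set m := `|g|%N; have m0 : (0 < m)%N by rewrite absz_gt0.
apply/eqP; rewrite eqn_leq; apply/andP; split.
  apply/bigmax_leqP => d /=; rewrite mulnn eqn_exp2r // => /eqP; lia.
have hm : (m < (m ^ 2).+1)%N by rewrite ltnS -[X in (X <= _)%N]expn1 leq_pexp2l.
by apply: (bigop.bigmax_sup (Ordinal hm)) => //=; rewrite mulnn.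
Qed.

(** (2y + a1 x + a3)^2 as a polynomial in x, homogenised to degree 4 to match [phih], whence the
    extra factor z. *)
Definition psi2h (x z : int) : int := 4 * x ^+ 3 * z + B2 * x ^+ 2 * z ^+ 2 + 2 * B4 * x * z ^+ 3 + B6 * z ^+ 4.
Definition phih (x z : int) : int := x ^+ 4 - B4 * x ^+ 2 * z ^+ 2 - 2 * B6 * x * z ^+ 3 - B8 * z ^+ 4.
(* The duplication formula x(2P) = phih/psi2h is in lowest terms at P; for points on the curve this says
   that P is nonsingular modulo every prime. *)
Definition dup_lowest (x : rat) : bool := coprimez (psi2h (numq x) (denq x)) (phih (numq x) (denq x)).

(** A prime dividing both forms cannot divide the denominator of x, and then divides the numerators
    of both partial derivatives of the curve equation at the point. *)
Lemma nonsing_dup_lowest (x y : rat) : on_curve E (EPt x y) ->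
  (forall l : nat, prime l -> nonsing_mod E l (EPt x y)) -> dup_lowest x.
Proof.
move=> cv ns; have [Y [hY eY]] := curve_int _ _ cv.
apply: coprimez_prime => l pl lp lf.
set Z := denq x in hY eY lp lf; set A := numq x in hY eY lp lf.
have dn : Z%:~R != 0 :> rat by rewrite intr_eq0 denq_neq0.
have lZ : ~~ (l%:Z %| Z)%Z.
  apply/negP => lZ; have lA : (l%:Z %| A ^+ 4)%Z.
    have -> : A ^+ 4 = phih A Z + (B4 * A ^+ 2 * Z + 2 * B6 * A * Z ^+ 2 + B8 * Z ^+ 3) * Z by rewrite /phih; ring.
    by rewrite rpredD // dvdz_mull.
  rewrite prime_dvdzX // in lA.
  by apply: (prime_notdvd1 _ _ _ pl _ lA lZ); rewrite coprimezE; exact: coprime_num_den.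
(* V and U are the two partial derivatives, cleared of denominators by Z^2. *)
pose V := 2 * Y + A1 * A * Z + A3 * Z ^+ 2.
pose U := A1 * Y - 3 * A ^+ 2 - 2 * A2 * A * Z - A4 * Z ^+ 2.
have VV : V ^+ 2 = psi2h A Z.
  rewrite /V /psi2h /b2 /b4 /b6.
  transitivity (4 * (Y ^+ 2 + A1 * A * Z * Y + A3 * Z ^+ 2 * Y) + (A1 * A * Z + A3 * Z ^+ 2) ^+ 2); first by ring.
  by rewrite eY; ring.
have lV : (l%:Z %| V)%Z by rewrite -(prime_dvdzX _ _ 2) // VV.
(* On the curve, U^2 is congruent to [phih] modulo V; with V^2 = [psi2h] both derivatives are
   divisible by l. *)
have UU : Z * U ^+ 2 = Z * phih A Z + (Z * A1 * U + (A2 * Z + 2 * A) * V) * V.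
  rewrite mulrDl -[_ * V * V]mulrA -expr2 VV /V /U /phih /psi2h /b2 /b4 /b6 /b8.
  apply/eqP; rewrite -subr_eq0; apply/eqP.
  have e0 : Y ^+ 2 + A1 * A * Z * Y + A3 * Z ^+ 2 * Y -
     Z * (A ^+ 3 + A2 * A ^+ 2 * Z + A4 * A * Z ^+ 2 + A6 * Z ^+ 3) = 0 by rewrite eY subrr.
  by rewrite -[RHS](mulr0 (- Z * A1 ^+ 2)) -e0; ring.
have lU : (l%:Z %| U)%Z.
  have : (l%:Z %| Z * U ^+ 2)%Z by rewrite UU rpredD // dvdz_mull.
  by rewrite prime_dvdzM // (negPf lZ) /= prime_dvdzX.
have num (t : rat) (W : int) : t * Z%:~R ^+ 2 = W%:~R -> (l%:Z %| W)%Z -> (l%:Z %| numq t)%Z.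
  move=> et lW; have e0 : numq t * Z ^+ 2 = W * denq t.
    apply: (@intr_inj rat); rewrite !(rmorphM, rmorphXn) /= -et.
    by rewrite -{2}(divq_num_den t); field; rewrite intr_eq0 denq_neq0.
  have : (l%:Z %| numq t * Z ^+ 2)%Z by rewrite e0 dvdz_mulr.
  by rewrite prime_dvdzM // prime_dvdzX // (negPf lZ) orbF.
case: (ns l pl) => [h|/negP]; first by move/negP: lZ; apply; rewrite dvdzE.
apply; apply/andP; split.
  apply: (num _ U) => //; rewrite /U !(rmorphB, rmorphM, rmorphXn) /= -hY -{1 2}(divq_num_den x) -/A -/Z.
  by field.
apply: (num _ V) => //; rewrite /V !(rmorphD, rmorphM, rmorphXn) /= -hY -{1}(divq_num_den x) -/A -/Z.
by field.
Qed.
End Curve.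

Section Denominators.
Variable E : wcoef.
Local Notation A1 := (a1 E).
Local Notation A2 := (a2 E).
Local Notation A3 := (a3 E).
Local Notation A4 := (a4 E).
Local Notation A6 := (a6 E).
Local Notation B2 := (b2 E).
Local Notation B4 := (b4 E).
Local Notation B6 := (b6 E).
Local Notation B8 := (b8 E).

Lemma b2Q : B2%:~R = A1%:~R ^+ 2 + 4 * A2%:~R :> rat.
Proof. by rewrite /b2 !(rmorphD, rmorphM, rmorphXn). Qed.
Lemma b4Q : B4%:~R = 2 * A4%:~R + A1%:~R * A3%:~R :> rat.
Proof. by rewrite /b4 !(rmorphD, rmorphM, rmorphXn). Qed.
Lemma b6Q : B6%:~R = A3%:~R ^+ 2 + 4 * A6%:~R :> rat.
Proof. by rewrite /b6 !(rmorphD, rmorphM, rmorphXn). Qed.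
Lemma b8Q : B8%:~R = A1%:~R ^+ 2 * A6%:~R + 4 * A2%:~R * A6%:~R - A1%:~R * A3%:~R * A4%:~R
                       + A2%:~R * A3%:~R ^+ 2 - A4%:~R ^+ 2 :> rat.
Proof. by rewrite /b8 !(rmorphB, rmorphD, rmorphM, rmorphXn). Qed.

Lemma ec_negE x y : ec_neg E (EPt x y) = EPt x (- y - A1%:~R * x - A3%:~R).
Proof. by []. Qed.

(** The symmetric functions of x(P+Q) and x(P-Q) are free of y, since y enters only through the
    curve equations; solving these for a6 and a4 leaves a rational identity. *)
Lemma sum_prod_x x1 y1 x2 y2 x3 y3 x4 y4 :
  on_curve E (EPt x1 y1) -> on_curve E (EPt x2 y2) -> x1 != x2 ->
  ec_add E (EPt x1 y1) (EPt x2 y2) = EPt x3 y3 ->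
  ec_add E (EPt x1 y1) (ec_neg E (EPt x2 y2)) = EPt x4 y4 ->
  (x1 - x2) ^+ 2 * (x3 + x4) = 2 * x1 * x2 * (x1 + x2) + B2%:~R * x1 * x2 + B4%:~R * (x1 + x2) + B6%:~R /\
  (x1 - x2) ^+ 2 * (x3 * x4) = x1 ^+ 2 * x2 ^+ 2 - B4%:~R * x1 * x2 - B6%:~R * (x1 + x2) - B8%:~R.
Proof.
move=> c1 c2 nx; rewrite ec_negE !ec_add_chord // => -[<- _] [<- _].
rewrite b2Q b4Q b6Q b8Q; rewrite /on_curve in c1 c2.
have d0 : x1 - x2 != 0 by rewrite subr_eq0.
have d0' : x2 - x1 != 0 by rewrite subr_eq0 eq_sym.
move: A1%:~R A2%:~R A3%:~R A4%:~R A6%:~R c1 c2 => a1 a2 a3 a4 a6 c1 c2.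
have e6 : a6 = y1 ^+ 2 + a1 * x1 * y1 + a3 * y1 - x1 ^+ 3 - a2 * x1 ^+ 2 - a4 * x1 by rewrite c1; ring.
have e4 : a4 = (y1 ^+ 2 + a1 * x1 * y1 + a3 * y1 - x1 ^+ 3 - a2 * x1 ^+ 2
  - (y2 ^+ 2 + a1 * x2 * y2 + a3 * y2 - x2 ^+ 3 - a2 * x2 ^+ 2)) / (x1 - x2) by rewrite c1 c2; field.
by split; rewrite e6 e4; field; rewrite d0 d0'.
Qed.

Lemma dup_x x y x2 y2 : on_curve E (EPt x y) -> 2 * y + A1%:~R * x + A3%:~R != 0 ->
  ec_add E (EPt x y) (EPt x y) = EPt x2 y2 ->
  (2 * y + A1%:~R * x + A3%:~R) ^+ 2 = 4 * x ^+ 3 + B2%:~R * x ^+ 2 + 2 * B4%:~R * x + B6%:~R /\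
  x2 * (2 * y + A1%:~R * x + A3%:~R) ^+ 2 = x ^+ 4 - B4%:~R * x ^+ 2 - 2 * B6%:~R * x - B8%:~R.
Proof.
move=> c n0; have n1 : y + y + A1%:~R * x + A3%:~R != 0 by rewrite -mulr2n -mulr_natl.
rewrite ec_add_tangent // => -[<- _].
rewrite b2Q b4Q b6Q b8Q; rewrite /on_curve in c.
move: A1%:~R A2%:~R A3%:~R A4%:~R A6%:~R c n0 n1 => a1 a2 a3 a4 a6 c n0 _.
have e6 : a6 = y ^+ 2 + a1 * x * y + a3 * y - x ^+ 3 - a2 * x ^+ 2 - a4 * x by rewrite c; ring.
by split; rewrite e6; field.
Qed.

Section Chord.
Variables a z u v : int.
Let w0 := (a * v - u * z) ^+ 2.
Let w1 := 2 * a * u * (a * v + u * z) + B2 * a * u * z * v + B4 * (a * v + u * z) * z * v + B6 * z ^+ 2 * v ^+ 2.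
Let w2 := a ^+ 2 * u ^+ 2 - B4 * a * u * z * v - B6 * (a * v + u * z) * z * v - B8 * z ^+ 2 * v ^+ 2.

(** With x(P) = a/z and x(Q) = u/v, the triple w0, w1, w2 represents 1, the sum and the product of
    x(P+Q) and x(P-Q). Modulo a prime dividing w0 the two abscissas coincide, and w1, w2 degenerate
    to the forms [psi2h], [phih] at P, which have no common prime factor. *)
Lemma chord_prim (l : nat) : coprimez u v -> coprimez (psi2h E a z) (phih E a z) -> prime l ->
  (l%:Z %| w0)%Z -> (l%:Z %| w1)%Z -> (l%:Z %| w2)%Z -> False.
Proof.
move=> cuv cg pl l0 l1 l2; rewrite prime_dvdzX // in l0.
have both (f w : int) c1 c2 : v ^+ 2 * f = z ^+ 2 * w + c1 * (a * v - u * z) ->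
  u ^+ 2 * f = a ^+ 2 * w + c2 * (a * v - u * z) -> (l%:Z %| w)%Z -> (l%:Z %| f)%Z.
  move=> e1 e2 lw.
  have : (l%:Z %| v ^+ 2 * f)%Z by rewrite e1 rpredD // dvdz_mull.
  rewrite prime_dvdzM // prime_dvdzX // => /orP[lv|//].
  have : (l%:Z %| u ^+ 2 * f)%Z by rewrite e2 rpredD // dvdz_mull.
  rewrite prime_dvdzM // prime_dvdzX // => /orP[lu|//].
  by case: (prime_notdvd1 _ _ _ pl cuv lu lv).
apply: (prime_notdvd1 _ _ _ pl cg).
  apply: (both _ _ (2 * a * z * (a * v + u * z + a * v) + B2 * a * z ^+ 2 * v + B4 * z ^+ 3 * v)
    (- (2 * a ^+ 3 * u + B2 * a ^+ 2 * u * z + B4 * a * z * (a * v + 2 * u * z) + B6 * z ^+ 2 * (a * v + u * z))) _ _ l1);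
  by rewrite /psi2h /w1; ring.
apply: (both _ _ (a ^+ 2 * (u * z + a * v) - B4 * a * v * z ^+ 2 - B6 * z ^+ 3 * v)
    (B4 * a ^+ 2 * u * z + B6 * a * z * (a * v + 2 * u * z) + B8 * z ^+ 2 * (a * v + u * z)) _ _ l2);
by rewrite /phih /w2; ring.
Qed.

(** Two proportional primitive triples agree up to sign, and both first entries are nonnegative. The
    triple of q s, p s + r q and p r is primitive by Gauss's lemma for the product of two linear
    forms. *)
Lemma chord_dvd (p q r s : int) : coprimez u v -> coprimez (psi2h E a z) (phih E a z) ->
  coprimez p q -> coprimez r s -> 0 < q -> 0 < s ->
  w1 * (q * s) = w0 * (p * s + r * q) -> w2 * (q * s) = w0 * (p * r) -> w0 = q * s.
Proof.
move=> cuv cg cpq crs q0 s0 e1 e2.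
have d1 : (q * s %| w0)%Z.
  apply: (prim_dvd _ _ _ _ _ _ _ e1 e2) => l pl; rewrite !prime_dvdzM // => /orP[lq|ls].
    move=> lt /orP[lp|lr]; first exact: (prime_notdvd1 _ _ _ pl cpq lp lq).
    have : (l%:Z %| p * s)%Z by rewrite -[p * s](addrK (r * q)) rpredB // dvdz_mull.
    rewrite prime_dvdzM // => /orP[lp|ls]; first exact: (prime_notdvd1 _ _ _ pl cpq lp lq).
    exact: (prime_notdvd1 _ _ _ pl crs lr ls).
  move=> lt /orP[lp|lr]; last exact: (prime_notdvd1 _ _ _ pl crs lr ls).
  have : (l%:Z %| r * q)%Z by rewrite -[r * q](addKr (p * s)) addrC rpredB // dvdz_mull.
  rewrite prime_dvdzM // => /orP[lr|lq]; first exact: (prime_notdvd1 _ _ _ pl crs lr ls).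
  exact: (prime_notdvd1 _ _ _ pl cpq lp lq).
have d2 : (w0 %| q * s)%Z.
  apply: (prim_dvd _ (p * s + r * q) (p * r) _ w1 w2) => [l||].
  - exact: (chord_prim l cuv cg).
  - by rewrite mulrC -e1 mulrC.
  - by rewrite mulrC -e2 mulrC.
have w00 : 0 <= w0 by exact: sqr_ge0.
have t0 : 0 <= q * s by rewrite mulr_ge0 // ltW.
rewrite -(ger0_norm w00) -(ger0_norm t0) -!abszE; congr Posz; apply/eqP.
by rewrite eqn_dvd; move: d1 d2; rewrite !dvdzE => -> ->.
Qed.
End Chord.

Lemma coprime_nd (x : rat) : coprimez (numq x) (denq x).
Proof. by rewrite coprimezE; exact: coprime_num_den. Qed.

Lemma chord_denom x1 y1 x2 y2 P3 P4 :
  on_curve E (EPt x1 y1) -> on_curve E (EPt x2 y2) -> on_curve E P3 -> on_curve E P4 ->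
  dup_lowest E x1 -> x1 != x2 ->
  ec_add E (EPt x1 y1) (EPt x2 y2) = P3 ->
  ec_add E (EPt x1 y1) (ec_neg E (EPt x2 y2)) = P4 ->
  (ell_denom P3 * ell_denom P4)%:R = (ell_denom (EPt x1 y1) * ell_denom (EPt x2 y2))%:R ^+ 2 * `|x1 - x2| :> rat.
Proof.
move=> c1 c2 c3 c4 g nx e3 e4.
have e3' := e3; have e4' := e4.
rewrite ec_negE in e4'; rewrite !ec_add_chord // in e3' e4'; cbv zeta in e3', e4'.
case: P3 c3 e3 e3' => // x3 y3 c3 e3 _; case: P4 c4 e4 e4' => // x4 y4 c4 e4 _.
have [S T] := sum_prod_x _ _ _ _ _ _ _ _ c1 c2 nx e3 e4.
have [d1 [p1 z1 ->]] := curve_denom _ _ _ c1; have [d2 [p2 z2 ->]] := curve_denom _ _ _ c2.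
have [d3 [p3 z3 ->]] := curve_denom _ _ _ c3; have [d4 [p4 z4 ->]] := curve_denom _ _ _ c4.
have q1 := divq_num_den x1; have q2 := divq_num_den x2; have q3 := divq_num_den x3; have q4 := divq_num_den x4.
have n1 : (denq x1)%:~R != 0 :> rat by rewrite intr_eq0 denq_neq0.
have n2 : (denq x2)%:~R != 0 :> rat by rewrite intr_eq0 denq_neq0.
have n3 : (denq x3)%:~R != 0 :> rat by rewrite intr_eq0 denq_neq0.
have n4 : (denq x4)%:~R != 0 :> rat by rewrite intr_eq0 denq_neq0.
have W : (numq x1 * denq x2 - numq x2 * denq x1) ^+ 2 = denq x3 * denq x4.
  apply: (chord_dvd _ _ _ _ (numq x3) (denq x3) (numq x4) (denq x4)); rewrite ?denq_gt0 ?coprime_nd //.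
    apply: (@intr_inj rat); move: S; move: (b2 E) (b4 E) (b6 E) => r2 r4 r6 S.
    rewrite !(rmorphB, rmorphD, rmorphM, rmorphXn) /=.
    move: S q1 q2 q3 q4 n1 n2 n3 n4.
    move: r2%:~R r4%:~R r6%:~R => {r2 r4 r6}r2 r4 r6.
    move: (numq x1)%:~R (numq x2)%:~R (numq x3)%:~R (numq x4)%:~R => a1 a2 a3 a4.
    move: (denq x1)%:~R (denq x2)%:~R (denq x3)%:~R (denq x4)%:~R => s1 s2 s3 s4 S q1 q2 q3 q4 n1 n2 n3 n4.
    rewrite -q1 -q2 -q3 -q4 in S.
    have -> : (a1 * s2 - a2 * s1) ^+ 2 * (a3 * s4 + a4 * s3) =
       s1 ^+ 2 * s2 ^+ 2 * s3 * s4 * ((a1 / s1 - a2 / s2) ^+ 2 * (a3 / s3 + a4 / s4)) by field; rewrite n1 n2 n3 n4.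
    by rewrite S; field; rewrite n1 n2.
  apply: (@intr_inj rat); move: T; move: (b4 E) (b6 E) (b8 E) => r4 r6 r8 T.
  rewrite !(rmorphB, rmorphD, rmorphM, rmorphXn) /=.
  move: T q1 q2 q3 q4 n1 n2 n3 n4.
  move: r4%:~R r6%:~R r8%:~R => {r4 r6 r8}r4 r6 r8.
  move: (numq x1)%:~R (numq x2)%:~R (numq x3)%:~R (numq x4)%:~R => a1 a2 a3 a4.
  move: (denq x1)%:~R (denq x2)%:~R (denq x3)%:~R (denq x4)%:~R => s1 s2 s3 s4 U q1 q2 q3 q4 n1 n2 n3 n4.
    rewrite -q1 -q2 -q3 -q4 in U.
  have -> : (a1 * s2 - a2 * s1) ^+ 2 * (a3 * a4) =
     s1 ^+ 2 * s2 ^+ 2 * s3 * s4 * ((a1 / s1 - a2 / s2) ^+ 2 * (a3 / s3 * (a4 / s4))) by field; rewrite n1 n2 n3 n4.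
  by rewrite U; field; rewrite n1 n2.
have xx : x1 - x2 = (numq x1 * denq x2 - numq x2 * denq x1)%:~R / ((denq x1)%:~R * (denq x2)%:~R).
  by rewrite -{1}q1 -{1}q2 rmorphB !rmorphM /=; field; rewrite n1 n2.
have net_arg : (d1 * d2)%:R ^+ 2 = (denq x1)%:~R * (denq x2)%:~R :> rat.
  by rewrite z1 z2 natrM exprMn !rmorphXn.
rewrite xx net_arg normrM normrV ?unitfE ?mulf_neq0 // [`| _ * _|]ger0_norm; last first.
  by rewrite -net_arg sqr_ge0.
rewrite mulrC divfK ?mulf_neq0 //.
(* [W] gives the square of the integer a v - u z, so both sides are compared after squaring. *)
apply/eqP; rewrite -(eqrXn2 (n := 2)) ?ler0n ?normr_ge0 //; apply/eqP.
have W' := congr1 (intr : int -> rat) W; rewrite [LHS]rmorphXn in W'.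
by rewrite real_normK ?num_real // W' [RHS]rmorphM z3 z4 natrM exprMn /= !rmorphXn.
Qed.

Lemma dup_denom x y P2 : on_curve E (EPt x y) -> on_curve E P2 -> 2 * y + A1%:~R * x + A3%:~R != 0 ->
  ec_add E (EPt x y) (EPt x y) = P2 ->
  dup_lowest E x <-> (ell_denom P2)%:R = (ell_denom (EPt x y))%:R ^+ 4 * `|2 * y + A1%:~R * x + A3%:~R| :> rat.
Proof.
move=> c c2 n0 e.
have n1' : y + y + A1%:~R * x + A3%:~R != 0 by rewrite -mulr2n -mulr_natl.
have e' := e; rewrite ec_add_tangent // in e'; cbv zeta in e'.
case: P2 c2 e e' => // x2 y2 c2 e _.
have [S T] := dup_x _ _ _ _ c n0 e.
have [d [p z ->]] := curve_denom _ _ _ c; have [d2 [p2 z2 ->]] := curve_denom _ _ _ c2.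
have q := divq_num_den x.
have n1 : (denq x)%:~R != 0 :> rat by rewrite intr_eq0 denq_neq0.
have net_arg : d%:R ^+ 2 = (denq x)%:~R :> rat by rewrite z rmorphXn.
set ps := (2 * y + _ + _) in S T n0 *.
(* The square of the proposed denominator is the integer [psi2h], so the claim becomes an equality
   with the denominator of x(2P). *)
have VV : (d%:R ^+ 4 * `|ps|) ^+ 2 = (psi2h E (numq x) (denq x))%:~R.
  rewrite exprMn real_normK ?num_real // S (exprM _ 2 2) net_arg.
  rewrite /psi2h; move: (b2 E) (b4 E) (b6 E) => r2 r4 r6; move: q; rewrite !(rmorphD, rmorphM, rmorphXn) /=; move: n1.
  move: r2%:~R r4%:~R r6%:~R (numq x)%:~R (denq x)%:~R => {r2 r4 r6}r2 r4 r6 a s n q; rewrite -q; by field; rewrite n.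
have pp : (0 < psi2h E (numq x) (denq x)).
  rewrite -(ltr0z rat) -VV exprn_gt0 // mulr_gt0 ?normr_gt0 // exprn_gt0 // ltr0n //.
have xE : x2 = (phih E (numq x) (denq x))%:~R / (psi2h E (numq x) (denq x))%:~R.
  apply: (canRL (mulfK _)); first by rewrite intr_eq0 gt_eqF.
  rewrite -VV exprMn real_normK ?num_real // mulrCA T (exprM _ 2 2) net_arg.
  rewrite /phih; move: (b4 E) (b6 E) (b8 E) => r2 r4 r6; move: q; rewrite !(rmorphB, rmorphD, rmorphM, rmorphXn) /=; move: n1.
  move: r2%:~R r4%:~R r6%:~R (numq x)%:~R (denq x)%:~R => {r2 r4 r6}r2 r4 r6 a s n q; rewrite -q; by field; rewrite n.
have den : d2%:R = d%:R ^+ 4 * `|ps| <-> denq x2 = psi2h E (numq x) (denq x).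
  have -> : (d2%:R = d%:R ^+ 4 * `|ps|) <-> (d2%:R ^+ 2 = (d%:R ^+ 4 * `|ps|) ^+ 2).
    split => [->//|] /eqP; rewrite eqrXn2 ?ler0n ?mulr_ge0 ?exprn_ge0 ?ler0n // => /eqP //.
  rewrite VV z2; split => [h|h]; last by rewrite -h rmorphXn.
  by apply: (@intr_inj rat); rewrite -h rmorphXn.
rewrite /dup_lowest; split => [g|/den h].
  apply/den; rewrite xE coprimeq_den ?gt_eqF ?gtr0_norm //.
  by move: g; rewrite coprimez_sym coprimezE.
have : numq x2 = phih E (numq x) (denq x).
  apply: (@intr_inj rat); have nz : (denq x2)%:~R != 0 :> rat by rewrite intr_eq0 denq_neq0.
  by apply: (mulIf (invr_neq0 nz)); rewrite divq_num_den h; exact: xE.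
by rewrite coprimez_sym -h => <-; exact: coprime_nd.
Qed.
End Denominators.

(** * Net polynomials *)

(** The slopes lb, lc and m belong to the chords giving V + B, V + C and B - C. The identity shows
    that a product of two abscissa differences is a rational square times a third one, which is the
    source of a real square root. *)
Lemma slope_alg (F : fieldType) (a1 a2 a3 a4 a6 xv yv xb yb xc yc : F) :
  yv ^+ 2 + a1 * xv * yv + a3 * yv = xv ^+ 3 + a2 * xv ^+ 2 + a4 * xv + a6 ->
  yb ^+ 2 + a1 * xb * yb + a3 * yb = xb ^+ 3 + a2 * xb ^+ 2 + a4 * xb + a6 ->
  yc ^+ 2 + a1 * xc * yc + a3 * yc = xc ^+ 3 + a2 * xc ^+ 2 + a4 * xc + a6 ->
  xv != xb -> xv != xc -> xb != xc ->
  let lb := (yb - yv) / (xb - xv) in let lc := (yc - yv) / (xc - xv) in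
  let m := (- yc - a1 * xc - a3 - yb) / (xc - xb) in
  (xc - (lb ^+ 2 + a1 * lb - a2 - xv - xb)) * (xb - (lc ^+ 2 + a1 * lc - a2 - xv - xc)) =
  (lb - lc) ^+ 2 * (m ^+ 2 + a1 * m - a2 - xb - xc - xv).
Proof.
move=> ev eb ec nvb nvc nbc lb lc m.
have dbv : xb - xv != 0 by rewrite subr_eq0 eq_sym.
have dcv : xc - xv != 0 by rewrite subr_eq0 eq_sym.
have dcb : xc - xb != 0 by rewrite subr_eq0 eq_sym.
have ybE : yb = yv + lb * (xb - xv) by rewrite /lb divfK // addrC subrK.
have ycE : yc = yv + lc * (xc - xv) by rewrite /lc divfK // addrC subrK.
have mE : m = (- yc - a1 * xc - a3 - yb) / (xc - xb) by [].
move: lb lc m ybE ycE mE => lb lc m ybE ycE mE.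
(* The curve equation along a chord, divided by the difference of abscissas, eliminates a6;
   combining [qb] and [qc] eliminates a4 and determines a2. *)
have qb : lb * (2 * yv + lb * (xb - xv)) + a1 * (yv + xb * lb) + a3 * lb =
   xb ^+ 2 + xb * xv + xv ^+ 2 + a2 * (xb + xv) + a4.
  apply: (mulIf dbv); transitivity (yb ^+ 2 + a1 * xb * yb + a3 * yb - (yv ^+ 2 + a1 * xv * yv + a3 * yv)).
    by rewrite ybE; ring.
  by rewrite eb ev; ring.
have qc : lc * (2 * yv + lc * (xc - xv)) + a1 * (yv + xc * lc) + a3 * lc =
   xc ^+ 2 + xc * xv + xv ^+ 2 + a2 * (xc + xv) + a4.
  apply: (mulIf dcv); transitivity (yc ^+ 2 + a1 * xc * yc + a3 * yc - (yv ^+ 2 + a1 * xv * yv + a3 * yv)).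
    by rewrite ycE; ring.
  by rewrite ec ev; ring.
have a2E : a2 = (lc * (2 * yv + lc * (xc - xv)) + a1 * (yv + xc * lc) + a3 * lc
  - (lb * (2 * yv + lb * (xb - xv)) + a1 * (yv + xb * lb) + a3 * lb)) / (xc - xb) - (xb + xc + xv).
  by rewrite qc qb; field.
by rewrite mE a2E ybE ycE; field.
Qed.

Lemma lim0_dbl f l : lim0 f l -> lim0 (fun h => f (2 * h)) l.
Proof.
move=> h e e0; have [d d0 hd] := h e e0.
exists (d / 2); first by rewrite divr_gt0.
move=> t t0 td; apply: hd; first by rewrite mulf_neq0 // pnatr_eq0.
by rewrite nmM nm_nat mulrC -ler_pdivlMr.
Qed.

Section Sigma3.
Variables (w1 w2 : CC).
Hypothesis hi : indep w1 w2.
Local Notation sg := (wsigma w1 w2).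
Local Notation inL := (in_latt w1 w2).

Lemma near0_shift a : near0 (fun h => ~ inL (a + h)).
Proof.
have [ha|ha] := pselect (inL a); last exact: near0_notin.
apply: near0_imp (near0_lat _ _ hi) => h _ hh; apply: contra_not hh => hs.
by rewrite -(addKr a h) addrC; apply: in_lattB.
Qed.

Lemma lim0_sg a : lim0 (fun h => sg (a + 2 * h)) (sg a).
Proof. by apply: (lim0_dbl (fun h => sg (a + h))); apply: lim0_hol; exact: wsigma_hol. Qed.

(** Off the lattice the product formula reduces this to (p1 - p2)(p3 - p4) + ... = 0. Translating
    all four arguments by h keeps the differences and moves them off the lattice; then h tends to
    0. *)
Lemma wsigma_three_term a b c d :
  sg (a + b) * sg (a - b) * (sg (c + d) * sg (c - d)) +
  sg (b + c) * sg (b - c) * (sg (a + d) * sg (a - d)) +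
  sg (c + a) * sg (c - a) * (sg (b + d) * sg (b - d)) = 0.
Proof.
pose F x y h := sg (x + y + 2 * h) * sg (x - y).
have lF x y : lim0 (F x y) (sg (x + y) * sg (x - y)) by apply: lim0M; [exact: lim0_sg|exact: lim0C].
apply: (lim0_eq (fun h => F a b h * F c d h + F b c h * F a d h + F c a h * F b d h) (fun=> 0)).
- exact: lim0D _ _ _ _ (lim0D _ _ _ _ (lim0M _ _ _ _ (lF a b) (lF c d)) (lim0M _ _ _ _ (lF b c) (lF a d)))
    (lim0M _ _ _ _ (lF c a) (lF b d)).
- exact: lim0C.
have := near0_and _ _ (near0_and _ _ (near0_shift a) (near0_shift b)) (near0_and _ _ (near0_shift c) (near0_shift d)).
apply: near0_imp => h _ [[ha hb] [hc hd]].
have FE x y : ~ inL (x + h) -> ~ inL (y + h) ->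
    F x y h = - (sg (x + h) ^+ 2 * sg (y + h) ^+ 2 * (wp w1 w2 (x + h) - wp w1 w2 (y + h))).
  move=> hx hy; rewrite -(wsigma_addB _ _ hi) // /F.
  have -> : x + y + 2 * h = x + h + (y + h) by ring.
  by have -> : x - y = x + h - (y + h) by ring.
rewrite !FE //; move: (sg _) (sg _) (sg _) (sg _) (wp _ _ _) (wp _ _ _) (wp _ _ _) (wp _ _ _) => s1 s2 s3 s4 p1 p2 p3 p4.
ring.
Qed.
End Sigma3.

(** * Quadratic maps and quadratic forms *)

Section QuadMap.
Variables (V : zmodType) (F : fieldType).

(** The cube law together with evenness, in multiplicative notation; evenness excludes a linear
    part. *)
Definition quadmap (k : V -> F) : Prop :=
  [/\ forall v, k v != 0, forall v, k (- v) = k v &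
      forall u v w, k (u + v + w) * k u * k v * k w = k (u + v) * k (v + w) * k (u + w)].

Lemma quadmap_par k v w : quadmap k -> k (v + w) * k (v - w) = k v ^+ 2 * k w ^+ 2.
Proof.
move=> [k0 kN kq].
have k1 : k 0 = 1.
  by apply: (mulfI (k0 0)); apply: (mulfI (k0 0)); apply: (mulfI (k0 0)); have := kq 0 0 0; rewrite !addr0 mulr1 !mulrA.
have := kq v w (- w); rewrite addrK subrr k1 kN mulr1 => <-; ring.
Qed.

(** The right side is symmetric in p, q and r, so all three terms of the net recurrence are scaled
    by the same factor. *)
Lemma quadmap_net k p q r s : quadmap k ->
  k (p + q + s) * k (p - q) * k (r + s) * k r =
  k p * k q * k r * (k (p + s) * k (q + s) * k (r + s)) / k s.
Proof.
move=> hk; have [k0 _ kq] := hk.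
apply: (mulIf (k0 s)); rewrite divfK //; apply: (mulIf (k0 p)); apply: (mulIf (k0 q)).
have e1 := kq p q s; have e2 := quadmap_par k p q hk.
transitivity (k (p + q + s) * k p * k q * k s * (k (p - q) * k (r + s) * k r)); first by ring.
rewrite e1; transitivity (k (p + q) * k (p - q) * (k (q + s) * k (p + s) * k (r + s) * k r)); first by ring.
by rewrite e2; ring.
Qed.

Definition quadform (q : V -> int) : Prop :=
  (forall v, q (- v) = q v) /\
  forall u v w, q (u + v + w) + q u + q v + q w = q (u + v) + q (v + w) + q (u + w).

Lemma quadformB q1 q2 : quadform q1 -> quadform q2 -> quadform (fun v => q1 v - q2 v).
Proof.
move=> [e1 h1] [e2 h2]; split => [v|u v w]; first by rewrite e1 e2.
by have := h1 u v w; have := h2 u v w; lia.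
Qed.

Lemma quadform_sum (I : Type) (r : seq I) (p : pred I) (q : I -> V -> int) : (forall i, p i -> quadform (q i)) ->
  quadform (fun v => \sum_(i <- r | p i) q i v).
Proof.
move=> h; split => [v|u v w]; first by apply: eq_bigr => i /h[].
by rewrite -!big_split; apply: eq_bigr => i /h[_ e]; exact: e.
Qed.

Lemma quadform_scale (c : int) q : quadform q -> quadform (fun v => c * q v).
Proof. by move=> [e h]; split => [v|u v w]; rewrite ?e // -!mulrDr h. Qed.

Lemma quadmap_exp (c : F) q : c != 0 -> quadform q -> quadmap (fun v => c ^ q v).
Proof.
move=> c0 [e h]; split => [v|v|u v w]; [by rewrite expfz_neq0|by rewrite e|].
by rewrite -!expfzDr // h.
Qed.

Lemma quadmapM k1 k2 : quadmap k1 -> quadmap k2 -> quadmap (fun v => k1 v * k2 v).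
Proof.
move=> [a1 b1 c1] [a2 b2 c2]; split => [v|v|u v w]; [by rewrite mulf_neq0|by rewrite b1 b2|].
transitivity (k1 (u + v + w) * k1 u * k1 v * k1 w * (k2 (u + v + w) * k2 u * k2 v * k2 w)); first by ring.
by rewrite c1 c2; ring.
Qed.

Lemma quadmapV k : quadmap k -> quadmap (fun v => (k v)^-1).
Proof.
move=> [a b c]; split => [v|v|u v w]; [by rewrite invr_eq0|by rewrite b|].
by rewrite -!invfM; congr (_^-1); rewrite -c; ring.
Qed.

Lemma quadmap_prod (I : Type) (r : seq I) (p : pred I) (k : I -> V -> F) : (forall i, p i -> quadmap (k i)) ->
  quadmap (fun v => \prod_(i <- r | p i) k i v).
Proof.
move=> h; split => [v|v|u v w].
- by elim/big_rec: _ => [|i x /h[k0 _ _] x0]; [exact: oner_neq0|exact: mulf_neq0].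
- by apply: eq_bigr => i /h[].
by rewrite -!big_split; apply: eq_bigr => i /h[_ _ e]; exact: e.
Qed.
End QuadMap.

Lemma quadform_coord n i j : quadform _ (fun v : 'rV[int]_n => v ord0 i * v ord0 j).
Proof. by split => [v|u v w]; rewrite !mxE; ring. Qed.

(** Proved in the translated form [S u -> S (u + v)], so that the coordinates of v can be added one
    after the other. *)
Lemma row_ind n (S : 'rV[int]_n -> Prop) : S 0 ->
  (forall v j, S v -> S (v + delta_mx ord0 j) /\ S (v - delta_mx ord0 j)) -> forall v, S v.
Proof.
move=> S0 step v; suff h : forall u, S u -> S (u + v) by rewrite -(add0r v); exact: h.
rewrite (row_sum_delta v); elim/big_ind: _ => [u|x y hx hy u hu|j _ u].
- by rewrite addr0.
- by rewrite addrA; apply: hy; exact: hx.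
elim/int_ind: (v ord0 j) u => [u|k ih u hu|k ih u hu]; first by rewrite scale0r addr0.
  by rewrite -[k.+1]addn1 PoszD scalerDl scale1r addrA; case: (step _ j (ih _ hu)).
by rewrite -[k.+1]addn1 PoszD opprD scalerDl scaleN1r addrA; case: (step _ j (ih _ hu)).
Qed.

Lemma big_pair (T : Type) (idx : T) (op : Monoid.com_law idx) n (i j : 'I_n) (F : 'I_n -> 'I_n -> T) : (i < j)%N ->
  (forall k l : 'I_n, (k < l)%N -> ~~ ((k == i) && (l == j)) -> F k l = idx) ->
  \big[op/idx]_(k < n) \big[op/idx]_(l < n | (k < l)%N) F k l = F i j.
Proof.
move=> ij h; rewrite (bigD1 i) //= (bigD1 j) //= big1 => [|l /andP[il nl]]; last first.
  by apply: h; rewrite ?(negPf nl) ?andbF.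
rewrite big1 ?Monoid.mulm1 // => k ki; rewrite big1 // => l kl.
by apply: h; rewrite ?(negPf ki).
Qed.

Lemma ratr_creal q : (ratr q : CC) \is Num.real.
Proof. by rewrite /ratr rpred_div // rpred_int. Qed.

Section Net.
Variables (E : wcoef) (n : nat) (P : 'I_n -> ecpt) (w1 w2 : CC) (z : 'I_n -> CC).
Hypothesis oc : forall i, on_curve E (P i).
Hypothesis li : lin_indep E P.
Hypothesis hp : period_basis E w1 w2.
Hypothesis hc : forall i, corresponds E w1 w2 (z i) (P i).
Local Notation sg := (wsigma w1 w2).
Local Notation inL := (in_latt w1 w2).
Local Notation Y := (net_psi w1 w2 z).
Local Notation Pt v := (ec_lincomb E v P).
Local Notation e_ j := (delta_mx ord0 j : 'rV[int]_n).
Let hi : indep w1 w2 := period_indep _ _ _ hp.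

Definition net_arg (v : 'rV[int]_n) : CC := \sum_(i < n) (v ord0 i)%:~R * z i.

Lemma net_argD u v : net_arg (u + v) = net_arg u + net_arg v.
Proof. by rewrite /net_arg -big_split; apply: eq_bigr => i _; rewrite mxE rmorphD mulrDl. Qed.
Lemma net_argN u : net_arg (- u) = - net_arg u.
Proof. by rewrite /net_arg -sumrN; apply: eq_bigr => i _; rewrite mxE rmorphN mulNr. Qed.
Lemma net_argB u v : net_arg (u - v) = net_arg u - net_arg v.
Proof. by rewrite net_argD net_argN. Qed.
Lemma net_arg0 : net_arg 0 = 0.
Proof. by rewrite /net_arg big1 // => i _; rewrite mxE mul0r. Qed.
Lemma net_arg_delta j : net_arg (e_ j) = z j.
Proof.
rewrite /net_arg (bigD1 j) //= big1 ?addr0 => [|i ij]; first by rewrite mxE !eqxx mul1r.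
by rewrite mxE (negPf ij) andbF mul0r.
Qed.

Lemma param_arg v : param E w1 w2 (net_arg v) (Pt v).
Proof. by apply: (param_lincomb _ _ _ hp) => i; split. Qed.

Lemma net_arg_latt v : inL (net_arg v) <-> v = 0.
Proof.
split => [h|->]; last by rewrite net_arg0; exact: in_latt0.
by apply: li; case: (param_arg v) => c _; exact: (cor_uniq _ _ _ _ _ EInf c h).
Qed.

Lemma net_arg_notin v : v != 0 -> ~ inL (net_arg v).
Proof. by move=> /eqP v0 /net_arg_latt. Qed.

(** Both sides correspond to the same complex number, and [cor_uniq] identifies them; associativity
    and commutativity of [ec_add] are not involved. *)
Lemma ptD u v : Pt (u + v) = ec_add E (Pt u) (Pt v).
Proof.
have [c _] := param_arg (u + v); rewrite net_argD in c.
have [c' _] := param_add _ _ _ hp _ _ _ _ (param_arg u) (param_arg v).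
exact: (cor_uniq _ _ _ _ _ _ c c').
Qed.

Lemma ptN u : Pt (- u) = ec_neg E (Pt u).
Proof.
have [c _] := param_arg (- u); rewrite net_argN in c.
have [c' _] := param_neg _ _ _ hp _ _ (param_arg u).
exact: (cor_uniq _ _ _ _ _ _ c c').
Qed.

Lemma pt_delta j : Pt (e_ j) = P j.
Proof. by have [c _] := param_arg (e_ j); rewrite net_arg_delta in c; exact: (cor_uniq _ _ _ _ _ _ c (hc j)). Qed.

Lemma ptP v : v != 0 -> exists x y, Pt v = EPt x y.
Proof.
move=> /eqP v0; case e : (Pt v) => [|x y]; last by exists x, y.
by case: v0; exact: li.
Qed.

Lemma delta_neq0 j : e_ j != 0.
Proof. by apply/eqP => /matrixP /(_ ord0 j); rewrite !mxE !eqxx. Qed.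

Lemma deltaD_neq0 i j : e_ i + e_ j != 0.
Proof. by apply/eqP => /matrixP /(_ ord0 j); rewrite !mxE !eqxx /=; case: (j == i). Qed.

(** The factor of sigma in Psi without the constant -1 of the sign exponent: only a homogeneous
    quadratic exponent gives a quadratic map. *)
Definition net_coef (v : 'rV[int]_n) : CC :=
  (-1) ^ (\sum_(i < n) v ord0 i ^+ 2 - \sum_(i < n) \sum_(j < n | (i < j)%N) v ord0 i * v ord0 j)
  / ((\prod_(i < n) sg (z i) ^ (2 * v ord0 i ^+ 2 - \sum_(j < n) v ord0 i * v ord0 j))
     * \prod_(i < n) \prod_(j < n | (i < j)%N) sg (z i + z j) ^ (v ord0 i * v ord0 j)).

Lemma psiE v : Y v = - (net_coef v * sg (net_arg v)).
Proof.
rewrite /net_psi /net_coef -/(net_arg v) expfzDr ?oppr_eq0 ?oner_neq0 // -[(-1) ^ (-1)]/((-1)^-1) invrN1.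
have aux (s t d : CC) : s * -1 * t / d = - (s / d * t) by ring.
exact: aux.
Qed.

Lemma wsigma_z_neq0 i : sg (z i) != 0.
Proof. by apply: wsigma_neq0 => //; rewrite -net_arg_delta; apply: net_arg_notin; exact: delta_neq0. Qed.

Lemma net_coef_quad : quadmap _ _ net_coef.
Proof.
have qs i : quadform _ (fun v : 'rV[int]_n => v ord0 i ^+ 2).
  by split => [v|u v w]; rewrite !mxE; ring.
apply: quadmapM; first apply: quadmap_exp.
- by rewrite oppr_eq0 oner_neq0.
- apply: quadformB; apply: quadform_sum => i _ //.
  by apply: quadform_sum => j _; exact: quadform_coord.
apply: quadmapV; apply: quadmapM; apply: quadmap_prod => i _.
  apply: quadmap_exp; first exact: wsigma_z_neq0.
  apply: quadformB; first exact: quadform_scale.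
  by apply: quadform_sum => j _; exact: quadform_coord.
apply: quadmap_prod => j _; apply: quadmap_exp; last exact: quadform_coord.
by apply: wsigma_neq0 => //; rewrite -!net_arg_delta -net_argD; apply: net_arg_notin; exact: deltaD_neq0.
Qed.

Lemma psi0 : Y 0 = 0.
Proof. have s0 : sg (net_arg 0) = 0 by apply/(wsigma_eq0 _ _ hi)/net_arg_latt.
by rewrite psiE s0 mulr0 oppr0. Qed.

Lemma psi_neq0 v : v != 0 -> Y v != 0.
Proof.
move=> v0; have [k0 _ _] := net_coef_quad.
by rewrite psiE oppr_eq0 mulf_neq0 //; apply: wsigma_neq0 => //; exact: net_arg_notin.
Qed.

Lemma psiN v : Y (- v) = - Y v.
Proof. by have [_ kN _] := net_coef_quad; rewrite !psiE kN net_argN wsigma_odd // mulrN. Qed.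

Definition xp (Q : ecpt) : rat := if Q is EPt x _ then x else 0.
Lemma psi_par v w : v != 0 -> w != 0 -> Y (v + w) * Y (v - w) = Y v ^+ 2 * Y w ^+ 2 * ratr (xp (Pt w) - xp (Pt v)).
Proof.
move=> v0 w0; have [cv _] := param_arg v; have [cw _] := param_arg w.
have [x [y e]] := ptP v v0; have [x' [y' e']] := ptP w w0.
rewrite e in cv *; rewrite e' in cw *; move: cv cw => [lv [hx _]] [lw [hx' _]].
have ep : wp w1 w2 (net_arg v) - wp w1 w2 (net_arg w) = ratr x - ratr x' by rewrite hx hx'; ring.
have := wsigma_addB _ _ hi _ _ lv lw; rewrite ep => es.
have := quadmap_par _ _ _ v w net_coef_quad => ek.
rewrite !psiE net_argB net_argD /= rmorphB /=.
rewrite mulrNN mulrACA ek es; move: (net_coef v) (net_coef w) (sg _) (sg _) (ratr x : CC) (ratr x' : CC) => k1 k2 s1 s2 t1 t2.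
by ring.
Qed.

Definition ec_psi2 (Q : ecpt) : rat := if Q is EPt x y then 2 * y + (a1 E)%:~R * x + (a3 E)%:~R else 0.

Lemma psi_dup v : v != 0 -> Y (v + v) = Y v ^+ 4 * ratr (ec_psi2 (Pt v)).
Proof.
move=> v0; have [cv _] := param_arg v; have [x [y e]] := ptP v v0.
rewrite e in cv *; move: cv => [lv [hx hy]].
have p'E : wp' w1 w2 (net_arg v) = ratr (2 * y + (a1 E)%:~R * x + (a3 E)%:~R).
  by rewrite 2!rmorphD 2!rmorphM /= !ratr_int ratr_nat hy; field.
have es := wsigma_dbl _ _ hi _ lv; rewrite p'E mulr_natl mulr2n in es.
have [k0 kN kq] := net_coef_quad.
have k00 : net_coef 0 = 1.
  by apply: (mulfI (k0 0)); apply: (mulfI (k0 0)); apply: (mulfI (k0 0)); have := kq 0 0 0; rewrite !addr0 mulr1 !mulrA.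
have := quadmap_par _ _ _ v v net_coef_quad; rewrite subrr k00 mulr1 => ek.
by rewrite !psiE net_argD es ek /ec_psi2; ring.
Qed.

Lemma psi_delta i : Y (e_ i) = 1.
Proof.
have ve k : e_ i ord0 k = (k == i)%:Z by rewrite mxE eqxx natz.
have pr (k l : 'I_n) : (k < l)%N -> e_ i ord0 k * e_ i ord0 l = 0.
  move=> kl; rewrite !ve; case: (eqVneq k i) => [ki|]; last by rewrite mul0r.
  by case: (eqVneq l i) => [li'|]; [move: kl; rewrite ki li' ltnn|rewrite mulr0].
rewrite /net_psi -/(net_arg (e_ i)) net_arg_delta.
have -> : \sum_(k < n) e_ i ord0 k ^+ 2 = 1.
  by rewrite (bigD1 i) //= big1 ?addr0 => [|k /negPf ki]; rewrite ve ?eqxx ?ki.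
have -> : \sum_(k < n) \sum_(l < n | (k < l)%N) e_ i ord0 k * e_ i ord0 l = 0.
  by rewrite big1 // => k _; rewrite big1 // => l; exact: pr.
have -> : \prod_(k < n) \prod_(l < n | (k < l)%N) sg (z k + z l) ^ (e_ i ord0 k * e_ i ord0 l) = 1.
  by rewrite big1 // => k _; rewrite big1 // => l kl; rewrite pr.
have sm : \sum_(l < n) e_ i ord0 l = 1.
  by rewrite (bigD1 i) //= big1 ?addr0 => [|k /negPf ki]; rewrite ve ?eqxx ?ki.
have -> : \prod_(k < n) sg (z k) ^ (2 * e_ i ord0 k ^+ 2 - \sum_(l < n) e_ i ord0 k * e_ i ord0 l) =
    \prod_(k < n) sg (z k) ^ (k == i)%:Z.
  by apply: eq_bigr => k _; rewrite -mulr_sumr sm ve; case: (k == i).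
rewrite (bigD1 i) //= big1 => [|k /negPf ->] //.
by rewrite eqxx subr0 subrr expr0z mul1r !mulr1 expr1z divff // wsigma_z_neq0.
Qed.

Lemma psi_deltaD (i j : 'I_n) : (i < j)%N -> Y (e_ i + e_ j) = 1.
Proof.
move=> ij; have ne : (i == j) = false by apply/eqP => h; move: ij; rewrite h ltnn.
have ve k : (e_ i + e_ j) ord0 k = (k == i)%:Z + (k == j)%:Z by rewrite !mxE eqxx !natz.
have pr (k l : 'I_n) : (k < l)%N -> ~~ ((k == i) && (l == j)) -> (e_ i + e_ j) ord0 k * (e_ i + e_ j) ord0 l = 0.
  move=> kl; rewrite !ve; case: (eqVneq k i) => [ki|ki] /=.
    move=> /negPf ->; rewrite ki ne; case: (eqVneq l i) => [li'|]; last by rewrite mulr0.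
    by exfalso; move: kl; rewrite ki li' ltnn.
  move=> _; case: (eqVneq k j) => [kj|]; last by rewrite mul0r.
  case: (eqVneq l i) => [li'|]; last case: (eqVneq l j) => [lj|]; rewrite ?mulr0 //.
    by exfalso; move: kl; rewrite kj li' ltnNge (ltnW ij).
  by exfalso; move: kl; rewrite kj lj ltnn.
have vi : (e_ i + e_ j) ord0 i = 1 by rewrite ve eqxx ne.
have vj : (e_ i + e_ j) ord0 j = 1 by rewrite ve eqxx eq_sym ne.
rewrite /net_psi -/(net_arg (e_ i + e_ j)) net_argD !net_arg_delta.
have s1 (f : int -> int) : f 0 = 0 -> \sum_(k < n) f ((e_ i + e_ j) ord0 k) = f 1 + f 1.
  move=> f0; rewrite (bigD1 i) //= (bigD1 j) ?(eq_sym j) ?ne //= big1 ?addr0 ?vi ?vj //.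
  by move=> k /andP[/negPf ki /negPf kj]; rewrite ve ki kj.
rewrite (s1 (fun x => x ^+ 2)) //.
rewrite (big_pair _ _ _ _ i j (fun k l => (e_ i + e_ j) ord0 k * (e_ i + e_ j) ord0 l)) //.
rewrite (big_pair _ _ _ _ i j (fun k l => sg (z k + z l) ^ ((e_ i + e_ j) ord0 k * (e_ i + e_ j) ord0 l))) //; last first.
  by move=> k l kl h; rewrite pr.
have -> : \prod_(k < n) sg (z k) ^ (2 * (e_ i + e_ j) ord0 k ^+ 2 - \sum_(l < n) (e_ i + e_ j) ord0 k * (e_ i + e_ j) ord0 l) = 1.
  rewrite big1 // => k _; rewrite -mulr_sumr (s1 id) // ve.
  case: (eqVneq k i) => [->|_]; first by rewrite ne.
  by case: (eqVneq k j).
rewrite vi vj; have -> : (-1) ^ (1 ^+ 2 + 1 ^+ 2 - 1 * 1 - 1 : int) = 1 :> CC by [].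
rewrite !mul1r expr1z divff //.
by apply: wsigma_neq0 => //; rewrite -!net_arg_delta -net_argD; apply: net_arg_notin; exact: deltaD_neq0.
Qed.

(** * Reality of the net polynomials *)

Lemma x_neq v w : v != 0 -> w != 0 -> v + w != 0 -> v - w != 0 -> xp (Pt v) != xp (Pt w).
Proof.
move=> v0 w0 d s; apply/eqP => e; have := psi_par v w v0 w0; rewrite e subrr raddf0 mulr0 => /eqP.
by rewrite mulf_eq0 !(negPf (psi_neq0 _ _)).
Qed.

Lemma pt_on v : on_curve E (Pt v).
Proof. by case: (param_arg v). Qed.

Lemma real_of_sqr (t r : CC) : t ^+ 2 = r ^+ 2 -> r \is Num.real -> t \is Num.real.
Proof. by move=> /eqP; rewrite eqf_sqr => /orP[] /eqP -> //; rewrite rpredN. Qed.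

(** The parallelogram law for the pairs (v+b, c), (v+c, b) and (v, b-c): in the product of the first
    two divided by the third, the unknown values at v+b-c and v-b+c cancel, and [slope_alg] makes
    the quotient of the abscissa differences a square. *)
Lemma psi_real_gen v b c : v != 0 -> b != 0 -> c != 0 -> v + b != 0 -> v - b != 0 -> v + c != 0 -> v - c != 0 ->
  b + c != 0 -> b - c != 0 -> v + b - c != 0 -> v - b + c != 0 ->
  Y v \is Num.real -> Y b \is Num.real -> Y c \is Num.real -> Y (v + b) \is Num.real -> Y (v + c) \is Num.real ->
  Y (b - c) \is Num.real -> Y (v + b + c) \is Num.real.
Proof.
move=> v0 b0 c0 vb vb' vc vc' bc bc' d1 d2 rv rb rc rvb rvc rbc.
have nvb := x_neq _ _ v0 b0 vb vb'; have nvc := x_neq _ _ v0 c0 vc vc'; have nbc := x_neq _ _ b0 c0 bc bc'.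
have [xv [yv ev]] := ptP v v0; have [xb [yb eb]] := ptP b b0; have [xc [yc ec]] := ptP c c0.
have cv := pt_on v; have cb := pt_on b; have cc := pt_on c.
have Evb := ptD v b; have Evc := ptD v c; have Ebc := ptD b (- c).
rewrite ptN in Ebc; rewrite ev in nvb nvc cv Evb Evc; rewrite eb in nvb nbc cb Evb Ebc; rewrite ec in nvc nbc cc Evc Ebc.
rewrite /xp in nvb nvc nbc; rewrite ec_negE in Ebc.
rewrite ec_add_chord // in Evb; rewrite ec_add_chord // in Evc; rewrite ec_add_chord // in Ebc.
cbv zeta in Evb, Evc, Ebc.
have sl := slope_alg _ _ _ _ _ _ _ _ _ _ _ _ cv cb cc nvb nvc nbc; cbv zeta in sl.
have p1 := psi_par (v + b) c vb c0; have p2 := psi_par (v + c) b vc b0; have p3 := psi_par v (b - c) v0 bc'.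
rewrite [v + c + b]addrAC [v + c - b]addrAC in p2; rewrite opprB addrA [v + (c - b)]addrA in p3.
rewrite [v + c - b]addrAC in p3.
have n3 : Y (v + b - c) * Y (v - b + c) != 0 by rewrite mulf_neq0 // psi_neq0.
pose lb := (yb - yv) / (xb - xv); pose lc := (yc - yv) / (xc - xv).
pose X1 := xp (Pt c) - xp (Pt (v + b)); pose X2 := xp (Pt b) - xp (Pt (v + c)); pose X3 := xp (Pt (b - c)) - xp (Pt v).
rewrite -/X1 in p1; rewrite -/X2 in p2; rewrite -/X3 in p3.
have {}sl : X1 * X2 = (lb - lc) ^+ 2 * X3 by rewrite /X1 /X2 /X3 Evb Evc Ebc ev eb ec; exact: sl.
have n4 : ratr X3 != 0 :> CC by apply: contraNneq n3 => x3; rewrite p3 x3 mulr0.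
have yv0 := psi_neq0 _ v0; have ybc0 := psi_neq0 _ bc'.
apply: (real_of_sqr _ (Y (v + b) * Y c * (Y (v + c) * Y b) / (Y v * Y (b - c)) * ratr (lb - lc))).
  apply: (mulIf n3).
  transitivity ((Y (v + b + c) * Y (v + b - c)) * (Y (v + b + c) * Y (v - b + c))); first by ring.
  rewrite p1 p2 p3.
  have e12 : ratr X1 * ratr X2 = ratr (lb - lc) ^+ 2 * ratr X3 :> CC by rewrite -!rmorphM sl rmorphM rmorphXn.
  move: (ratr X1) (ratr X2) (ratr X3) (ratr (lb - lc)) e12 => s1 s2 s3 s4 e12.
  transitivity (Y (v + b) ^+ 2 * Y c ^+ 2 * (Y (v + c) ^+ 2 * Y b ^+ 2) * (s1 * s2)); first by ring.
  rewrite e12; move: (Y v) (Y (b - c)) yv0 ybc0 (Y (v + b)) (Y c) (Y (v + c)) (Y b) => y1 y2 n1 n2 y3 y4 y5 y6.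
  by field; rewrite n1 n2.
apply: rpredM; last exact: ratr_creal.
by apply: rpred_div; [apply: rpredM; exact: rpredM|exact: rpredM].
Qed.

Lemma psi_real_par v w : v != 0 -> w != 0 -> v - w != 0 -> Y v \is Num.real -> Y w \is Num.real -> Y (v - w) \is Num.real ->
  Y (v + w) \is Num.real.
Proof.
move=> v0 w0 d rv rw rd; have ny := psi_neq0 _ d.
rewrite -(mulfK ny (Y (v + w))) psi_par //; apply: rpred_div => //.
by apply: rpredM; [apply: rpredM; exact: rpredX|exact: ratr_creal].
Qed.

Lemma psi_real_dup v : Y v \is Num.real -> Y (v + v) \is Num.real.
Proof.
move=> rv; have [->|v0] := eqVneq v 0; first by rewrite addr0 psi0 rpred0.
by rewrite psi_dup //; apply: rpredM; [exact: rpredX|exact: ratr_creal].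
Qed.

(** The excluded positions of [psi_real_gen] are those where some vector vanishes; each of them
    collapses to an assumed value, to a doubling or to one parallelogram law. *)
Lemma psi_real_step v b c : b != 0 -> c != 0 ->
  Y v \is Num.real -> Y b \is Num.real -> Y c \is Num.real -> Y (v + b) \is Num.real -> Y (v + c) \is Num.real ->
  Y (b + c) \is Num.real -> Y (b - c) \is Num.real -> Y (v + b + c) \is Num.real.
Proof.
move=> b0 c0 rv rb rc rvb rvc rbc rbc'.
have rcb : Y (c - b) \is Num.real by rewrite -opprB psiN rpredN.
have [->|v0] := eqVneq v 0; first by rewrite add0r.
have [e|vb] := eqVneq (v + b) 0; first by rewrite e add0r.
have [e|vc] := eqVneq (v + c) 0; first by rewrite addrAC e add0r.
have [e|bc] := eqVneq (b + c) 0; first by rewrite -addrA e addr0.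
have [e|bc'] := eqVneq (b - c) 0.
  have -> : c = b by apply/eqP; rewrite eq_sym -subr_eq0 e.
  by apply: psi_real_par => //; rewrite addrK.
have [e|vb'] := eqVneq (v - b) 0.
  have vE : v = b by apply/eqP; rewrite -subr_eq0 e.
  rewrite vE in v0 rvc *; rewrite -addrA addrC; apply: psi_real_par => //; rewrite addrAC subrr add0r //.
have [e|vc'] := eqVneq (v - c) 0.
  have vE : v = c by apply/eqP; rewrite -subr_eq0 e.
  rewrite vE in v0 rvb *; apply: psi_real_par => //; first by rewrite addrC.
    by rewrite addrAC subrr add0r.
  by rewrite addrAC subrr add0r.
have [e|d1] := eqVneq (v + b - c) 0.
  have -> : v + b = c by apply/eqP; rewrite -subr_eq0 e.
  exact: psi_real_dup.
have [e|d2] := eqVneq (v - b + c) 0.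
  have -> : v + b + c = b + b by rewrite -[RHS](addr0) -e; rewrite [b + b]addrC; apply/eqP; rewrite -subr_eq0; apply/eqP/matrixP => i j; rewrite !mxE; ring.
  exact: psi_real_dup.
exact: psi_real_gen.
Qed.

Lemma psi_real v : Y v \is Num.real.
Proof.
have rd i : Y (e_ i) \is Num.real by rewrite psi_delta rpred1.
have rD i j : Y (e_ i + e_ j) \is Num.real.
  case: (ltngtP i j) => [ij|ij|/val_inj ->]; first by rewrite psi_deltaD ?rpred1.
    by rewrite addrC psi_deltaD ?rpred1.
  exact: psi_real_dup.
have rB i j : Y (e_ i - e_ j) \is Num.real.
  have [->|ij] := eqVneq i j; first by rewrite subrr psi0 rpred0.
  have ny := psi_neq0 _ (deltaD_neq0 i j).
  rewrite -(mulKf ny (Y (e_ i - e_ j))) psi_par ?delta_neq0 //.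
  by apply: rpredM; [rewrite rpredV|apply: rpredM; [apply: rpredM; exact: rpredX|exact: ratr_creal]].
have rN v' : Y v' \is Num.real -> Y (- v') \is Num.real by rewrite psiN rpredN.
have dN i : - e_ i != 0 by rewrite oppr_eq0 delta_neq0.
(* The induction carries the neighbours of v along, because a step to v + b + c uses the values at v
   + b and v + c. *)
suff [] : Y v \is Num.real /\ forall i, Y (v + e_ i) \is Num.real /\ Y (v - e_ i) \is Num.real by [].
elim/row_ind: v => [|v j [rv rs]].
  by split => [|i]; [rewrite psi0 rpred0|rewrite !add0r; split; auto].
have [r1 r2] := rs j.
have st b c : b \in [:: e_ j; - e_ j] -> (exists i, c \in [:: e_ i; - e_ i]) -> Y (v + b + c) \is Num.real.
  rewrite inE mem_seq1 => hb; case => i; have [r3 r4] := rs i; rewrite inE mem_seq1 => hc'.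
  case/orP: hb => /eqP ->; case/orP: hc' => /eqP ->; apply: psi_real_step; rewrite ?delta_neq0 ?dN ?opprK //; auto.
  - by rewrite addrC; apply: rB.
  - by rewrite -opprD; apply: rN.
  - by rewrite -opprD; apply: rN.
  - by rewrite addrC; apply: rB.
have me i : e_ i \in [:: e_ i; - e_ i] by rewrite mem_head.
have mn i : - e_ i \in [:: e_ i; - e_ i] by rewrite inE mem_seq1 eqxx orbT.
by split; split => [//|i]; split; apply: st; rewrite ?me ?mn //; exists i; rewrite ?me ?mn.
Qed.

Lemma creal_Re (c : CC) : c \is Num.real -> c = (complex.Re c)%:K.
Proof. by move=> h; rewrite RRe_real. Qed.

Lemma nm_ratr (q : rat) : nm (ratr q) = ratr `|q|.
Proof. by rewrite -(fmorph_rat (real_complex R)) nm_real ratr_norm. Qed.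

(** * The ratio of net polynomial and denominator *)

Local Notation den v := (ell_denom (Pt v)).

Lemma den_gt0 v : v != 0 -> (0 < den v)%N.
Proof.
move=> v0; have [x [y e]] := ptP v v0; have := pt_on v; rewrite e => c.
by have [D [D0 _ ->]] := curve_denom _ _ _ c.
Qed.

Definition dup_lowest_net (v : 'rV[int]_n) : bool := if Pt v is EPt x _ then dup_lowest E x else true.

(** The value 1 at 0 is the one that the cube law forces on a nowhere vanishing map. *)
Definition psi_ratio (v : 'rV[int]_n) : R := if v == 0 then 1 else nm (Y v) / (den v)%:R.

Lemma psi_ratioE v : v != 0 -> psi_ratio v = nm (Y v) / (den v)%:R.
Proof. by rewrite /psi_ratio => /negPf ->. Qed.

Lemma psi_ratio0 : psi_ratio 0 = 1.
Proof. by rewrite /psi_ratio eqxx. Qed.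

Lemma psi_ratio_gt0 v : 0 < psi_ratio v.
Proof.
have [->|v0] := eqVneq v 0; first by rewrite psi_ratio0.
by rewrite psi_ratioE // divr_gt0 ?nm_gt0 ?psi_neq0 // ltr0n den_gt0.
Qed.

Lemma psi_ratioN v : psi_ratio (- v) = psi_ratio v.
Proof.
have [->|v0] := eqVneq v 0; first by rewrite oppr0.
by rewrite !psi_ratioE ?oppr_eq0 // psiN nmN ptN; have [x [y ->]] := ptP v v0.
Qed.

Lemma dbl_neq0 (v : 'rV[int]_n) : v != 0 -> v + v != 0.
Proof.
apply: contra_neq => /matrixP h; apply/matrixP => i j.
by have := h i j; rewrite !mxE -mulr2n => /eqP; rewrite mulrn_eq0 /= => /eqP.
Qed.

Lemma psi_ratio_dup v : v != 0 -> dup_lowest_net v <-> psi_ratio (v + v) = psi_ratio v ^+ 4.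
Proof.
move=> v0; have v2 := dbl_neq0 v v0; have [x [y e]] := ptP v v0.
have c := pt_on v; have c2 := pt_on (v + v); have e2 := ptD v v.
have yd := psi_dup v v0; have y20 := psi_neq0 _ v2.
have ps0 : ec_psi2 (Pt v) != 0 by apply: contraNneq y20 => h; rewrite yd h raddf0 mulr0.
rewrite e in ps0 c e2 yd; have D := dup_denom E x y _ c c2 ps0 (esym e2).
rewrite /dup_lowest_net e; apply: (iff_trans D); rewrite !psi_ratioE // yd e nmM nmX nm_ratr.
have d1 : 0 < (ell_denom (EPt x y))%:R :> R by rewrite ltr0n -e den_gt0.
have d2 : 0 < (den (v + v))%:R :> R by rewrite ltr0n den_gt0.
have yv : 0 < nm (Y v) by rewrite nm_gt0 psi_neq0.
rewrite /ec_psi2; set t := `|_|; split => [h|h].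
  have -> : ratr t = (den (v + v))%:R / (ell_denom (EPt x y))%:R ^+ 4 :> R.
    apply: (canRL (mulfK _)); first by rewrite gt_eqF // exprn_gt0.
    by rewrite -(ratr_nat R (den _)) h rmorphM rmorphXn /= ratr_nat mulrC.
  by field; rewrite !gt_eqF.
apply: (fmorph_inj (ratr : {rmorphism rat -> R})); rewrite /= rmorphM rmorphXn /= !ratr_nat.
have y4 : nm (Y v) ^+ 4 != 0 by rewrite gt_eqF // exprn_gt0.
apply: (mulfI y4); move: h; move: (nm _) (ratr t) d1 d2 yv y4 => a b.
move: (_%:R) (_%:R) => s2 s1 d1 d2 a0 a4 /(congr1 (fun w => w * s2 * s1 ^+ 4)) /=.
have -> : a ^+ 4 * b / s2 * s2 * s1 ^+ 4 = a ^+ 4 * (s1 ^+ 4 * b) by field; rewrite gt_eqF.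
by move=> ->; field; rewrite gt_eqF.
Qed.

Lemma psi_ratio_par v w : dup_lowest_net v -> psi_ratio (w + v) * psi_ratio (w - v) = psi_ratio w ^+ 2 * psi_ratio v ^+ 2.
Proof.
move=> gv; have [->|v0] := eqVneq v 0; first by rewrite addr0 subr0 psi_ratio0 expr1n mulr1.
have [->|w0] := eqVneq w 0; first by rewrite add0r sub0r psi_ratioN psi_ratio0 expr1n mul1r.
have gd := proj1 (psi_ratio_dup v v0) gv.
(* For w = v or w = -v the chord formula does not apply, and the doubling law takes its place. *)
have [e|s] := eqVneq (w + v) 0.
  have -> : w = - v by apply/eqP; rewrite -addr_eq0 e.
  by rewrite addNr psi_ratio0 mul1r -opprD !psi_ratioN gd; ring.
have [e|d] := eqVneq (w - v) 0.
  have -> : w = v by apply/eqP; rewrite -subr_eq0 e.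
  by rewrite subrr psi_ratio0 mulr1 gd; ring.
rewrite -(psi_ratioN (w - v)) opprB (addrC w).
have d' : v - w != 0 by rewrite -opprB oppr_eq0.
have s' : v + w != 0 by rewrite addrC.
have [x [y e]] := ptP v v0; have [x' [y' e']] := ptP w w0.
have c := pt_on v; have c' := pt_on w; have cs := pt_on (v + w); have cd := pt_on (v - w).
have nx := x_neq _ _ v0 w0 s' d'; have es := ptD v w; have ed := ptD v (- w); rewrite ptN in ed.
have yp := psi_par v w v0 w0; have := gv; rewrite /dup_lowest_net e => gx.
rewrite e e' in nx es ed yp; rewrite e in c; rewrite e' in c'.
have D := chord_denom E x y x' y' _ _ c c' cs cd gx nx (esym es) (esym ed).
have yn := congr1 nm yp; rewrite nmM [RHS]nmM nm_ratr [nm (Y v ^+ 2 * _)]nmM !nmX in yn.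
have dn u : u != 0 -> (den u)%:R != 0 :> R by move=> u0; rewrite pnatr_eq0 -lt0n den_gt0.
have d1 := dn _ v0; have d2 := dn _ w0; have d3 := dn _ s'; have d4 := dn _ d'.
have {}D := congr1 (ratr : rat -> R) D.
rewrite -e -e' -natrX [RHS]rmorphM /= !ratr_nat natrX !natrM distrC in D; rewrite !psi_ratioE //.
have -> : nm (Y (v + w)) / (den (v + w))%:R * (nm (Y (v - w)) / (den (v - w))%:R) =
  nm (Y (v + w)) * nm (Y (v - w)) / ((den (v + w))%:R * (den (v - w))%:R) by field; rewrite d3 d4.
have n0 : ratr `|x' - x| != 0 :> R by rewrite fmorph_eq0 normr_eq0 subr_eq0 eq_sym.
by rewrite yn D; field; rewrite n0 d1 d2.
Qed.

Local Notation f v := (ln (psi_ratio v)).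

Lemma ln_psi_ratio_par v w : dup_lowest_net v -> f (w + v) + f (w - v) = 2 * f w + 2 * f v.
Proof.
move=> gv; have gp u : psi_ratio u \is Num.pos by rewrite posrE psi_ratio_gt0.
have := congr1 (@ln R) (psi_ratio_par v w gv).
by rewrite !expr2 !lnM ?posrE ?mulr_gt0 ?psi_ratio_gt0 // => ->; ring.
Qed.

(** With f the logarithm of the ratio, the laws at (2u+v, v), (u+v, u) and (u, u) combine linearly
    to f(2(u+v)) = 4 f(u+v), which by [psi_ratio_dup] is the lowest-terms condition at u + v. *)
Lemma dup_lowest_netD u v : dup_lowest_net u -> dup_lowest_net v -> dup_lowest_net (u + v).
Proof.
move=> gu gv; have [e|uv] := eqVneq (u + v) 0.
  by rewrite /dup_lowest_net; have [c _] := param_arg (u + v); move/net_arg_latt: (e); case: (Pt _) c => // x y [].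
apply/(psi_ratio_dup _ uv); apply: ln_inj; rewrite ?posrE ?exprn_gt0 ?psi_ratio_gt0 // lnXn ?psi_ratio_gt0 //.
have p1 := ln_psi_ratio_par v (u + u + v) gv; have p2 := ln_psi_ratio_par u (u + v) gu; have p3 := ln_psi_ratio_par u u gu.
rewrite subrr psi_ratio0 ln1 in p3; rewrite addrK in p1; rewrite [u + v - u]addrAC subrr add0r [u + v + u]addrAC in p2.
have -> : u + v + (u + v) = u + u + v + v by rewrite addrACA !addrA.
by rewrite -mulr_natl; lra.
Qed.

Lemma dup_lowest_netN v : dup_lowest_net v -> dup_lowest_net (- v).
Proof. by rewrite /dup_lowest_net ptN; case: (Pt v). Qed.

Hypothesis ns : forall (l : nat) (i : 'I_n), prime l -> nonsing_mod E l (P i).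

Lemma dup_lowest_net_all v : dup_lowest_net v.
Proof.
have gd j : dup_lowest_net (e_ j).
  rewrite /dup_lowest_net pt_delta; have := oc j; have := fun l => ns l j.
  case: (P j) => // x y hn c; exact: nonsing_dup_lowest c hn.
elim/row_ind: v => [|v j gv].
  have [c _] := param_arg 0; rewrite /dup_lowest_net; case: (Pt 0) c => // x y [].
  by rewrite net_arg0 => h; case: h; exact: in_latt0.
by split; apply: dup_lowest_netD => //; exact: dup_lowest_netN.
Qed.

(** The Jordan-von Neumann argument: four parallelogram laws give the cube law. One of them is taken
    at v - w, so the lowest-terms condition is required at arbitrary vectors. *)
Lemma psi_ratio_quad : quadmap _ _ psi_ratio.
Proof.
split => [v|v|u v w]; [by rewrite gt_eqF ?psi_ratio_gt0|exact: psi_ratioN|].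
apply: ln_inj; rewrite ?posrE ?mulr_gt0 ?psi_ratio_gt0 // !lnM ?posrE ?mulr_gt0 ?psi_ratio_gt0 //.
have p1 := ln_psi_ratio_par w (u + v) (dup_lowest_net_all w).
have p2 := ln_psi_ratio_par (v - w) u (dup_lowest_net_all _).
have p3 := ln_psi_ratio_par v (u + w) (dup_lowest_net_all v).
have p4 := ln_psi_ratio_par w v (dup_lowest_net_all w).
rewrite addrA opprB addrA in p2; rewrite [u + w + v]addrAC in p3.
rewrite [u + w - v]addrAC in p2 p3.
lra.
Qed.

Lemma netW_ratio v : ratr (netW E P w1 w2 z v) * psi_ratio v = complex.Re (Y v) :> R.
Proof.
rewrite /netW; have [->|v0] := eqVneq v 0; first by rewrite raddf0 mul0r psi0.
have dn : (den v)%:R != 0 :> R by rewrite pnatr_eq0 -lt0n den_gt0.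
have yr := creal_Re _ (psi_real v).
have aux (a b c : R) : b != 0 -> a * b * (c / b) = a * c by move=> b0; field.
rewrite psi_ratioE // [ratr _]rmorphM /= rmorph_sign ratr_nat aux // /parity.
by rewrite {2}yr nm_real -realEsign ?num_real.
Qed.

Lemma psi_net p q r s :
  Y (p + q + s) * Y (p - q) * Y (r + s) * Y r + Y (q + r + s) * Y (q - r) * Y (p + s) * Y p
  + Y (r + p + s) * Y (r - p) * Y (q + s) * Y q = 0.
Proof.
(* Shifting every argument by half of z_s makes the sums a + b + s and the differences a - b appear,
   and the fourth argument z_s / 2 produces c + s and c. *)
have := wsigma_three_term _ _ hi (net_arg p + net_arg s / 2) (net_arg q + net_arg s / 2) (net_arg r + net_arg s / 2) (net_arg s / 2).
have hD a b : a + net_arg s / 2 + (b + net_arg s / 2) = a + b + net_arg s by field.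
have hB a b : a + net_arg s / 2 - (b + net_arg s / 2) = a - b by ring.
have h1 a : a + net_arg s / 2 + net_arg s / 2 = a + net_arg s by field.
have h2 a : a + net_arg s / 2 - net_arg s / 2 = a by ring.
rewrite !hD !hB !h1 !h2 -!net_argD -!net_argB => e.
have T a b c : Y (a + b + s) * Y (a - b) * Y (c + s) * Y c =
  net_coef (a + b + s) * net_coef (a - b) * net_coef (c + s) * net_coef c *
  (sg (net_arg (a + b + s)) * sg (net_arg (a - b)) * (sg (net_arg (c + s)) * sg (net_arg c))).
  rewrite !psiE; move: (net_coef _) (net_coef _) (net_coef _) (net_coef _) (sg _) (sg _) (sg _) (sg _) => k1 k2 k3 k4 s1 s2 s3 s4.
  by ring.
rewrite !T !(quadmap_net _ _ _ _ _ _ _ net_coef_quad).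
have rot (x1 x2 x3 y1 y2 y3 t : CC) : x2 * x3 * x1 * (y2 * y3 * y1) / t = x1 * x2 * x3 * (y1 * y2 * y3) / t by ring.
rewrite (rot (net_coef q) (net_coef r) (net_coef p)) !(rot (net_coef p) (net_coef q) (net_coef r)).
have scale (k t1 t2 t3 : CC) : t1 + t2 + t3 = 0 -> k * t1 + k * t2 + k * t3 = 0 by move=> t0; rewrite -!mulrDr t0 mulr0.
exact: scale e.
Qed.

Lemma netW_net : elliptic_net (netW E P w1 w2 z).
Proof.
split => [|p q r s]; first by rewrite /netW eqxx.
set W := netW E P w1 w2 z.
apply: (fmorph_inj (ratr : {rmorphism rat -> R})); rewrite /= raddf0.
(* The common factor from [quadmap_net]; multiplication by it turns the recurrence for [W] into that
   for the real numbers Psi. *)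
pose M := psi_ratio p * psi_ratio q * psi_ratio r * (psi_ratio (p + s) * psi_ratio (q + s) * psi_ratio (r + s)) / psi_ratio s.
have M0 : M != 0 by rewrite !mulf_neq0 ?invr_eq0 ?gt_eqF ?psi_ratio_gt0.
apply: (mulIf M0); rewrite mul0r !rmorphD !mulrDl.
pose y v : R := complex.Re (Y v).
have T a b c : psi_ratio a * psi_ratio b * psi_ratio c * (psi_ratio (a + s) * psi_ratio (b + s) * psi_ratio (c + s)) / psi_ratio s = M ->
  ratr (W (a + b + s) * W (a - b) * W (c + s) * W c) * M = y (a + b + s) * y (a - b) * y (c + s) * y c.
  move=> <-; rewrite -(quadmap_net _ _ _ _ _ _ _ psi_ratio_quad) !rmorphM /= /y -!netW_ratio -/W.
  move: (ratr _) (ratr _) (ratr _) (ratr _) (psi_ratio _) (psi_ratio _) (psi_ratio _) (psi_ratio _) => *; ring.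
rewrite !T //; try by rewrite /M; move: (psi_ratio _) (psi_ratio _) (psi_ratio _) (psi_ratio _) (psi_ratio _) (psi_ratio _) (psi_ratio _) => *; ring.
have hy v : Y v = (y v)%:K by exact: creal_Re (psi_real v).
have := psi_net p q r s; rewrite !hy -!rmorphM -!rmorphD => /eqP.
by rewrite fmorph_eq0 => /eqP.
Qed.
End Net.

Theorem theorem1p16 (E : wcoef) (n : nat) (P : 'I_n -> ecpt)
    (w1 w2 : CC) (z : 'I_n -> CC) :
  disc E != 0 ->
  (forall i, on_curve E (P i)) ->
  lin_indep E P ->
  (forall (l : nat) (i : 'I_n), prime l -> nonsing_mod E l (P i)) ->
  period_basis E w1 w2 ->
  (forall i, corresponds E w1 w2 (z i) (P i)) ->
  elliptic_net (netW E P w1 w2 z).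
Proof. by move=> _ oc li ns hp hc; exact: netW_net. Qed.
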